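(* Let $\Sigma$ be a complete fan in $\mathbb{R}^n$, $\mathcal{P}$ its dual polytope and $X_{\mathcal{P}}$ the associated toric variety, with projection $p:X_{\mathcal{P}}\to\mathcal{P}$ and filtration $$X_{\mathcal{P}}=X_{2n}\supset X_{2(n-1)}\supset\dots\supset X_2\supset X_0,\qquad X_{2i}=p^{-1}(\mathcal{P}^i),$$ where $\mathcal{P}^i$ is the $i$-skeleton of $\mathcal{P}$. Then $X_{\mathcal{P}}$ is a ($2n$-dimensional) topological pseudomanifold with trivial link bundle.
   Context: Fans. A rational polyhedral cone in $\mathbb{R}^n$ is a set $\sigma=\{\sum x_i\nu_i : x_i\ge 0\}$ with finitely many $\nu_i\in\mathbb{Z}^n$; it is proper if it is not spanned by a proper subset of the $\nu_i$ and the $\nu_i$ lie strictly on one side of some hyperplane. A complete fan $\Sigma$ in $\mathbb{R}^n$ is a nonempty finite set of proper rational polyhedral cones, closed under taking faces, such that any two cones meet in a common face and the union of all cones is $\mathbb{R}^n$. The dual polytope $\mathcal{P}$ is the regular cell complex homeomorphic to the $n$-disc whose face poset is the face poset of $\Sigma$ with inclusions reversed; let $\delta:\mathcal{P}\to\Sigma$ be the inclusion-reversing bijection taking a $k$-dimensional face to its dual $(n-k)$-dimensional cone. Toric variety. Let $T^n=\mathbb{R}^n/\mathbb{Z}^n$, $\pi:\mathbb{R}^n\to T^n$ the projection, $V_\sigma$ the linear span of a cone $\sigma$. $X_{\mathcal{P}}$ is the quotient of $\mathcal{P}\times T^n$ obtained by collapsing, for every face $F$ and $x\in\operatorname{int}(F)$,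 $\{x\}\times T^n$ to $\{x\}\times T^n/\pi(V_{\delta(F)})$; $p$ is the induced projection. Topologically stratified spaces (inductive definition). A $0$-dimensional one is a countable discrete set. An $m$-dimensional one is a paracompact Hausdorff space $X$ with a filtration by closed subsets $X=X_m\supseteq X_{m-1}\supseteq\dots\supseteq X_0\supseteq X_{-1}=\emptyset$ such that each $x\in X_j-X_{j-1}$ has a neighborhood $N$, a compact $(m-j-1)$-dimensional topologically stratified space $\mathcal{L}$ (a link at $x$), and a homeomorphism $N\to\mathbb{R}^j\times\mathcal{C}(\mathcal{L})$ ($\mathcal{C}$ = open cone) taking $N\cap X_{j+i+1}$ onto $\mathbb{R}^j\times\mathcal{C}(\mathcal{L}_i)$ for $0\le i\le m-j-1$ and $N\cap X_j$ onto $\mathbb{R}^j\times\{\text{cone vertex}\}$. Missing odd-index terms of a filtration are filled in by $X_{2j+1}=X_{2j}$. Strata are connected components of $X_j-X_{j-1}$. An $m$-dimensional topological pseudomanifold is a paracompact Hausdorff space with such a stratification with $X_{m-1}=X_{m-2}$ and $X-X_{m-1}$ dense. Trivial link bundle: every stratum $S$ (here the strata are $p^{-1}(\operatorname{int}\tau)\cong\mathbb{R}^{\dim\tau}\times T^n/\pi(V_{\delta(\tau)})$ for the faces $\tau$ of $\mathcal{P}$) has an open neighborhood $N$ in $X=X_{\mathcal{P}}$ that is homeomorphic to the product $S\times\mathcal{C}(\mathcal{L})$ with $\mathcal{L}$ a link of $S$, by a homeomorphism which, writing $d=\dim S$ ($=2\dim\tau$), takes $N\cap X_{d+i+1}$ onto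 $S\times\mathcal{C}(\mathcal{L}_i)$ for $0\le i\le 2n-d-1$ and $N\cap X_d$ onto $S\times\{\text{cone vertex}\}$, with $S$ corresponding to $S\times\{\text{cone vertex}\}$. *)

(* Defs.v *)
(* The reals are an arbitrary R : realType, and R^k is 'rV[R]_k with its product
   topology. *)
From HB Require Import structures.
From mathcomp Require Import all_boot all_order all_algebra generic_quotient.
From mathcomp Require Import all_classical all_reals all_analysis.

Set Implicit Arguments.
Unset Strict Implicit.
Unset Printing Implicit Defensive.

Import Order.TTheory GRing.Theory Num.Theory.
Import numFieldNormedType.Exports.

Local Open Scope classical_set_scope.
Local Open Scope ring_scope.
Local Open Scope quotient_scope.

Definition homeomorphism {T U : topologicalType} (f : T -> U) : Prop :=
  exists g : U -> T, [/\ continuous f, continuous g, cancel f g & cancel g f].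

Definition paracompact (V : topologicalType) : Prop :=
  forall C : set (set V), C `<=` open -> \bigcup_(A in C) A = setT ->
  exists D : set (set V),
    [/\ D `<=` open, \bigcup_(B in D) B = setT,
        (forall B, D B -> exists2 A, C A & B `<=` A) &
        (forall x : V, exists2 W, nbhs x W &
           finite_set [set B | D B /\ B `&` W !=set0])].

(* The open cone on L is {apex} + L x [0,1[ with L x {0} identified with the
   apex.  The extra point makes the cone on the empty space a single point,
   as needed for the links of the top-dimensional strata. *)
Section OpenCone.
Variables (R : realType) (L : topologicalType).

Definition cone_piece (b : bool) : topologicalType :=
  if b then (L * (`[0, 1[%classic : set R))%type : topologicalType
  else discrete_topology unit.

Definition over_apex (c : {b : bool & cone_piece b}) : bool :=
  match c with
  | existT true lt => set_val lt.2 == 0 :> R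
  | existT false _ => true
  end.

Definition cone_eqb (c d : {b : bool & cone_piece b}) : bool :=
  (c == d) || (over_apex c && over_apex d).

Lemma cone_eqb_refl : reflexive cone_eqb.
Proof. by move=> c; rewrite /cone_eqb eqxx. Qed.

Lemma cone_eqb_sym : symmetric cone_eqb.
Proof. by move=> c d; rewrite /cone_eqb eq_sym andbC. Qed.

Lemma cone_eqb_trans : transitive cone_eqb.
Proof.
move=> d c e /orP[/eqP -> //|/andP[cA dA]] /orP[/eqP <-|/andP[_ eA]].
  by rewrite /cone_eqb cA dA orbT.
by rewrite /cone_eqb cA eA orbT.
Qed.

Definition cone_rel := EquivRel _ cone_eqb_refl cone_eqb_sym cone_eqb_trans.

Definition open_cone := {eq_quot cone_rel}.

HB.instance Definition _ :=
  Topological.copy open_cone (quotient_topology open_cone).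
HB.instance Definition _ := Quotient.on open_cone.

Definition cone_apex : open_cone := \pi_open_cone (existT cone_piece false tt).

Definition cone_pt (l : L) (t : (`[0, 1[%classic : set R)) : open_cone :=
  \pi_open_cone (existT cone_piece true (l, t)).

(* The cone on a subset of L; it always contains the apex. *)
Definition subcone (A : set L) : set open_cone :=
  [set c | c = cone_apex \/ exists l t, A l /\ c = cone_pt l t].

End OpenCone.

Section Stratifications.
Variable R : realType.

(* X_(k-1), with the convention that X_(-1) is empty. *)
Definition filt_pred (T : Type) (X : nat -> set T) (k : nat) : set T :=
  if k is k'.+1 then X k' else set0.

Definition filt_diff (T : Type) (X : nat -> set T) (j : nat) : set T :=
  X j `\` filt_pred X j.

(* f : N -> B x C(L) is a homeomorphism adapted to the filtrations, where X is
   an m-dimensional filtration and B has dimension j. *)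
Definition conical_chart (m : nat) (T : topologicalType) (X : nat -> set T)
    (j : nat) (B L : topologicalType) (LX : nat -> set L) (N : set T)
    (f : N -> (B * open_cone R L)%type) : Prop :=
  [/\ homeomorphism f,
      (forall i, (i < m - j)%N ->
         f @` [set y | X (j + i + 1)%N (set_val y)] =
         [set z | subcone (LX i) z.2]) &
      f @` [set y | X j (set_val y)] = [set z | z.2 = cone_apex R L]].

(* L, filtered by LX, is a link at the point x of X_j - X_(j-1).  The predicate
   strat k L LX reads "LX is a stratification of L of dimension k"; the space
   of dimension -1, which occurs for j = m, is the empty one. *)
Definition link_at (strat : nat -> forall L : topologicalType,
      (nat -> set L) -> Prop)
    (m : nat) (T : topologicalType) (X : nat -> set T) (j : nat) (x : T)
    (L : topologicalType) (LX : nat -> set L) : Prop :=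
  [/\ compact [set: L],
      (j < m)%N -> strat (m - j - 1)%N L LX,
      j = m -> [set: L] = set0 &
      exists (N : set T) (f : N -> ('rV[R]_j * open_cone R L)%type),
        nbhs x N /\ conical_chart m X j LX f].

(* Only X 0, ..., X m are relevant. *)
Inductive stratified (m : nat) (T : topologicalType) (X : nat -> set T)
    : Prop :=
| stratified_discrete of m = 0%N & countable [set: T]
    & (forall A : set T, open A) & X 0%N = setT
| stratified_cone of (0 < m)%N & paracompact T & hausdorff_space T
    & X m = setT
    & (forall i, (i < m)%N -> X i `<=` X i.+1)
    & (forall i, (i <= m)%N -> closed (X i))
    & (forall j x, (j <= m)%N -> filt_diff X j x ->
         exists (L : topologicalType) (LX : nat -> set L),
           link_at stratified m X j x LX).

Definition pseudomanifold (m : nat) (T : topologicalType) (X : nat -> set T)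
    : Prop :=
  [/\ paracompact T, hausdorff_space T, stratified m X,
      filt_pred X m = filt_pred X m.-1 & dense (~` filt_pred X m)].

Definition is_stratum (T : topologicalType) (X : nat -> set T) (j : nat)
    (S : set T) : Prop :=
  exists2 x, filt_diff X j x & S = connected_component (filt_diff X j) x.

Definition trivial_link_bundle (m : nat) (T : topologicalType)
    (X : nat -> set T) : Prop :=
  forall (d : nat) (S : set T), (d <= m)%N -> is_stratum X d S ->
  exists (L : topologicalType) (LX : nat -> set L) (N : set T)
         (f : N -> (S * open_cone R L)%type),
    [/\ forall x, S x -> link_at stratified m X d x LX,
        open N, S `<=` N,
        conical_chart m X d LX f &
        forall (y : N) (s : S),
          set_val y = set_val s -> f y = (s, cone_apex R L)].

End Stratifications.

Section Fans.
Variables (R : realType) (n : nat).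

Definition dotrv (u x : 'rV[R]_n) : R := \sum_i u 0 i * x 0 i.

Definition realrv (v : 'rV[int]_n) : 'rV[R]_n := map_mx intr v.

Definition cone_hull (s : seq 'rV[int]_n) : set 'rV[R]_n :=
  [set x | exists2 a : 'rV[int]_n -> R, (forall v, 0 <= a v) &
           x = \sum_(v <- s) a v *: realrv v].

(* The hyperplane in the last clause passes through the origin. *)
Definition proper_rational_cone (sigma : set 'rV[R]_n) : Prop :=
  exists s : seq 'rV[int]_n,
    [/\ sigma = cone_hull s,
        (forall t : seq 'rV[int]_n, {subset t <= s} ->
           cone_hull t = sigma -> {subset s <= t}) &
        exists u : 'rV[R]_n, forall v, v \in s -> 0 < dotrv u (realrv v)].

(* A cone is a face of itself (take u = 0). *)
Definition cone_face (tau sigma : set 'rV[R]_n) : Prop :=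
  exists2 u : 'rV[R]_n, (forall x, sigma x -> 0 <= dotrv u x) &
    tau = sigma `&` [set x | dotrv u x = 0].

Record complete_fan (Sigma : set (set 'rV[R]_n)) : Prop := CompleteFan {
  fan_nonempty : Sigma !=set0 ;
  fan_finite : finite_set Sigma ;
  fan_cones : forall sigma, Sigma sigma -> proper_rational_cone sigma ;
  fan_faces : forall sigma tau,
    Sigma sigma -> cone_face tau sigma -> Sigma tau ;
  fan_meet : forall sigma tau, Sigma sigma -> Sigma tau ->
    cone_face (sigma `&` tau) sigma /\ cone_face (sigma `&` tau) tau ;
  fan_cover : \bigcup_(sigma in Sigma) sigma = setT }.

(* The smallest linear subspace containing A; it always exists, so the default
   value 0 is never used. *)
Definition lin_span (A : set 'rV[R]_n) : {vspace 'rV[R]_n} :=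
  xget 0%VS [set V : {vspace 'rV[R]_n} | (forall x, A x -> x \in V) /\
                     forall W : {vspace 'rV[R]_n},
                       (forall x, A x -> x \in W) -> (V <= W)%VS].

End Fans.

Definition unit_disc (R : realType) (k : nat) : set 'rV[R]_k :=
  [set x | \sum_i x 0 i ^+ 2 <= 1].
Arguments unit_disc : clear implicits.

Definition unit_sphere (R : realType) (k : nat) : set 'rV[R]_k :=
  [set x | \sum_i x 0 i ^+ 2 = 1].
Arguments unit_sphere : clear implicits.

Section RegularCellComplexes.
Variables (R : realType) (P : topologicalType) (faces : set (set P)).

Definition face_bd (F : set P) : set P :=
  \bigcup_(G in [set G | faces G /\ G `<` F]) G.

Definition face_int (F : set P) : set P := F `\` face_bd F.

Definition is_cell (k : nat) (F : set P) : Prop :=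
  exists f : unit_disc R k -> F,
    homeomorphism f /\
    f @` [set x | unit_sphere R k (set_val x)] = [set y | face_bd F (set_val y)].

(* A finite regular cell complex, given by its closed cells: a closed cell is a
   disc whose boundary sphere is the union of the cells properly contained in
   it, and the cell interiors partition P.  Finiteness makes the weak topology
   condition automatic. *)
Definition regular_cell_complex : Prop :=
  [/\ hausdorff_space P, finite_set faces,
      (forall F, faces F -> exists k, is_cell k F) &
      forall x, exists! F, faces F /\ face_int F x].

Definition skeleton (i : nat) : set P :=
  \bigcup_(F in [set F | faces F /\ exists2 k, (k <= i)%N & is_cell k F]) F.

End RegularCellComplexes.

(* The regular cell complex is determined by the conditions below only up to a
   homeomorphism preserving the cells, so "dual polytope" is a property of the
   cell structure [faces] on P together with the bijection delta. *)
Record dual_polytope (R : realType) (n : nat) (Sigma : set (set 'rV[R]_n))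
    (P : topologicalType) (faces : set (set P))
    (delta : set P -> set 'rV[R]_n) : Prop := DualPolytope {
  dual_complex : regular_cell_complex R faces ;
  dual_disc : exists h : P -> unit_disc R n, homeomorphism h ;
  dual_bij : set_bij faces Sigma delta ;
  dual_anti : forall F G, faces F -> faces G ->
    (F `<=` G <-> delta G `<=` delta F) ;
  dual_dim : forall F k, faces F -> is_cell R faces k F ->
    (k + \dim (lin_span (delta F)))%N = n }.

Section Torus.
Variables (R : realType) (n : nat).

Definition lattice_eqb (x y : 'rV[R]_n) : bool :=
  `[< exists z : 'rV[int]_n, x - y = realrv R z >].

Lemma lattice_eqb_refl : reflexive lattice_eqb.
Proof. by move=> x; apply/asboolP; exists 0; rewrite subrr /realrv map_mx0. Qed.

Lemma lattice_eqb_sub x y : lattice_eqb x y -> lattice_eqb y x.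
Proof.
move=> /asboolP[z xyz]; apply/asboolP; exists (- z).
by rewrite /realrv map_mxN -/(realrv R z) -xyz opprB.
Qed.

Lemma lattice_eqb_sym : symmetric lattice_eqb.
Proof. by move=> x y; apply/idP/idP; exact: lattice_eqb_sub. Qed.

Lemma lattice_eqb_trans : transitive lattice_eqb.
Proof.
move=> y x z /asboolP[v xyv] /asboolP[w yzw]; apply/asboolP; exists (v + w).
rewrite /realrv map_mxD -/(realrv R v) -/(realrv R w) -xyv -yzw.
by rewrite addrA subrK.
Qed.

Definition lattice_rel :=
  EquivRel _ lattice_eqb_refl lattice_eqb_sym lattice_eqb_trans.

Definition torus := {eq_quot lattice_rel}.

HB.instance Definition _ := Topological.copy torus (quotient_topology torus).
HB.instance Definition _ := Quotient.on torus.

Definition torus_pi (x : 'rV[R]_n) : torus := \pi_torus x.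

(* t and s lie in the same coset of the subgroup pi(V). *)
Definition same_coset (V : {vspace 'rV[R]_n}) (t s : torus) : Prop :=
  exists x v, [/\ v \in V, t = torus_pi x & s = torus_pi (x + v)].

Lemma same_coset_refl V t : same_coset V t t.
Proof.
by exists (repr t), 0; rewrite mem0v addr0 /torus_pi reprK.
Qed.

Lemma same_coset_sym V t s : same_coset V t s -> same_coset V s t.
Proof.
by move=> [x [v [vV -> ->]]]; exists (x + v), (- v); rewrite memvN vV addrK.
Qed.

Lemma same_coset_trans V s t u :
  same_coset V t s -> same_coset V s u -> same_coset V t u.
Proof.
move=> [x [v [vV -> ->]]] [y [w [wV exy ->]]].
exists x, (v + w); rewrite memvD//; split => //; apply/eqmodP.
move: exy => /eqmodP/lattice_eqb_sub/asboolP[z yxz].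
by apply/asboolP; exists z; rewrite -yxz addrA opprD addrACA subrr addr0.
Qed.

End Torus.

Section ToricVariety.
Variables (R : realType) (n : nat) (P : topologicalType).
Variables (faces : set (set P)) (delta : set P -> set 'rV[R]_n).

(* When [faces] is a regular cell complex, exactly one F occurs in the
   conjunction below: the face with x in its interior. *)
Definition toric_eqb (a b : P * torus R n) : bool :=
  `[< a.1 = b.1 /\ forall F, faces F -> face_int faces F a.1 ->
        same_coset (lin_span (delta F)) a.2 b.2 >].

Lemma toric_eqb_refl : reflexive toric_eqb.
Proof. by move=> a; apply/asboolP; split=> // F _ _; exact: same_coset_refl. Qed.

Lemma toric_eqb_swap a b : toric_eqb a b -> toric_eqb b a.
Proof.
move=> /asboolP[ab H]; apply/asboolP; split=> // F FF; rewrite -ab => Fa.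
exact/same_coset_sym/H.
Qed.

Lemma toric_eqb_sym : symmetric toric_eqb.
Proof. by move=> a b; apply/idP/idP; exact: toric_eqb_swap. Qed.

Lemma toric_eqb_trans : transitive toric_eqb.
Proof.
move=> b a c /asboolP[ab H] /asboolP[bc K]; apply/asboolP.
split; first by rewrite ab.
move=> F FF Fa; apply: same_coset_trans (H F FF Fa) _.
by apply: K => //; rewrite -ab.
Qed.

Definition toric_rel := EquivRel _ toric_eqb_refl toric_eqb_sym toric_eqb_trans.

Definition toric_variety := {eq_quot toric_rel}.

HB.instance Definition _ :=
  Topological.copy toric_variety (quotient_topology toric_variety).
HB.instance Definition _ := Quotient.on toric_variety.

Definition toric_proj (x : toric_variety) : P := (repr x).1.

Lemma toric_projE (a : P * torus R n) :
  toric_proj (\pi_toric_variety a) = a.1.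
Proof.
by rewrite /toric_proj; case: piP => b /eqmodP/asboolP[].
Qed.

(* X_(2i) = X_(2i+1) = p^-1 of the i-skeleton. *)
Definition toric_filtration (k : nat) : set toric_variety :=
  toric_proj @^-1` skeleton R faces k./2.

End ToricVariety.
Arguments toric_filtration {R n P} faces delta k.

(* Main.v *)
Require Import Defs.
From mathcomp Require Import all_boot all_order all_algebra generic_quotient.
From mathcomp Require Import finmap all_classical all_reals all_analysis.
From mathcomp Require Import ring lra zify.

Set Implicit Arguments.
Unset Strict Implicit.
Unset Printing Implicit Defensive.

Import Order.TTheory GRing.Theory Num.Theory.
Import numFieldNormedType.Exports.

Local Open Scope classical_set_scope.
Local Open Scope ring_scope.
Local Open Scope quotient_scope.

(** The toric variety is compared with an explicit model in a Euclidean space.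

    Let the cones of the fan be the vertices of the order complex of the fan
    ordered by inclusion. A regular cell complex is the order complex of its
    face poset (cell_complex_model), so P becomes this complex, and the face
    dual to a cone becomes the union of the simplices whose vertices all
    contain that cone. Points of the toric variety are then pairs (a, t) of a
    point a of the complex and an element t of the torus, with t taken modulo
    the subtorus of the smallest cone in the support of a. The map Phi records
    a, together with the images of t in the quotient tori of the cones weighted
    by the coordinates of a; since the quotient variety is compact, Phi embeds
    it in a normed space (toric_emb_injective, toric_emb_continuous).

    The gain is a formula for the charts. If s is a vertex in the support of a,
    then a is the join of its part at or above s and of its part below s, and t
    splits into a class modulo the subtorus of s and an element of that
    subtorus. The first halves describe the stratum of s and the second halves
    the cone on a space of the same kind, built from the proper faces of s and
    from its span; this is the link (chart_hom). The chart is defined over the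
    whole stratum at once, which is the triviality of the link bundle, and as
    the link has the form of the model again, the inductive definition of a
    stratified space is met by induction on the dimension of the cones
    (model_stratified).

    The induction needs that strata are locally Euclidean, in the variety and
    in all links. The torus factor is a standard torus because the integral
    points of a rational subspace have a complement (saturation_split,
    lattice_complement). The other factor is an open dual cell of the order
    complex. In P it is the interior of a face, hence a ball. In the link of a
    cone t it is the dual cell of a proper face s of t: the centers of the cones
    strictly between s and t, taken along chains, subdivide the boundary of t
    modulo s, and this boundary projects from the center of t onto the space
    V t / (V s + R b t), where b t is that center (between_hom). That every
    vector has such a decomposition, and only one, follows from the description
    of cones by finitely many inequalities (cone_hull_halfspaces,
    center_decomp_exists, center_decomp_uniq).

    Finally the strata are the connected components required, being star-shaped
    and separated from each other by the coordinates of the model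
    (is_stratum_model), and the stratum of the zero cone is dense
    (model_dense). *)

(** * Continuity and homeomorphisms on subsets *)

Section SetLevelTopology.

Lemma nbhsS (T : topologicalType) (x : T) (P Q : set T) :
  (forall y, P y -> Q y) -> nbhs x P -> nbhs x Q.
Proof. by move=> PQ; exact: filterS. Qed.

(** Maps that matter only on a subset are kept as total functions, so that
    charts can be composed without transport between subspace types. *)
Definition cont_on (T U : topologicalType) (A : set T) (f : T -> U) : Prop :=
  forall x, A x -> f @ within A (nbhs x) --> f x.

Lemma cont_on_near (T U : topologicalType) (A : set T) (f : T -> U) x (O : set U) :
  cont_on A f -> A x -> nbhs (f x) O -> \forall y \near x, A y -> O (f y).
Proof. by move=> cf Ax /(cf x Ax). Qed.

Definition hom_on (T U : topologicalType) (A : set T) (B : set U)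
    (f : T -> U) (g : U -> T) : Prop :=
  [/\ cont_on A f, cont_on B g,
      forall x, A x -> B (f x) /\ g (f x) = x &
      forall y, B y -> A (g y) /\ f (g y) = y].

Lemma continuous_cont_on (T U : topologicalType) (A : set T) (f : T -> U) :
  continuous f -> cont_on A f.
Proof. by move=> fc x Ax; apply: cvg_within_filter; exact: fc. Qed.

Lemma cont_on_setT (T U : topologicalType) (h : T -> U) :
  cont_on setT h -> continuous h.
Proof.
move=> ch x O Oh; have := ch x I O Oh; rewrite /= !nbhs_simpl /within /=.
by apply: filterS => y; exact.
Qed.

Lemma cont_on_sub (T U : topologicalType) (A B : set T) (f : T -> U) :
  A `<=` B -> cont_on B f -> cont_on A f.
Proof.
move=> AB fc x Ax O Of; have := fc x (AB _ Ax) O Of.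
by rewrite /= !nbhs_simpl /within /=; apply: filterS => y + Ay; apply; exact: AB.
Qed.

Lemma cont_on_eq (T U : topologicalType) (A : set T) (f g : T -> U) :
  (forall x, A x -> f x = g x) -> cont_on A f -> cont_on A g.
Proof.
move=> fg fc x Ax O; rewrite -fg// => /(fc x Ax).
rewrite /= !nbhs_simpl /within /=; apply: filterS => y + Ay.
by rewrite fg//; exact.
Qed.

Lemma cont_on_comp (T U V : topologicalType) (A : set T) (B : set U)
    (f : T -> U) (g : U -> V) :
  cont_on A f -> (forall x, A x -> B (f x)) -> cont_on B g ->
  cont_on A (g \o f).
Proof.
move=> fc AB gc x Ax O /(gc _ (AB _ Ax)); rewrite /= !nbhs_simpl /within /=.
move=> /(fc x Ax); rewrite /= !nbhs_simpl /within /=; apply: filterS => y H Ay.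
exact: H (AB _ Ay).
Qed.

Lemma cont_on_pair (T U V : topologicalType) (A : set T)
    (f : T -> U) (g : T -> V) :
  cont_on A f -> cont_on A g -> cont_on A (fun x => (f x, g x)).
Proof. by move=> fc gc x Ax; apply: cvg_pair; [exact: fc|exact: gc]. Qed.

Lemma cont_on_comp_continuous (T U V : topologicalType) (A : set T)
    (f : T -> U) (g : U -> V) :
  cont_on A f -> continuous g -> cont_on A (fun x => g (f x)).
Proof.
move=> cf cg; apply: (cont_on_comp (B := setT) (g := g) cf) => //.
exact: continuous_cont_on.
Qed.

Lemma cont_on_fst (T U V : topologicalType) (A : set T) (f : T -> U * V) :
  cont_on A f -> cont_on A (fun x => (f x).1).
Proof.
by move=> cf; apply: (cont_on_comp_continuous (g := fst) cf) => ?; exact: cvg_fst.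
Qed.

Lemma cont_on_snd (T U V : topologicalType) (A : set T) (f : T -> U * V) :
  cont_on A f -> cont_on A (fun x => (f x).2).
Proof.
by move=> cf; apply: (cont_on_comp_continuous (g := snd) cf) => ?; exact: cvg_snd.
Qed.

Lemma cont_on_id (T : topologicalType) (A : set T) : cont_on A id.
Proof. by apply: continuous_cont_on => x; exact: cvg_id. Qed.

Lemma cont_on_proj1 (T U : topologicalType) (A : set (T * U)) : cont_on A fst.
Proof. by apply: (cont_on_fst (f := id)); exact: cont_on_id. Qed.

Lemma cont_on_proj2 (T U : topologicalType) (A : set (T * U)) : cont_on A snd.
Proof. by apply: (cont_on_snd (f := id)); exact: cont_on_id. Qed.

Lemma cont_on_cst (T U : topologicalType) (A : set T) (c : U) :
  cont_on A (fun=> c).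
Proof. by apply: continuous_cont_on => x; exact: cvg_cst. Qed.

Lemma hom_on_sym (T U : topologicalType) (A : set T) (B : set U) f g :
  hom_on A B f g -> hom_on B A g f.
Proof. by case. Qed.

Lemma hom_on_comp (T U V : topologicalType) (A : set T) (B : set U) (C : set V)
    f g f' g' :
  hom_on A B f g -> hom_on B C f' g' -> hom_on A C (f' \o f) (g \o g').
Proof.
move=> [cf cg fg gf] [cf' cg' fg' gf']; split.
- by apply: (cont_on_comp cf _ cf') => x /fg[].
- by apply: (cont_on_comp cg' _ cg) => x /gf'[].
- by move=> x /fg[Bfx gfx]; have [? e] := fg' _ Bfx; split=> //=; rewrite e.
- by move=> x /gf'[Bfx gfx]; have [? e] := gf _ Bfx; split=> //=; rewrite e.
Qed.

Lemma hom_on_pair (T U T' U' : topologicalType) (A : set T) (B : set U)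
    (A' : set T') (B' : set U') f g f' g' :
  hom_on A B f g -> hom_on A' B' f' g' ->
  hom_on (A `*` A') (B `*` B') (fun x => (f x.1, f' x.2))
         (fun x => (g x.1, g' x.2)).
Proof.
move=> [cf cg fg gf] [cf' cg' fg' gf']; split.
- apply: cont_on_pair.
    by apply: (cont_on_comp (f := fst) (B := A)) => //; [exact: cont_on_proj1|move=> x []].
  by apply: (cont_on_comp (f := snd) (B := A')) => //; [exact: cont_on_proj2|move=> x []].
- apply: cont_on_pair.
    by apply: (cont_on_comp (f := fst) (B := B)) => //; [exact: cont_on_proj1|move=> x []].
  by apply: (cont_on_comp (f := snd) (B := B')) => //; [exact: cont_on_proj2|move=> x []].
- by move=> [x x'] [/= /fg[? e] /fg'[? e']]; split=> //=; rewrite e e'.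
- by move=> [x x'] [/= /gf[? e] /gf'[? e']]; split=> //=; rewrite e e'.
Qed.

Lemma hom_on_sub (T U : topologicalType) (A A' : set T) (B B' : set U) f g :
  hom_on A B f g -> A' `<=` A -> B' `<=` B ->
  (forall x, A' x -> B' (f x)) -> (forall y, B' y -> A' (g y)) ->
  hom_on A' B' f g.
Proof.
move=> [cf cg fg gf] AA BB AB BA; split.
- exact: cont_on_sub cf.
- exact: cont_on_sub cg.
- by move=> x A'x; split; [exact: AB|case: (fg x (AA _ A'x))].
- by move=> x A'x; split; [exact: BA|case: (gf x (BB _ A'x))].
Qed.

(** Points of Y close to y only have preimages in K close to the fibre of y:
    otherwise the bad preimages would cluster at a point of the fibre. *)
Lemma compact_fiber_near (T Y : topologicalType) (K : set T) (phi : T -> Y)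
    (y : Y) (O : set T) :
  hausdorff_space Y -> compact K -> cont_on K phi ->
  (forall k, K k -> phi k = y -> \forall k' \near k, K k' -> O k') ->
  \forall y' \near y, forall k, K k -> phi k = y' -> O k.
Proof.
move=> hY cK cphi HO; apply: contrapT => notO.
pose G := filter_from (nbhs y)
  (fun W => [set k | [/\ K k, W (phi k) & ~ O k]]).
have GF : ProperFilter G.
  apply: filter_from_proper.
    apply: filter_from_filter; first by exists setT; exact: filterT.
    move=> W1 W2 h1 h2; exists (W1 `&` W2); first exact: filterI.
    by move=> k [Kk [? ?] nO]; split; split.
  move=> W Wy; apply: contrapT => H; apply: notO.
  apply: filterS Wy => y' Wy' k Kk e; apply: contrapT => nOk; apply: H.
  by exists k; split=> //; rewrite e.
have GK : G K by exists setT; [exact: filterT|move=> k []].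
have [k [Kk kG]] := cK G GF GK.
have e : phi k = y.
  apply: hY => U W Uk Wy.
  have := cphi k Kk U Uk; rewrite /= !nbhs_simpl /within /= => H.
  have GW : G [set k | [/\ K k, W (phi k) & ~ O k]] by exists W.
  have [k' [[Kk' Wk' _] Uk']] := kG _ _ GW H.
  by exists (phi k'); split=> //; exact: Uk'.
have GW : G [set k | [/\ K k, setT (phi k) & ~ O k]].
  by exists setT => //; exact: filterT.
by have [k' [[Kk' _ nO] /(_ Kk')]] := kG _ _ GW (HO k Kk e).
Qed.

(** A compact parametrization of a Hausdorff space is a quotient map. *)
Lemma compact_param_cont (T Y Z : topologicalType) (K : set T) (phi : T -> Y)
    (D : set Y) (g : Y -> Z) (psi : T -> Z) :
  hausdorff_space Y -> compact K -> cont_on K phi ->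
  cont_on (K `&` phi @^-1` D) psi ->
  (forall y, D y -> exists2 k, K k & phi k = y) ->
  (forall k, K k -> D (phi k) -> g (phi k) = psi k) ->
  cont_on D g.
Proof.
move=> hY cK cphi cpsi Dsurj gpsi y Dy O Og.
have H : forall k, K k -> phi k = y ->
    \forall k' \near k, K k' -> (D (phi k') -> O (psi k')).
  move=> k Kk ek; have Dk : D (phi k) by rewrite ek.
  have : nbhs (psi k) O by rewrite -gpsi// ek.
  move=> /(cpsi k (conj Kk Dk)); rewrite /= !nbhs_simpl /within /=.
  by apply: filterS => k' + Kk' Dk'; apply.
have := compact_fiber_near (O := [set k | D (phi k) -> O (psi k)]) hY cK cphi H.
rewrite /= !nbhs_simpl /within /=; apply: filterS => y' WO Dy'.
have [k Kk ek] := Dsurj _ Dy'.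
by rewrite /= -ek gpsi// ?ek//; apply: (WO k) => //; rewrite ek.
Qed.

(** The space itself is a compact parametrization of its image. *)
Lemma compact_injection_hom (T Y : topologicalType) (x0 : T) (iota : T -> Y) :
  hausdorff_space Y -> compact [set: T] -> continuous iota -> injective iota ->
  exists g, hom_on [set: T] (range iota) iota g.
Proof.
move=> hY cT ic iI.
have /choice[g gE] : forall y : Y, exists x, range iota y -> iota x = y.
  move=> y; have [[x _ <-]|no] := pselect (range iota y); first by exists x.
  by exists x0.
exists g; split.
- exact: continuous_cont_on.
- apply: (@compact_param_cont _ _ _ [set: T] iota _ g id) => //.
  + exact: continuous_cont_on.
  + exact: cont_on_id.
  + by move=> x _ rx; apply: iI; rewrite gE.
- by move=> x _; split; [exists x|apply: iI; rewrite gE].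
- by move=> y ry; split=> //; exact: gE.
Qed.

Lemma cont_on_local (T U : topologicalType) (A : set T) (f : T -> U) :
  (forall x, A x -> exists2 D : set T, nbhs x D & cont_on (A `&` D) f) ->
  cont_on A f.
Proof.
move=> H x Ax O Of; have [D Dx cD] := H x Ax.
have := cont_on_near cD (conj Ax (nbhs_singleton Dx)) Of.
rewrite /= !nbhs_simpl /within /= => H'.
by apply: filterS2 Dx H' => y Dy + Ay; apply.
Qed.

(** For maps given by formulas in the parameters only: the formulas psi1 and
    psi2 hold on D1 and D2, which may extend beyond the compact sets K1 and K2
    that make the maps continuous. *)
Lemma hom_on_of_params (T1 T2 Y1 Y2 : topologicalType)
    (K1 D1 : set T1) (K2 D2 : set T2) (A : set Y1) (B : set Y2)
    (y1 : Y1) (y2 : Y2) (phi1 : T1 -> Y1) (phi2 : T2 -> Y2) (psi1 : T1 -> Y2) (psi2 : T2 -> Y1) :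
  hausdorff_space Y1 -> hausdorff_space Y2 -> compact K1 -> compact K2 ->
  cont_on K1 phi1 -> cont_on K2 phi2 ->
  K1 `&` phi1 @^-1` A `<=` D1 -> K2 `&` phi2 @^-1` B `<=` D2 ->
  (forall k, D1 k -> A (phi1 k)) -> (forall k, D2 k -> B (phi2 k)) ->
  (forall y, A y -> exists2 k, K1 k & phi1 k = y) ->
  (forall y, B y -> exists2 k, K2 k & phi2 k = y) ->
  cont_on (K1 `&` D1) psi1 -> cont_on (K2 `&` D2) psi2 ->
  (forall k k', D1 k -> D1 k' -> phi1 k = phi1 k' -> psi1 k = psi1 k') ->
  (forall k k', D2 k -> D2 k' -> phi2 k = phi2 k' -> psi2 k = psi2 k') ->
  (forall k, D1 k -> exists2 k', D2 k' & phi2 k' = psi1 k /\ psi2 k' = phi1 k) ->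
  (forall k, D2 k -> exists2 k', D1 k' & phi1 k' = psi2 k /\ psi1 k' = phi2 k) ->
  exists f g, [/\ hom_on A B f g,
    (forall k, D1 k -> f (phi1 k) = psi1 k) &
    (forall k, D2 k -> g (phi2 k) = psi2 k)].
Proof.
move=> hY1 hY2 cK1 cK2 cphi1 cphi2 KD1 KD2 D1A D2B AK BK cpsi1 cpsi2.
move=> wd1 wd2 m12 m21.
have lift (S Y Z : topologicalType) (z0 : Z) (D : set S) (phi : S -> Y)
    (psi : S -> Z) : (forall k k', D k -> D k' -> phi k = phi k' -> psi k = psi k') ->
    exists f : Y -> Z, forall k, D k -> f (phi k) = psi k.
  move=> wd; suff /choice[f fE] : forall y : Y,
      exists z : Z, forall k, D k -> phi k = y -> z = psi k.
    by exists f => k Dk; exact: fE.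
  move=> y; have [[k Dk <-]|noy] := pselect (exists2 k, D k & phi k = y).
    by exists (psi k) => k' Dk' e; exact: wd.
  by exists z0 => k Dk e; case: noy; exists k.
have [f fE] := lift _ _ _ y2 _ _ _ wd1.
have [g gE] := lift _ _ _ y1 _ _ _ wd2.
exists f, g; split=> //; split.
- apply: (@compact_param_cont _ _ _ K1 phi1 A f psi1) => //.
    by apply: cont_on_sub cpsi1 => k Kk; split; [case: Kk|exact: KD1].
  by move=> k Kk Ak; apply: fE; exact: KD1.
- apply: (@compact_param_cont _ _ _ K2 phi2 B g psi2) => //.
    by apply: cont_on_sub cpsi2 => k Kk; split; [case: Kk|exact: KD2].
  by move=> k Kk Ak; apply: gE; exact: KD2.
- move=> y Ay; have [k Kk ek] := AK _ Ay.
  have Dk : D1 k by apply: KD1; split=> //=; rewrite ek.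
  have [k' Dk' [e1 e2]] := m12 _ Dk.
  by rewrite -ek fE// -e1; split; [exact: D2B|rewrite gE].
- move=> y By; have [k Kk ek] := BK _ By.
  have Dk : D2 k by apply: KD2; split=> //=; rewrite ek.
  have [k' Dk' [e1 e2]] := m21 _ Dk.
  by rewrite -ek gE// -e1; split; [exact: D1A|rewrite fE].
Qed.

(** A has its subspace topology, so N is only a neighbourhood of x in A. *)
Definition loc_euclidean (R : realType) (k : nat) (T : topologicalType)
    (A : set T) : Prop :=
  forall x, A x -> exists (N : set T) (f : T -> 'rV[R]_k) (g : 'rV[R]_k -> T),
    [/\ N `<=` A, (\forall y \near x, A y -> N y) & hom_on N setT f g].

Lemma loc_euclidean_hom (R : realType) k (T U : topologicalType) (A : set T)
    (B : set U) f g :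
  hom_on A B f g -> loc_euclidean R k B -> loc_euclidean R k A.
Proof.
move=> fg eB x Ax; have [cf cg fgx gfx] := fg.
have [Bfx gfxx] := fgx _ Ax.
have [N [p [q [NB Nx pq]]]] := eB _ Bfx.
exists (A `&` f @^-1` N), (p \o f), (g \o q); split.
- by move=> y [].
- have := cf _ Ax _ Nx; rewrite /= !nbhs_simpl /within /=.
  by apply: filterS => y H Ay; split=> //; apply: H => //; case: (fgx _ Ay).
- apply: (hom_on_comp (B := N)) => //.
  apply: (hom_on_sub fg) => //; try by move=> y [].
  move=> y Ny; have [? e] := gfx _ (NB _ Ny).
  by split=> //; rewrite /preimage/= e.
Qed.

Lemma cvg_mx (S : Type) (F : set_system S) (FF : Filter F) m n
    (U : topologicalType) (f : S -> 'M[U]_(m, n)) (M : 'M[U]_(m, n)) :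
  (forall i j, (fun x => f x i j) @ F --> M i j) -> f @ F --> M.
Proof.
move=> H A [P MP PA]; rewrite /= nbhs_simpl /=.
suff : \forall x \near F, forall i j, P i j (f x i j).
  by apply: filterS => x Px; exact: PA.
by apply: filter_forall => i; apply: filter_forall => j; exact: H (MP i j).
Qed.

Lemma cont_on_mx (T : topologicalType) (A : set T) m n (U : topologicalType)
    (f : T -> 'M[U]_(m, n)) :
  (forall i j, cont_on A (fun x => f x i j)) -> cont_on A f.
Proof. by move=> H x Ax; apply: cvg_mx => i j; exact: H. Qed.

Lemma cont_on_coord (R : realType) (T : topologicalType) (A : set T) m n
    (f : T -> 'M[R]_(m, n)) i j :
  cont_on A f -> cont_on A (fun x => f x i j).
Proof.
move=> cf; apply: (cont_on_comp_continuous (g := fun M : 'M[R]_(m, n) => M i j) cf).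
exact: coord_continuous.
Qed.

Section RealValued.
Variables (R : realType) (T : topologicalType) (A : set T).

Lemma cont_onD (V : normedModType R) (f g : T -> V) :
  cont_on A f -> cont_on A g -> cont_on A (fun x => f x + g x).
Proof. by move=> cf cg x Ax; apply: cvgD; [exact: cf|exact: cg]. Qed.

Lemma cont_onB (V : normedModType R) (f g : T -> V) :
  cont_on A f -> cont_on A g -> cont_on A (fun x => f x - g x).
Proof. by move=> cf cg x Ax; apply: cvgB; [exact: cf|exact: cg]. Qed.

Lemma cont_onM (f g : T -> R) :
  cont_on A f -> cont_on A g -> cont_on A (fun x => f x * g x).
Proof. by move=> cf cg x Ax; apply: cvgM; [exact: cf|exact: cg]. Qed.

Lemma cont_onZ (V : normedModType R) (f : T -> R) (g : T -> V) :
  cont_on A f -> cont_on A g -> cont_on A (fun x => f x *: g x).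
Proof. by move=> cf cg x Ax; apply: cvgZ; [exact: cf|exact: cg]. Qed.

Lemma cont_onV (f : T -> R) :
  (forall x, A x -> f x != 0) ->
  cont_on A f -> cont_on A (fun x => (f x)^-1).
Proof. by move=> f0 cf x Ax; apply: cvgV; [exact: f0|exact: cf]. Qed.

Lemma cont_on_norm (V : normedModType R) (f : T -> V) :
  cont_on A f -> cont_on A (fun x => `|f x|).
Proof. by move=> cf x Ax; apply: cvg_norm; exact: cf. Qed.

Lemma cont_on_sum (V : normedModType R) (I : Type) (r : seq I) (P : pred I)
    (f : I -> T -> V) :
  (forall i, P i -> cont_on A (f i)) ->
  cont_on A (fun x => \sum_(i <- r | P i) f i x).
Proof.
move=> cf; elim: r => [|i r IH].
  apply: (@cont_on_eq _ _ _ (fun=> 0)); first by move=> x _; rewrite big_nil.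
  exact: cont_on_cst.
have [Pi|nPi] := boolP (P i).
  apply: (@cont_on_eq _ _ _ (fun x => f i x + \sum_(i <- r | P i) f i x)).
    by move=> x _; rewrite big_cons Pi.
  by apply: cont_onD => //; exact: cf.
apply: cont_on_eq IH => x _; by rewrite big_cons (negbTE nPi).
Qed.

Lemma cont_on_mulmx m n p (f : T -> 'M[R]_(m, n)) (M : 'M[R]_(n, p)) :
  cont_on A f -> cont_on A (fun x => f x *m M).
Proof.
move=> cf; apply: cont_on_mx => i j.
apply: (@cont_on_eq _ _ _ (fun x => \sum_k f x i k * M k j)).
  by move=> x _; rewrite mxE.
apply: cont_on_sum => k _; apply: cont_onM; last exact: cont_on_cst.
exact: cont_on_coord.
Qed.

End RealValued.

Lemma hom_on_row_mx (R : realType) (a b : nat) :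
  hom_on [set: 'rV[R]_a * 'rV[R]_b] [set: 'rV[R]_(a + b)]
    (fun x => row_mx x.1 x.2) (fun y => (lsubmx y, rsubmx y)).
Proof.
split.
- apply: cont_on_mx => i j; rewrite -[j]splitK; case: (fintype.split j) => k /=.
    apply: (@cont_on_eq _ _ _ (fun x : 'rV[R]_a * 'rV[R]_b => x.1 i k)).
      by move=> x _; rewrite row_mxEl.
    by apply: cont_on_coord; apply: cont_on_fst; exact: cont_on_id.
  apply: (@cont_on_eq _ _ _ (fun x : 'rV[R]_a * 'rV[R]_b => x.2 i k)).
    by move=> x _; rewrite row_mxEr.
  by apply: cont_on_coord; apply: cont_on_snd; exact: cont_on_id.
- apply: cont_on_pair; apply: cont_on_mx => i j.
    apply: (@cont_on_eq _ _ _ (fun x : 'rV[R]_(a + b) => x i (lshift b j))).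
      by move=> x _; rewrite mxE.
    by apply: cont_on_coord; exact: cont_on_id.
  apply: (@cont_on_eq _ _ _ (fun x : 'rV[R]_(a + b) => x i (rshift a j))).
    by move=> x _; rewrite mxE.
  by apply: cont_on_coord; exact: cont_on_id.
- by move=> [x y] _; split=> //=; rewrite row_mxKl row_mxKr.
- by move=> x _; split=> //=; rewrite hsubmxK.
Qed.

Lemma loc_euclidean_prod (R : realType) a b (T U : topologicalType) (A : set T)
    (B : set U) :
  loc_euclidean R a A -> loc_euclidean R b B -> loc_euclidean R (a + b) (A `*` B).
Proof.
move=> eA eB [x y] [/= Ax By]; have [N [f [g [NA Nx fg]]]] := eA _ Ax.
have [N' [f' [g' [NB Ny fg']]]] := eB _ By.
exists (N `*` N'), (fun z => row_mx (f z.1) (f' z.2)),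
  (fun z => (g (lsubmx z), g' (rsubmx z))); split.
- by move=> [z z'] [/= ? ?]; split=> /=; [exact: NA|exact: NB].
- exists ([set z | A z -> N z], [set z | B z -> N' z]) => //=.
  by move=> [z z'] [/= H H'] [/= ? ?]; split=> /=; [exact: H|exact: H'].
- have := hom_on_pair fg fg'.
  have -> : [set: 'rV[R]_a] `*` [set: 'rV[R]_b] = setT by apply/seteqP; split.
  by move=> /hom_on_comp/(_ (hom_on_row_mx R a b)).
Qed.

(** A ball is homeomorphic to the whole space by a radial dilation. *)
Lemma loc_euclidean_open (R : realType) k (A : set 'rV[R]_k) :
  open A -> loc_euclidean R k A.
Proof.
move=> oA x Ax; have /nbhs_ballP[d /= d0 dA] := open_nbhs_nbhs (conj oA Ax).
exists (ball x d), (fun y => (d - `|y - x|)^-1 *: (y - x)),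
  (fun z => x + (d / (1 + `|z|)) *: z); split => //.
  by apply: filterS (nbhsx_ballx x d d0).
have bE y : ball x d y = (`|y - x| < d) :> Prop.
  by rewrite -ball_normE /ball_/= distrC.
have n1 (z : 'rV[R]_k) : 0 < 1 + `|z| by rewrite ltr_pwDl.
split.
- apply: cont_onZ; last first.
    by apply: cont_onB; [exact: cont_on_id|exact: cont_on_cst].
  apply: cont_onV.
    by move=> y; rewrite bE => h; rewrite gt_eqF// subr_gt0.
  apply: cont_onB; first exact: cont_on_cst.
  by apply: cont_on_norm; apply: cont_onB; [exact: cont_on_id|exact: cont_on_cst].
- apply: cont_onD; first exact: cont_on_cst.
  apply: cont_onZ; last exact: cont_on_id.
  apply: cont_onM; first exact: cont_on_cst.
  apply: cont_onV; first by move=> z _; rewrite gt_eqF.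
  by apply: cont_onD; [exact: cont_on_cst|apply: cont_on_norm; exact: cont_on_id].
- move=> y; rewrite bE => h; split=> //.
  have dy : 0 < d - `|y - x| by rewrite subr_gt0.
  rewrite normrZ gtr0_norm ?invr_gt0//.
  have -> : 1 + (d - `|y - x|)^-1 * `|y - x| = d / (d - `|y - x|).
    by field; rewrite gt_eqF.
  rewrite scalerA.
  have -> : d / (d / (d - `|y - x|)) / (d - `|y - x|) = 1.
    by field; rewrite !gt_eqF.
  by rewrite scale1r addrC subrK.
- move=> z _; rewrite bE addrAC subrr add0r normrZ gtr0_norm ?divr_gt0//.
  have -> : d - d / (1 + `|z|) * `|z| = d / (1 + `|z|).
    by field; rewrite gt_eqF.
  split; first by rewrite mulrAC ltr_pdivrMr// ltr_pM2l// ltrDr.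
  by rewrite scalerA mulVf ?scale1r// gt_eqF// divr_gt0.
Qed.
End SetLevelTopology.

(** * Open cones in linear form *)

Section SetTypes.

Definition elt_of (T : Type) (A : set T) x (Ax : A x) : A :=
  exist _ x (mem_set Ax).

Lemma set_val_elt (T : Type) (A : set T) x (Ax : A x) : set_val (elt_of Ax) = x.
Proof. by []. Qed.

Lemma set_val_continuous (T : topologicalType) (A : set T) :
  continuous (set_val : A -> T).
Proof. exact: initial_continuous. Qed.

Lemma set_type_initial (T Z : topologicalType) (A : set T) (h : Z -> A) :
  continuous (set_val \o h) -> continuous h.
Proof.
move=> ch x O [W [[V oV <-] /= Vx WO]].
have : nbhs (set_val (h x)) V by exact: open_nbhs_nbhs.
move=> /(ch x); rewrite /= !nbhs_simpl /= => H.
by apply: (filterS (P := (set_val \o h) @^-1` V)) => // y Vy; exact: WO.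
Qed.

Lemma compact_set_val (T : topologicalType) (A B : set T) :
  B `<=` A -> compact B -> compact (set_val @^-1` B : set A).
Proof.
move=> BA cB F FF FB.
have /cB[] : ProperFilter (set_val @ F) by exact: fmap_proper_filter.
  exact: FB.
move=> b [Bb Fb].
have Ab := BA _ Bb.
exists (elt_of Ab); split=> // C W FC [V [[V' oV' <-] /= V'b VW]].
have FC' : (set_val @ F) (set_val @` C).
  by rewrite nbhs_simpl /=; apply: filterS FC => c Cc; exists c.
have nV : nbhs b V' by exact: open_nbhs_nbhs.
have [_ [[c Cc <-] V'c]] := Fb _ _ FC' nV.
by exists c; split=> //; exact: VW.
Qed.

Lemma compact_set_type (T : topologicalType) (A : set T) :
  compact A -> compact [set: A].
Proof.
move=> cA; have := compact_set_val (@subset_refl _ A) cA.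
suff -> : set_val @^-1` A = [set: A] by [].
by apply/seteqP; split=> // x _; exact: set_valP.
Qed.

Lemma set_val_inj (T : Type) (A : set T) : injective (set_val : A -> T).
Proof. exact: val_inj. Qed.

(** A finite subcover is a locally finite refinement. *)
Lemma compact_paracompact (V : topologicalType) :
  compact [set: V] -> paracompact V.
Proof.
move=> /compact_near_coveringP cV C Copen Ccov.
pose F := filter_from [set D : {fset set V} | {subset D <= C}]
  (fun D => [set D' : {fset set V} | {subset D <= D'} /\ {subset D' <= C}]).
have FF : Filter F.
  apply: filter_from_filter; first by exists fset0.
  move=> D1 D2 D1C D2C; exists (D1 `|` D2)%fset.
    by move=> A; rewrite inE => /orP[/D1C|/D2C].
  move=> D' [DD' D'C]; split; split=> // A hA; apply: DD'; rewrite inE hA//.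
  by rewrite orbT.
have [D DC Dcov] : exists2 D : {fset set V}, {subset D <= C} &
    [set: V] `<=` \bigcup_(A in [set` D]) A.
  have [|D DC DD] := cV _ F (fun D x => (\bigcup_(A in [set` D]) A) x) FF.
    move=> x _; have [A CA Ax] : (\bigcup_(A in C) A) x by rewrite Ccov.
    exists (A, [set D : {fset set V} | A \in D]) => /=.
      split; first by apply: open_nbhs_nbhs; split=> //; exact: Copen.
      exists [fset A]%fset; first by move=> B; rewrite inE => /eqP ->; exact: mem_set.
      by move=> D [+ _]; apply; rewrite inE.
    by move=> [y D] [/= Ay AD]; exists A.
  by exists D => //; apply: (DD D); split.
exists [set` D]; split.
- by move=> A /DC /set_mem; exact: Copen.
- by apply/seteqP; split.
- by move=> B /DC /set_mem CB; exists B.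
- move=> x; exists setT; first exact: filterT.
  by apply: (sub_finite_set (B := [set` D])); [move=> B []|exact: finite_fset].
Qed.

End SetTypes.

Section EuclideanCone.
Variables (R : realType) (E : normedModType R) (L : set E) (mass : E -> R).
Hypotheses (cL : compact L) (cmass : continuous mass).
Hypotheses (massZ : forall r x, mass (r *: x) = r * mass x).
Hypotheses (massL : forall l, L l -> mass l = 1).

(** For L in the affine hyperplane mass = 1, the open cone on L is realized
    linearly, with its apex at the origin. *)
Definition euclidean_cone : set E :=
  [set x | x = 0 \/ exists r l, [/\ 0 <= r, r < 1, L l & x = r *: l]].

Let C := open_cone R L.

Let pre (c : {b : bool & cone_piece R L b}) : E :=
  match c with
  | existT true lt => (set_val lt.2 : R) *: (set_val lt.1 : E)
  | existT false _ => 0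
  end.

Definition cone_emb (c : C) : E := pre (repr c).

Let pre_wd : {homo pre : a b / \pi_C a == \pi_C b :> C >-> a == b}.
Proof.
move=> a b /eqP/eqmodP; rewrite /= /cone_eqb => /orP[/eqP -> //|].
suff K c : over_apex c -> pre c = 0 by move=> /andP[/K -> /K ->].
by case: c => -[] //= lt /eqP ->; rewrite scale0r.
Qed.

Lemma cone_emb_pi c : cone_emb (\pi_C c) = pre c.
Proof. by apply/eqP; apply: pre_wd; rewrite reprK. Qed.

Lemma cone_emb_apex : cone_emb (cone_apex R L) = 0.
Proof. by rewrite cone_emb_pi. Qed.

Lemma cone_emb_pt l t : cone_emb (cone_pt l t) = set_val t *: set_val l.
Proof. by rewrite cone_emb_pi. Qed.

Lemma cone_emb_continuous : continuous cone_emb.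
Proof.
apply: repr_comp_continuous pre_wd.
have c1 : continuous (fun lt : L * (`[0, 1[%classic : set R) =>
    (set_val lt.2 : R) *: (set_val lt.1 : E)).
  apply: cont_on_setT; apply: cont_onZ.
    apply: (cont_on_comp_continuous (g := set_val)); last exact: set_val_continuous.
    exact: cont_on_proj2.
  apply: (cont_on_comp_continuous (g := set_val)); last exact: set_val_continuous.
  exact: cont_on_proj1.
case=> -[] x O; first by move=> /c1.
move=> /= O0; rewrite /nbhs /= /sigT_nbhs /=.
by apply: (@filterS (discrete_topology unit) (nbhs x) _ setT);
  [move=> y _; exact: (nbhs_singleton O0)|exact: filterT].
Qed.

Lemma cone_pt_continuous : continuous (fun lt => @cone_pt R L lt.1 lt.2).
Proof.
move=> [l t] O Olt; pose x := existT (cone_piece R L) true (l, t).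
have H : nbhs x (\pi_C @^-1` O).
  exact: (@pi_continuous _ (open_cone R L) x O Olt).
have := @existT_continuous _ (cone_piece R L) true (l, t) _ H.
rewrite /= !nbhs_simpl /= => H'; apply: (@filterS _ _ (nbhs_filter (l, t)) _ _ _ H').
by case.
Qed.

Lemma open_coneP (c : C) : c = cone_apex R L \/ exists l t, c = cone_pt l t.
Proof.
rewrite -[c]reprK; case: (repr c) => -[[l t]|[]]; last by left.
by right; exists l, t.
Qed.

Lemma cone_pt0 l t : set_val t = 0 :> R -> cone_pt l t = cone_apex R L.
Proof. by move=> t0; apply/eqmodP/orP; right; rewrite /= t0 eqxx. Qed.

Lemma mass_cone_pt l t : mass (cone_emb (cone_pt l t)) = set_val t.
Proof. by rewrite cone_emb_pt massZ massL ?mulr1//; exact: set_valP. Qed.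

Lemma mass_cone0 : mass (0 : E) = 0.
Proof. by rewrite -(scale0r (0 : E)) massZ mul0r. Qed.

Lemma cone_emb_inj : injective cone_emb.
Proof.
move=> c d e; have em := congr1 mass e.
have [ec|[l [t ec]]] := open_coneP c; have [ed|[l' [t' ed]]] := open_coneP d;
  rewrite ?ec ?ed // in e em *.
- by rewrite mass_cone_pt cone_emb_apex mass_cone0 in em; rewrite cone_pt0.
- by rewrite mass_cone_pt cone_emb_apex mass_cone0 in em; rewrite cone_pt0.
- rewrite !mass_cone_pt in em.
  have [t0|t0] := eqVneq (set_val t : R) 0; first by rewrite !cone_pt0// -em.
  rewrite !cone_emb_pt -em in e; have ll := scalerI t0 e.
  by rewrite (set_val_inj ll) (set_val_inj em).
Qed.

Lemma cone_emb_in c : euclidean_cone (cone_emb c).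
Proof.
have [->|[l [t ->]]] := open_coneP c; first by left; rewrite cone_emb_apex.
right; exists (set_val t), (set_val l); rewrite cone_emb_pt.
have := set_valP t; rewrite /= in_itv /= => /andP[? ?].
by split=> //; exact: set_valP.
Qed.

Lemma cone_emb_surj x : euclidean_cone x -> exists c, cone_emb c = x.
Proof.
move=> [->|[r [l [r0 r1 Ll ->]]]].
  by exists (cone_apex R L); rewrite cone_emb_apex.
have rI : (`[0, 1[%classic : set R) r by rewrite /= in_itv /= r0.
exists (cone_pt (elt_of Ll) (elt_of rI)).
by rewrite cone_emb_pt.
Qed.

(** A cone neighbourhood of radius r < 1 is the continuous image of the compact
    set L x [0, r], on which the Euclidean embedding of the cone is proper. *)
Lemma open_cone_homeo :
  exists g : E -> C, hom_on [set: C] euclidean_cone cone_emb g.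
Proof.
have /choice[g gE] : forall x : E, exists c : C, euclidean_cone x -> cone_emb c = x.
  move=> x; have [/cone_emb_surj[c e]|no] := pselect (euclidean_cone x).
    by exists c.
  by exists (cone_apex R L).
exists g; split.
- exact/continuous_cont_on/cone_emb_continuous.
- apply: cont_on_local => x Cx.
  have mx1 : mass x < 1.
    case: Cx => [->|[r [l [r0 r1 Ll ->]]]]; first by rewrite mass_cone0.
    by rewrite massZ massL// mulr1.
  exists [set y | mass y < (1 + mass x) / 2].
    have H : nbhs (mass x) [set r | r < (1 + mass x) / 2].
      by apply: open_nbhs_nbhs; split; [exact: open_lt|move=> /=; lra].
    exact: (cmass H).
  pose D : set E := euclidean_cone `&` [set y | mass y < (1 + mass x) / 2].
  have [[l0 Ll0]|noL] := pselect (exists l, L l); last first.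
    apply: (@cont_on_eq _ _ _ (fun=> g 0)); last exact: cont_on_cst.
    by move=> y [[->//|[r [l [_ _ Ll _]]]] _]; case: noL; exists l.
  pose K : set (L * (`[0, 1[%classic : set R)) :=
    [set: L] `*` (set_val @^-1` `[0, (1 + mass x) / 2]).
  apply: (@compact_param_cont _ _ _ K
     (fun lt => (set_val lt.2 : R) *: (set_val lt.1 : E)) D g
     (fun lt => cone_pt lt.1 lt.2)).
  + exact: norm_hausdorff.
  + apply: compact_setX; first exact: compact_set_type.
    apply: compact_set_val; last exact: segment_compact.
    by move=> t /=; rewrite !in_itv /=; lra.
  + apply: cont_onZ.
      apply: (cont_on_comp_continuous (g := set_val)); last exact: set_val_continuous.
      exact: cont_on_proj2.
    apply: (cont_on_comp_continuous (g := set_val)); last exact: set_val_continuous.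
    exact: cont_on_proj1.
  + exact/continuous_cont_on/cone_pt_continuous.
  + move=> y [Cy my].
    have I0 : (`[0, 1[%classic : set R) 0 by rewrite /= in_itv /=; lra.
    case: Cy => [y0|[r [l [r0 r1 Ll yE]]]].
      exists (elt_of Ll0, elt_of I0).
        split=> //; rewrite /preimage /mkset set_val_elt /= in_itv /= lexx /=.
        by move: my; rewrite y0 /= mass_cone0; lra.
      by rewrite y0 scale0r.
    have rI : (`[0, 1[%classic : set R) r by rewrite /= in_itv /= r0.
    exists (elt_of Ll, elt_of rI) => //.
    split=> //; rewrite /preimage /mkset set_val_elt /= in_itv /= r0 /=.
    by move: my; rewrite yE /= massZ massL// mulr1 => /ltW.
  + move=> [l t] Kk [Ce _]; apply: cone_emb_inj.
    by rewrite gE// cone_emb_pt.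
- by move=> c _; split; [exact: cone_emb_in|apply: cone_emb_inj; rewrite gE//; exact: cone_emb_in].
- by move=> y Cy; split=> //; exact: gE.
Qed.

End EuclideanCone.

Section Charts.
Variables (R : realType) (E : normedModType R) (L : set E) (mass : E -> R).
Hypotheses (cL : compact L) (cmass : continuous mass).
Hypotheses (massZ : forall r x, mass (r *: x) = r * mass x).
Hypotheses (massL : forall l, L l -> mass l = 1).

Lemma subcone_emb (A : set E) (c : open_cone R L) :
  subcone (set_val @^-1` A) c <->
  cone_emb c = 0 \/ exists r l, [/\ 0 <= r, r < 1, L l /\ A l & cone_emb c = r *: l].
Proof.
split=> [[->|[l [t [Al ->]]]]|[e|[r [l [r0 r1 [Ll Al] e]]]]].
- by left; rewrite cone_emb_apex.
- right; exists (set_val t), (set_val l); rewrite cone_emb_pt.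
  have := set_valP t; rewrite /= in_itv /= => /andP[? ?].
  by split=> //; split=> //; exact: set_valP.
- by left; apply: (cone_emb_inj massZ massL); rewrite e cone_emb_apex.
- right; have rI : (`[0, 1[%classic : set R) r by rewrite /= in_itv /= r0.
  exists (elt_of Ll), (elt_of rI); split=> //.
  by apply: (cone_emb_inj massZ massL); rewrite e cone_emb_pt.
Qed.

(** Charts are first obtained as homeomorphisms between subsets of normed
    spaces, with a cone in linear form; the base B of the chart is presented
    by an embedding b onto the subset S. *)
Lemma chart_of_hom (m j : nat) (T U B : topologicalType) (X : nat -> set T)
    (N : set T) (S : set U) (b : B -> U) (F : T -> U * E) (G : U * E -> T)
    (A : nat -> set E) :
  hom_on N (S `*` euclidean_cone L) F G ->
  continuous b -> injective b -> (forall u, S u <-> exists x, b x = u) ->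
  (forall (Z : topologicalType) (h : Z -> B), continuous (b \o h) -> continuous h) ->
  (forall i y, (i < m - j)%N -> N y -> (X (j + i + 1)%N y <->
     ((F y).2 = 0 \/ exists r l, [/\ 0 <= r, r < 1, L l /\ A i l & (F y).2 = r *: l]))) ->
  (forall y, N y -> (X j y <-> (F y).2 = 0)) ->
  exists f : N -> B * open_cone R L,
    conical_chart m X j (fun i => set_val @^-1` A i) f /\
    forall y : N, b (f y).1 = (F (set_val y)).1 /\
                  cone_emb (f y).2 = (F (set_val y)).2.
Proof.
move=> [cF cG FG GF] cb bI bS bini XA X0.
have [k hk] := open_cone_homeo cL cmass massZ massL.
have [ce ck ek ke] := hk.
have /choice[b' b'E] : forall y : N, exists x, b x = (F (set_val y)).1.
  move=> y; have [[SF _] _] := FG _ (set_valP y).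
  exact: ((bS _).1 SF).
have SC (x : B) (c : open_cone R L) : (S `*` euclidean_cone L) (b x, cone_emb c).
  by split=> /=; [apply/bS; exists x|exact: cone_emb_in].
have NG (x : B) (c : open_cone R L) : N (G (b x, cone_emb c)).
  by have [] := GF _ (SC x c).
pose g (xc : B * open_cone R L) : N := elt_of (NG xc.1 xc.2).
pose f (y : N) := (b' y, k (F (set_val y)).2).
have f2 y : cone_emb (f y).2 = (F (set_val y)).2.
  by have [[_ CF] _] := FG _ (set_valP y); have [_ ->] := ke _ CF.
have Fg xc : F (set_val (g xc)) = (b xc.1, cone_emb xc.2).
  by rewrite set_val_elt; have [] := GF _ (SC xc.1 xc.2).
have fK : cancel f g.
  move=> y; apply: set_val_inj; rewrite set_val_elt f2 b'E.
  by rewrite -surjective_pairing; have [_] := FG _ (set_valP y).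
have gK : cancel g f.
  move=> [x c]; have [e1 e2] : b (f (g (x, c))).1 = b x /\
      cone_emb (f (g (x, c))).2 = cone_emb c.
    by rewrite f2 [b _]b'E !Fg.
  by rewrite [f _]surjective_pairing (bI _ _ e1) (cone_emb_inj massZ massL e2).
have cFv : cont_on [set: N] (fun y => F (set_val y)).
  apply: (cont_on_comp (f := set_val) (B := N)) => //.
    exact/continuous_cont_on/set_val_continuous.
  by move=> y _; exact: set_valP.
have cf : continuous f.
  apply: cont_on_setT; apply: cont_on_pair.
    apply: continuous_cont_on; apply: bini; apply: cont_on_setT.
    apply: (@cont_on_eq _ _ _ (fun y => (F (set_val y)).1)).
      by move=> y _; rewrite -b'E.
    exact: (cont_on_fst cFv).
  apply: (cont_on_comp (B := euclidean_cone L) (f := fun y : N => (F (set_val y)).2) (g := k)) => //.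
    exact: (cont_on_snd cFv).
  by move=> y _; have [[]] := FG _ (set_valP y).
have cg : continuous g.
  apply: set_type_initial; apply: cont_on_setT.
  apply: (cont_on_comp (B := S `*` euclidean_cone L)
           (f := fun xc : B * open_cone R L => (b xc.1, cone_emb xc.2))) => //.
    apply: cont_on_pair.
      apply: (cont_on_comp_continuous (g := b)) => //.
      exact: cont_on_proj1.
    apply: (cont_on_comp_continuous (g := @cone_emb _ _ L)).
      exact: cont_on_proj2.
    exact: cone_emb_continuous.
exists f; split; last by move=> y; rewrite f2 b'E.
split; first by exists g.
- move=> i im; apply/seteqP; split=> [_ [y Xy <-]|xc] /=.
    apply/subcone_emb; rewrite f2; apply/XA => //; exact: set_valP.
  move=> /subcone_emb H; exists (g xc); last exact: gK.
  apply/XA => //; first exact: set_valP.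
  by rewrite Fg.
- apply/seteqP; split=> [_ [y Xy <-]|xc] /=.
    apply: (cone_emb_inj massZ massL); rewrite cone_emb_apex [cone_emb _]f2.
    apply/X0 => //; exact: set_valP.
  move=> H; exists (g xc); last exact: gK.
  by apply/X0; [exact: set_valP|rewrite Fg /= H cone_emb_apex].
Qed.

End Charts.

(** * The standard torus *)

Section StandardTorus.
Variable R : realType.
Implicit Types k : nat.

Definition circle_cos (x : R) : R := cos (x * (pi *+ 2)).
Definition circle_sin (x : R) : R := sin (x * (pi *+ 2)).

Lemma circle_cosD x y :
  circle_cos (x - y) = circle_cos x * circle_cos y + circle_sin x * circle_sin y.
Proof. by rewrite /circle_cos mulrBl cosB. Qed.

Lemma circle_sinD x y :
  circle_sin (x - y) = circle_sin x * circle_cos y - circle_cos x * circle_sin y.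
Proof. by rewrite /circle_sin mulrBl sinB. Qed.

Lemma circle_cos_nat (m : nat) : circle_cos m%:R = 1.
Proof.
by rewrite /circle_cos mulr_natl -[_ *+ m]add0r (periodicn (@cosD2pi R)) cos0.
Qed.

Lemma circle_sin_nat (m : nat) : circle_sin m%:R = 0.
Proof.
by rewrite /circle_sin mulr_natl -[_ *+ m]add0r (periodicn (@sinD2pi R)) sin0.
Qed.

Lemma circle_int (z : int) : circle_cos z%:~R = 1 /\ circle_sin z%:~R = 0.
Proof.
case: z => m; first by split; [exact: circle_cos_nat|exact: circle_sin_nat].
rewrite NegzE mulrNz /circle_cos /circle_sin mulNr cosN sinN.
split; first exact: circle_cos_nat.
by have := circle_sin_nat m.+1; rewrite /circle_sin => ->; rewrite oppr0.
Qed.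

Lemma circle_cos_eq1 (x : R) : 0 <= x < 1 -> circle_cos x = 1 -> x = 0.
Proof.
move=> /andP[x0 x1] cx.
have pi0 := pi_gt0 R.
have z0 : (0 : R) \in `[0, pi] by rewrite in_itv /= lexx ltW.
have key (y : R) : 0 <= y -> y <= 1 / 2 -> circle_cos y = 1 -> y = 0.
  move=> y0 y1 cy; have yI : y * (pi *+ 2) \in `[0, pi].
    rewrite in_itv /=; apply/andP; split.
      by apply: mulr_ge0 => //; rewrite mulrn_wge0// ltW.
    have h : 0 <= pi * (1 / 2 - y) by apply: mulr_ge0; [exact: ltW|lra].
    have -> : y * (pi *+ 2) = pi - pi * (1 / 2 - y) *+ 2 by field.
    by rewrite lerBlDr lerDl mulrn_wge0.
  have : y * (pi *+ 2) = 0 by have := cos_inj yI z0; rewrite cos0 => /(_ cy).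
  by move=> /eqP; rewrite mulf_eq0 mulrn_eq0/= (gt_eqF pi0) orbF => /eqP.
have [xh|xh] := lerP x (1 / 2); first exact: key.
have : circle_cos (1 - x) = 1.
  have [c1 s1] := circle_int 1.
  by rewrite circle_cosD c1 s1 cx mul0r mulr1 addr0.
by move=> /key; lra.
Qed.

Lemma circle_eq (x y : R) :
  (circle_cos x = circle_cos y /\ circle_sin x = circle_sin y) <->
  exists z : int, x - y = z%:~R.
Proof.
split=> [[ec es]|[z xyz]]; last first.
  have -> : x = y - (- z)%:~R by rewrite mulrNz opprK -xyz addrC subrK.
  have [c1 s1] := circle_int (- z).
  by rewrite circle_cosD circle_sinD c1 s1 !mulr1 !mulr0 addr0 subr0.
exists (Num.floor (x - y)).
have /andP[f1 f2] := Num.Theory.floor_itv (x - y).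
pose r := x - y - (Num.floor (x - y))%:~R.
suff : r = 0 by rewrite /r => /eqP; rewrite subr_eq0 => /eqP.
apply: circle_cos_eq1.
  by rewrite /r; move: f1 f2; rewrite intrD; lra.
have [c1 s1] := circle_int (Num.floor (x - y)).
rewrite /r circle_cosD c1 s1 mulr0 mulr1 addr0 circle_cosD ec es.
by rewrite -!expr2 /circle_cos /circle_sin cos2Dsin2.
Qed.

Lemma circle_cos_continuous : continuous circle_cos.
Proof.
apply: cont_on_setT.
apply: (cont_on_comp_continuous (g := @cos R)); last exact: continuous_cos.
by apply: cont_onM; [exact: cont_on_id|exact: cont_on_cst].
Qed.

Lemma circle_sin_continuous : continuous circle_sin.
Proof.
apply: cont_on_setT.
apply: (cont_on_comp_continuous (g := @sin R)); last exact: continuous_sin.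
by apply: cont_onM; [exact: cont_on_id|exact: cont_on_cst].
Qed.

Definition is_integral k (x : 'rV[R]_k) : Prop := exists z, x = realrv R z.

Lemma is_integralB k (x y : 'rV[R]_k) : is_integral x -> is_integral y -> is_integral (x - y).
Proof. by move=> [z ->] [w ->]; exists (z - w); rewrite /realrv map_mxB. Qed.

Lemma is_integralD k (x y : 'rV[R]_k) : is_integral x -> is_integral y -> is_integral (x + y).
Proof. by move=> [z ->] [w ->]; exists (z + w); rewrite /realrv map_mxD. Qed.

Lemma is_integralM k l (x : 'rV[R]_k) (M : 'M[int]_(k, l)) :
  is_integral x -> is_integral (x *m map_mx intr M).
Proof. by move=> [z ->]; exists (z *m M); rewrite /realrv map_mxM. Qed.

Lemma is_integral0 k : is_integral (0 : 'rV[R]_k).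
Proof. by exists 0; rewrite /realrv map_mx0. Qed.

Lemma is_integralP k (x : 'rV[R]_k) :
  is_integral x <-> forall i, exists z : int, x 0 i = z%:~R.
Proof.
split=> [[z ->] i|/choice[f fE]]; first by exists (z 0 i); rewrite mxE.
by exists (\row_i f i); apply/rowP => i; rewrite !mxE fE.
Qed.

(** The torus is handled through these coordinates, which separate exactly the
    cosets of the integral vectors and live in a normed space. *)
Definition torus_emb k (x : 'rV[R]_k) : 'rV[R]_k * 'rV[R]_k :=
  (\row_i circle_cos (x 0 i), \row_i circle_sin (x 0 i)).

Lemma torus_embE k (x y : 'rV[R]_k) :
  torus_emb x = torus_emb y <-> is_integral (x - y).
Proof.
split=> [[/rowP ec /rowP es]|/is_integralP xy].
  apply/is_integralP => i; have := ec i; have := es i; rewrite !mxE => e1 e2.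
  exact/circle_eq.
by congr pair; apply/rowP => i; rewrite !mxE;
  have [z] := xy i; rewrite !mxE => H; have [] := (circle_eq _ _).2 (ex_intro _ z H).
Qed.

Lemma torus_emb_continuous k : continuous (@torus_emb k).
Proof.
apply: cont_on_setT; apply: cont_on_pair; apply: cont_on_mx => i j.
  apply: (@cont_on_eq _ _ _ (fun x : 'rV[R]_k => circle_cos (x 0 j))).
    by move=> x _; rewrite mxE.
  apply: (cont_on_comp_continuous (g := circle_cos)).
    by apply: cont_on_coord; exact: cont_on_id.
  exact: circle_cos_continuous.
apply: (@cont_on_eq _ _ _ (fun x : 'rV[R]_k => circle_sin (x 0 j))).
  by move=> x _; rewrite mxE.
apply: (cont_on_comp_continuous (g := circle_sin)).
  by apply: cont_on_coord; exact: cont_on_id.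
exact: circle_sin_continuous.
Qed.

Definition unit_box k (c : 'rV[R]_k) : set 'rV[R]_k :=
  [set x | forall i, x 0 i \in `[c 0 i, c 0 i + 1]].

Lemma unit_box_compact k (c : 'rV[R]_k) : compact (unit_box c).
Proof.
apply: (@rV_compact R k (fun i => `[c 0 i, c 0 i + 1]%classic)) => i.
exact: segment_compact.
Qed.

Lemma unit_box_repr k (c x : 'rV[R]_k) :
  exists2 y, unit_box c y & is_integral (x - y).
Proof.
exists (\row_i (x 0 i - (Num.floor (x 0 i - c 0 i))%:~R)).
  move=> i; rewrite mxE in_itv /=.
  have /andP[f1 f2] := Num.Theory.floor_itv (x 0 i - c 0 i).
  by move: f1 f2; rewrite intrD; lra.
apply/is_integralP => i; exists (Num.floor (x 0 i - c 0 i)).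
by rewrite !mxE opprB addrCA subrr addr0.
Qed.

(** Away from its faces a unit box meets every coset of the lattice at most
    once, so its interior is a chart of the torus. *)
Lemma loc_euclidean_torus k : loc_euclidean R k (range (@torus_emb k)).
Proof.
move=> _ [x0 _ <-].
(* the lower corner of the unit box centered at x0 *)
pose c := x0 - const_mx (1 / 2) : 'rV[R]_k.
pose O : set 'rV[R]_k := [set x | forall i, c 0 i < x 0 i < c 0 i + 1].
have Ox0 : O x0 by move=> i; rewrite !mxE; lra.
have Obox : O `<=` unit_box c.
  by move=> x Ox i; rewrite in_itv /=; have := Ox i; lra.
have uniqO x y : O x -> unit_box c y -> torus_emb y = torus_emb x -> y = x.
  move=> Ox By /torus_embE/is_integralP xy; apply/rowP => i.
  have [z] := xy i; rewrite !mxE => yxz.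
  have := By i; have := Ox i; rewrite in_itv /= => h1 h2.
  have z1 : (z < 1)%R by rewrite -(ltr_int R) -yxz; lra.
  have z2 : (-1 < z)%R by rewrite -(ltr_int R) mulrNz -yxz; lra.
  have z0 : z = 0 by lia.
  by move: yxz; rewrite z0 => /eqP; rewrite subr_eq0 => /eqP.
have oO : open O.
  rewrite openE => x Ox; apply: (@filter_forall _ _
    (fun i => [set y : 'rV[R]_k | c 0 i < y 0 i < c 0 i + 1]) (nbhs x)) => i.
  have : nbhs (x 0 i) `]c 0 i, c 0 i + 1[%classic.
    apply: open_nbhs_nbhs; split; first exact: interval_open.
    by rewrite /= in_itv /=.
  move=> /(@coord_continuous R 1 k 0 i x).
  by apply: nbhsS => y; rewrite /= in_itv.
have [N [f [g [NO Nx0 fg]]]] := loc_euclidean_open oO Ox0.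
pose TN := @torus_emb k @` N.
have [cf cg fgx gfx] := fg.
have Nnear : \forall p \near torus_emb x0, range (@torus_emb k) p -> TN p.
  have near_box : \forall p \near torus_emb x0, forall y, unit_box c y ->
      torus_emb y = p -> N y.
    apply: (@compact_fiber_near _ _ (unit_box c) (@torus_emb k)).
    - exact: norm_hausdorff.
    - exact: unit_box_compact.
    - exact/continuous_cont_on/torus_emb_continuous.
    move=> y By /(uniqO _ _ Ox0 By) ->.
    have := oO; rewrite openE => /(_ _ Ox0).
    by move=> Onear; apply: filterS2 Onear Nx0 => z Oz Nz _; exact: Nz.
  apply: filterS near_box => p H [x _ xp].
  have [y By xy] := unit_box_repr c x.
  have yp : torus_emb y = p by rewrite -xp; apply/esym/torus_embE.
  by exists y => //; exact: H By yp.
have /choice[h hE] : forall p, exists y, TN p -> N y /\ torus_emb y = p.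
  move=> p; have [[y Ny e]|no] := pselect (TN p); first by exists y.
  by exists 0.
have hK x : N x -> h (torus_emb x) = x.
  move=> Nx; have [|Nh eh] := hE (torus_emb x); first by exists x.
  by apply: uniqO eh; [exact: NO|apply: Obox; exact: NO].
have homh : hom_on TN N h (@torus_emb k).
  split.
  - apply: (@compact_param_cont _ _ _ (unit_box c) (@torus_emb k) TN h id).
    + exact: norm_hausdorff.
    + exact: unit_box_compact.
    + exact/continuous_cont_on/torus_emb_continuous.
    + exact: cont_on_id.
    + by move=> _ [y Ny <-]; exists y => //; exact/Obox/NO.
    + move=> y By [y' Ny' e]; rewrite -e hK//.
      by apply/esym; apply: uniqO => //; exact: NO.
  - exact/continuous_cont_on/torus_emb_continuous.
  - by move=> p /hE.
  - by move=> x Nx; split; [exists x|exact: hK].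
exists TN, (f \o h), (@torus_emb k \o g); split=> //.
  by move=> _ [y Ny <-]; exists y.
exact: hom_on_comp homh fg.
Qed.

End StandardTorus.

(** * The model over an order complex *)

(** A direct summand of Z^n, with basis the rows of lbasis. The matrix lcoord
    extends the coordinates in this basis to Z^n, which makes
    lcoord *m lbasis an integral projection onto the summand. *)
Record split_lattice (n : nat) := SplitLattice {
  ldim : nat;
  lbasis : 'M[int]_(ldim, n);
  lcoord : 'M[int]_(n, ldim);
  lbasisK : lbasis *m lcoord = 1%:M }.

Lemma closed_preimage (T U : topologicalType) (f : T -> U) (D : set U) :
  continuous f -> closed D -> closed (f @^-1` D).
Proof. by move=> cf cD; apply: closed_comp => // x _; exact: cf. Qed.

Section SplitLattices.
Variables (R : realType) (n : nat).
Implicit Types V W : split_lattice n.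

Definition lproj V : 'M[R]_n := map_mx intr (lcoord V *m lbasis V).
(** The kernel of lproj' is the span of V and lproj' is integral, so t and t'
    agree in T^n modulo the subtorus of V exactly when (t - t') *m lproj' is
    integral. *)
Definition lproj' V : 'M[R]_n := 1%:M - lproj V.

Lemma lproj'E V : lproj' V = map_mx intr (1%:M - lcoord V *m lbasis V).
Proof. by rewrite map_mxB map_mx1. Qed.

Lemma lproj_idem V : lproj V *m lproj V = lproj V.
Proof. by rewrite -map_mxM mulmxA -(mulmxA _ _ (lcoord V)) lbasisK mulmx1. Qed.

Lemma lproj'K V : lproj' V *m lproj V = 0.
Proof. by rewrite mulmxBl mul1mx lproj_idem subrr. Qed.

Lemma is_integral_lproj V (x : 'rV[R]_n) : is_integral x -> is_integral (x *m lproj V).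
Proof. exact: is_integralM. Qed.

Lemma is_integral_lproj' V (x : 'rV[R]_n) : is_integral x -> is_integral (x *m lproj' V).
Proof. by rewrite lproj'E; exact: is_integralM. Qed.

Definition in_lat V : set 'rV[R]_n := [set x | x *m lproj V = x].

Lemma in_lat_proj V x : in_lat V (x *m lproj V).
Proof. by rewrite /in_lat/= -mulmxA lproj_idem. Qed.

Definition lat_box V : set 'rV[R]_n := (fun x => x *m lproj V) @` unit_box 0.

Lemma lat_box_sub V : lat_box V `<=` in_lat V.
Proof. by move=> _ [x _ <-]; exact: in_lat_proj. Qed.

Lemma lat_box_compact V : compact (lat_box V).
Proof.
apply: continuous_compact; last exact: unit_box_compact.
apply: continuous_subspaceT; apply: cont_on_setT; apply: cont_on_mulmx.
exact: cont_on_id.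
Qed.

Lemma lat_box_repr V x : in_lat V x -> exists2 y, lat_box V y & is_integral (x - y).
Proof.
move=> Vx; have [y By xy] := unit_box_repr 0 x.
by exists (y *m lproj V); [exists y|rewrite -{1}Vx -mulmxBl; exact: is_integral_lproj].
Qed.

End SplitLattices.

Section Model.
Variables (R : realType) (n N : nat) (le : rel 'I_N).
Variable V : 'I_N -> split_lattice n.
Hypotheses (le_refl : reflexive le) (le_trans : transitive le).
Hypothesis le_anti : antisymmetric le.
Hypothesis leV : forall i j, le i j -> lproj R (V i) *m lproj R (V j) = lproj R (V i).

Definition lt i j := le i j && (i != j).

Definition model_space : normedModType R :=
  ('rV[R]_N * ('M[R]_(N, n) * 'M[R]_(N, n)))%type.

Local Notation E := model_space.
Local Notation Q i := (lproj R (V i)).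
Local Notation Q' i := (lproj' R (V i)).

(** The coefficient of the vertex i weighs the coordinates of t in the quotient
    torus of V i. Over a simplex of the order complex these quotients are all
    quotients of the one for the smallest vertex, so that Phi a t remembers a
    and the class of t in that torus, and nothing else. *)
Definition Phi (a : 'rV[R]_N) (t : 'rV[R]_n) : E :=
  (a, (\matrix_(i, k) (a 0 i * circle_cos ((t *m Q' i) 0 k)),
       \matrix_(i, k) (a 0 i * circle_sin ((t *m Q' i) 0 k)))).

Lemma Phi_eq a t a' t' :
  Phi a t = Phi a' t' <->
  a = a' /\ forall i, a 0 i != 0 -> is_integral ((t - t') *m Q' i).
Proof.
split=> [[<- /matrixP ec /matrixP es]|[<- tt]].
  split=> // i ai; rewrite mulmxBl; apply/torus_embE.
  by congr pair; apply/rowP => k; rewrite !mxE; apply: (mulfI ai);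
    [have := ec i k|have := es i k]; rewrite !mxE.
congr (_, (_, _)); apply/matrixP => i k; rewrite [LHS]mxE [RHS]mxE;
  have [->|ai] := eqVneq (a 0 i) 0; rewrite ?mul0r//; congr (_ * _);
  have /torus_embE[/rowP ec /rowP es] : is_integral (t *m Q' i - t' *m Q' i)
    by rewrite -mulmxBl; exact: tt.
  by have := ec k; rewrite !mxE.
by have := es k; rewrite !mxE.
Qed.

Lemma PhiZ r a t : Phi (r *: a) t = r *: Phi a t.
Proof.
by congr (_, (_, _)); apply/matrixP => i k; rewrite !mxE mulrA.
Qed.

Lemma Phi0 t : Phi 0 t = 0.
Proof. by rewrite -(scale0r (0 : 'rV_N)) PhiZ scale0r. Qed.

Lemma Phi_integral a t t' : is_integral (t - t') -> Phi a t = Phi a t'.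
Proof. by move=> tt; apply/Phi_eq; split=> // i _; exact: is_integral_lproj'. Qed.

Lemma cont_on_Phi (T : topologicalType) (D : set T) a t :
  cont_on D a -> cont_on D t -> cont_on D (fun x => Phi (a x) (t x)).
Proof.
move=> ca ct.
have cQ i k : cont_on D (fun x => (t x *m Q' i) 0 k).
  by apply: cont_on_coord; exact: cont_on_mulmx.
apply: cont_on_pair => //; apply: cont_on_pair; apply: cont_on_mx => i k.
  apply: (@cont_on_eq _ _ _ (fun x => a x 0 i * circle_cos ((t x *m Q' i) 0 k))).
    by move=> x _; rewrite [RHS]mxE.
  apply: cont_onM; first exact: cont_on_coord.
  exact: cont_on_comp_continuous (@circle_cos_continuous R).
apply: (@cont_on_eq _ _ _ (fun x => a x 0 i * circle_sin ((t x *m Q' i) 0 k))).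
  by move=> x _; rewrite [RHS]mxE.
apply: cont_onM; first exact: cont_on_coord.
exact: cont_on_comp_continuous (@circle_sin_continuous R).
Qed.

Definition wsum (a : 'rV[R]_N) : R := \sum_i a 0 i.

Lemma cont_on_wsum (T : topologicalType) (D : set T) a :
  cont_on D a -> cont_on D (fun x => wsum (a x)).
Proof. by move=> ca; apply: cont_on_sum => i _; exact: cont_on_coord. Qed.

Lemma wsumZ r a : wsum (r *: a) = r * wsum a.
Proof. by rewrite /wsum mulr_sumr; apply: eq_bigr => i _; rewrite mxE. Qed.

Lemma wsumD a b : wsum (a + b) = wsum a + wsum b.
Proof. by rewrite /wsum -big_split; apply: eq_bigr => i _; rewrite mxE. Qed.

(** The cone over the order complex of A. *)
Definition chain_cone (A : pred 'I_N) : set 'rV[R]_N :=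
  [set a | [/\ forall i, 0 <= a 0 i, forall i, a 0 i != 0 -> A i &
    forall i j, a 0 i != 0 -> a 0 j != 0 -> le i j || le j i]].

Definition simplex (A : pred 'I_N) : set 'rV[R]_N :=
  [set a | chain_cone A a /\ wsum a = 1].

Lemma chain_cone0 A : chain_cone A 0.
Proof. by split=> [i|i|i j]; rewrite !mxE ?eqxx. Qed.

Lemma wsum_ge0 A a : chain_cone A a -> 0 <= wsum a.
Proof. by move=> [a0 _ _]; exact: sumr_ge0. Qed.

Lemma wsum_eq0 A a : chain_cone A a -> wsum a = 0 -> a = 0.
Proof.
move=> [a0 _ _] /eqP; rewrite psumr_eq0// => /allP H.
by apply/rowP => i; rewrite mxE; apply/eqP/H; exact: mem_index_enum.
Qed.

Lemma chain_coneZ A r a : 0 <= r -> chain_cone A a -> chain_cone A (r *: a).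
Proof.
move=> r0 [a0 aA ac]; split=> [i|i|i j]; rewrite !mxE ?mulr_ge0//.
  by rewrite mulf_eq0 negb_or => /andP[_]; exact: aA.
by rewrite !mulf_eq0 !negb_or => /andP[_ ?] /andP[_ ?]; exact: ac.
Qed.

Lemma chain_cone_sub (A B : pred 'I_N) a :
  chain_cone A a -> (forall i, a 0 i != 0 -> B i) -> chain_cone B a.
Proof. by move=> [a0 _ ac] aB; split. Qed.

Definition vertex (i : 'I_N) : 'rV[R]_N := delta_mx 0 i.

Lemma vertexE i j : vertex i 0 j = (j == i)%:R.
Proof. by rewrite mxE eqxx. Qed.

Lemma wsum_vertex i : wsum (vertex i) = 1.
Proof.
rewrite /wsum (bigD1 i)//= vertexE eqxx big1 ?addr0// => j /negbTE ji.
by rewrite vertexE ji.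
Qed.

Lemma vertex_simplex (A : pred 'I_N) i : A i -> simplex A (vertex i).
Proof.
move=> Ai; have supp l : vertex i 0 l != 0 -> l = i.
  by rewrite vertexE; have [->|_] := eqVneq l i; rewrite //= eqxx.
split; last exact: wsum_vertex.
split=> [l|l /supp -> //|l m /supp -> /supp ->]; last by rewrite le_refl.
by rewrite vertexE.
Qed.

Definition toward i r (a : 'rV[R]_N) : 'rV[R]_N := (1 - r) *: vertex i + r *: a.

Lemma towardE i r a j : toward i r a 0 j = (1 - r) * (j == i)%:R + r * a 0 j.
Proof. by rewrite !mxE eqxx. Qed.

Lemma toward_support i r a j : toward i r a 0 j != 0 -> j = i \/ a 0 j != 0.
Proof.
rewrite towardE; have [->|_] := eqVneq j i; first by left.
by rewrite mulr0 add0r mulf_eq0 negb_or => /andP[_]; right.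
Qed.

Lemma toward_simplex (A : pred 'I_N) i r a : A i -> simplex A a ->
  (forall j, a 0 j != 0 -> le i j) -> 0 <= r -> r <= 1 -> simplex A (toward i r a).
Proof.
move=> Ai [[a0 aA ac] a1] lea r0 r1.
split; last by rewrite wsumD !wsumZ wsum_vertex a1 !mulr1 subrK.
split=> [l|l /toward_support[->|/aA]//|l m].
- by rewrite towardE addr_ge0// mulr_ge0// ?subr_ge0.
- move=> /toward_support[->|al] /toward_support[->|am];
    rewrite ?le_refl ?(lea l) ?(lea m) ?orbT//.
  exact: ac.
Qed.

Lemma toward0 i a : toward i 0 a = vertex i.
Proof. by rewrite /toward subr0 scale1r scale0r addr0. Qed.

Lemma toward1 i a : toward i 1 a = a.
Proof. by rewrite /toward subrr scale0r add0r scale1r. Qed.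

Lemma cont_on_toward (T : topologicalType) (D : set T) i r a :
  cont_on D r -> cont_on D a -> cont_on D (fun x => toward i (r x) (a x)).
Proof.
move=> cr ca; apply: cont_onD; apply: cont_onZ => //; last exact: cont_on_cst.
by apply: cont_onB => //; exact: cont_on_cst.
Qed.

Lemma simplex_neq0 (A : pred 'I_N) a : simplex A a -> a != 0.
Proof.
move=> [_ a1]; apply/eqP => a0; move/eqP: a1.
by rewrite a0 -(scale0r 0) wsumZ mul0r eq_sym oner_eq0.
Qed.

Lemma chain_cone_closed A : closed (chain_cone A).
Proof.
have cc i : continuous (fun a : 'rV[R]_N => a 0 i) by exact: coord_continuous.
have c0 i : closed [set a : 'rV[R]_N | a 0 i = 0].
  exact: (closed_preimage (cc i) (@closed_eq R 0)).
have c1 i : closed [set a : 'rV[R]_N | 0 <= a 0 i].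
  exact: (closed_preimage (cc i) (@closed_ge R 0)).
have c2 i : closed [set a : 'rV[R]_N | a 0 i != 0 -> A i].
  have [Ai|/negP nAi] := pselect (A i).
    by rewrite (_ : mkset _ = setT); [exact: closedT|apply/seteqP; split=> // a _ _].
  rewrite (_ : mkset _ = [set a : 'rV[R]_N | a 0 i = 0]); first exact: c0.
  apply/seteqP; split=> a /=; last by move=> ->; rewrite eqxx.
  by rewrite (negbTE nAi); have [//|_ /(_ isT)] := eqVneq (a 0 i) 0.
have c3 i j : closed [set a : 'rV[R]_N |
    a 0 i != 0 -> a 0 j != 0 -> le i j || le j i].
  have [Ai|/negP nAi] := pselect (le i j || le j i).
    by rewrite (_ : mkset _ = setT); [exact: closedT|apply/seteqP; split=> // a _ _].
  rewrite (_ : mkset _ = [set a : 'rV[R]_N | a 0 i = 0] `|`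
      [set a : 'rV[R]_N | a 0 j = 0]); first by apply: closedU; exact: c0.
  apply/seteqP; split=> a /=; last by move=> [] ->; rewrite eqxx.
  rewrite (negbTE nAi).
  have [|ai] := eqVneq (a 0 i) 0; first by left.
  by have [|aj /(_ isT isT)//] := eqVneq (a 0 j) 0; first by right.
rewrite (_ : chain_cone A = (\bigcap_i [set a | 0 <= a 0 i]) `&`
   (\bigcap_i [set a | a 0 i != 0 -> A i]) `&`
   (\bigcap_(ij in [set: 'I_N * 'I_N]) [set a |
      a 0 ij.1 != 0 -> a 0 ij.2 != 0 -> le ij.1 ij.2 || le ij.2 ij.1])).
  apply: closedI; first apply: closedI; apply: closed_bigI => i _.
  - exact: c1.
  - exact: c2.
  - exact: c3.
apply/seteqP; split=> [a [h1 h2 h3]|a [[h1 h2] h3]].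
  by do 2?split; [move=> i _; exact: h1|move=> i _; exact: h2|move=> [i j] _; exact: h3].
split=> [i|i|i j]; [exact: (h1 i I)|exact: (h2 i I)|exact: (h3 (i, j) I)].
Qed.

Lemma chain_cone_compact A (C : set R) :
  closed C -> C `<=` [set x | x <= 1] ->
  compact (chain_cone A `&` [set a | C (wsum a)]).
Proof.
move=> cC C1.
apply: (@subclosed_compact _ _ [set v : 'rV[R]_N | forall i, v 0 i \in `[0, 1]]).
- apply: closedI; first exact: chain_cone_closed.
  apply: (@closed_preimage _ _ wsum _ _ cC); apply: cont_on_setT.
  exact: (cont_on_wsum (@cont_on_id _ _)).
- apply: (@rV_compact R N (fun i => `[0, 1]%classic)) => i; exact: segment_compact.
- move=> a [[a0 _ _] /C1 /= a1] i; rewrite in_itv /= a0 /=.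
  by apply: Order.POrderTheory.le_trans a1; rewrite /wsum (bigD1 i)//= lerDl sumr_ge0.
Qed.

Lemma simplex_compact A : compact (simplex A).
Proof.
apply: (@chain_cone_compact A [set 1]); first exact: closed_eq.
by move=> x /= ->.
Qed.

(** The common form of the whole variety (A everything, W = Z^n) and of the
    links of its strata (A the elements below s, W = V s); the iterated links
    have it too, which is what makes an induction on links possible. *)
Definition stratum_space (A : pred 'I_N) (W : split_lattice n) : set E :=
  [set x | exists a t, [/\ simplex A a, in_lat W t & x = Phi a t]].

Definition mass (x : E) : R := wsum x.1.

Lemma mass_continuous : continuous mass.
Proof.
apply: cont_on_setT; apply: cont_on_wsum.
exact: cont_on_proj1.
Qed.

Lemma massZ r x : mass (r *: x) = r * mass x.
Proof. exact: wsumZ. Qed.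

Lemma mass_stratum_space A W x : stratum_space A W x -> mass x = 1.
Proof. by move=> [a [t [[_ a1] _ ->]]]. Qed.

Lemma stratum_space_param A W x : stratum_space A W x ->
  exists2 at_, (simplex A `*` lat_box W) at_ & Phi at_.1 at_.2 = x.
Proof.
move=> [a [t [sa Wt ->]]]; have [t' Bt' tt] := lat_box_repr Wt.
by exists (a, t') => //=; apply/esym; exact: Phi_integral.
Qed.

Lemma stratum_space_compact A W : compact (stratum_space A W).
Proof.
rewrite (_ : stratum_space A W =
  (fun at_ => Phi at_.1 at_.2) @` (simplex A `*` lat_box W)).
  apply: continuous_compact; last first.
    by apply: compact_setX; [exact: simplex_compact|exact: lat_box_compact].
  apply: continuous_subspaceT; apply: cont_on_setT; apply: cont_on_Phi.
    exact: cont_on_proj1.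
  exact: cont_on_proj2.
apply/seteqP; split=> x.
  by move=> /stratum_space_param[[a t] ? <-]; exists (a, t).
by move=> [[a t] [/= sa /lat_box_sub Wt] <-]; exists a, t.
Qed.

Lemma euclidean_coneE A W :
  euclidean_cone (stratum_space A W) =
  [set x | exists b t, [/\ chain_cone A b, wsum b < 1, in_lat W t & x = Phi b t]].
Proof.
apply/seteqP; split=> x.
  move=> [->|[r [l [r0 r1 [a [t [[ca a1] Wt ->]]] ->]]]].
    exists 0, 0; split; first exact: chain_cone0.
    - by rewrite -(scale0r 0) wsumZ mul0r.
    - by rewrite /in_lat/= mul0mx.
    - by rewrite Phi0.
  exists (r *: a), t; split; first exact: chain_coneZ.
  - by rewrite wsumZ a1 mulr1.
  - by [].
  - by rewrite PhiZ.
move=> [b [t [cb b1 Wt ->]]].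
have [b0|b0] := eqVneq (wsum b) 0; first by left; rewrite (wsum_eq0 cb b0) Phi0.
right; exists (wsum b), (Phi ((wsum b)^-1 *: b) t).
have bge := wsum_ge0 cb; split=> //; last by rewrite -PhiZ scalerA divff// scale1r.
exists ((wsum b)^-1 *: b), t; split=> //; split.
  by apply: chain_coneZ => //; rewrite invr_ge0.
by rewrite wsumZ mulVf.
Qed.

Definition below s : pred 'I_N := [pred i | lt i s].

(** A simplex having s as a vertex is the join of its face below s with its
    face of vertices at or above s. Of the coordinates a of a point in it,
    lower s a is the part below s, and upper s a the rest, normalized to total
    mass 1; join inverts this. *)
Definition lower (s : 'I_N) (a : 'rV[R]_N) : 'rV[R]_N :=
  \row_i (if lt i s then a 0 i else 0).

Definition upper (s : 'I_N) (a : 'rV[R]_N) : 'rV[R]_N :=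
  (1 - wsum (lower s a))^-1 *: (a - lower s a).

Definition join (b y : 'rV[R]_N) : 'rV[R]_N := b + (1 - wsum b) *: y.

(** The open cell dual to s in the order complex of A. *)
Definition face_open (A : pred 'I_N) s : set 'rV[R]_N :=
  [set y | [/\ simplex A y, y 0 s != 0 & forall i, y 0 i != 0 -> le s i]].

Lemma ltii i : lt i i = false. Proof. by rewrite /lt eqxx andbF. Qed.

Lemma le_below i j : le i j -> i != j -> lt i j.
Proof. by rewrite /lt => ->. Qed.

Lemma below_le i j : lt i j -> le i j. Proof. by case/andP. Qed.

Lemma belowNle i j : lt i j -> ~~ le j i.
Proof.
move=> /andP[ij nij]; apply/negP => ji; move/eqP: nij; apply.
by apply: le_anti; rewrite ij ji.
Qed.

Section Join.
Variables (A : pred 'I_N) (s : 'I_N).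
Hypothesis Alow : forall i j, le i j -> A j -> A i.

Lemma lower_chain a : chain_cone A a -> chain_cone (below s) (lower s a).
Proof.
move=> [a0 aA ac]; split=> [i|i|i j]; rewrite !mxE; first by case: ifP.
  by rewrite /below/=; case: ifP => //; rewrite eqxx.
by case: ifP => _; rewrite ?eqxx//; case: ifP => _; rewrite ?eqxx//; exact: ac.
Qed.

Lemma lower_lt1 a : simplex A a -> a 0 s != 0 -> wsum (lower s a) < 1.
Proof.
move=> [[a0 aA ac] <-] as0; rewrite /wsum (bigD1 s)//= [ltRHS](bigD1 s)//=.
rewrite mxE ltii; apply: ltr_leD; first by rewrite lt0r as0 a0.
by apply: ler_sum => i _; rewrite mxE; case: ifP.
Qed.

Lemma upper_face a : simplex A a -> a 0 s != 0 -> face_open A s (upper s a).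
Proof.
move=> sa as0; have l1 := lower_lt1 sa as0; have [[a0 aA ac] a1] := sa.
have l0 : 0 < 1 - wsum (lower s a) by rewrite subr_gt0.
have key i : upper s a 0 i != 0 -> [/\ a 0 i != 0, ~~ lt i s & le s i].
  rewrite !mxE mulf_eq0 negb_or => /andP[_]; case: ifP => h; rewrite ?subrr ?eqxx//.
  rewrite subr0 => ai; split=> //; have /orP[//|is_] := ac _ _ as0 ai.
  have [->|ne] := eqVneq i s; first exact: le_refl.
  by move: h; rewrite /lt is_ ne.
split; last by move=> i /key[].
- split.
    split=> [i|i /key[]|i j /key[ai _ _] /key[aj _ _]]; last exact: ac.
      rewrite !mxE mulr_ge0 ?invr_ge0 ?(ltW l0)//; case: ifP => _.
        by rewrite subrr.
      by rewrite subr0.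
    by move=> ? _ _; exact: aA.
  have -> : wsum (upper s a) = (1 - wsum (lower s a))^-1 * (wsum a - wsum (lower s a)).
    by rewrite wsumZ wsumD -[- lower s a]scaleN1r wsumZ mulN1r.
  by rewrite a1 mulVf// gt_eqF.
- by rewrite !mxE ltii subr0 mulf_neq0// invr_neq0// gt_eqF.
Qed.

Lemma joinK a : simplex A a -> a 0 s != 0 -> join (lower s a) (upper s a) = a.
Proof.
move=> sa as0; have l1 := lower_lt1 sa as0.
rewrite /join /upper scalerA divff ?scale1r ?subrKC// gt_eqF// subr_gt0//.
Qed.

Section JoinIn.
Variables (b y : 'rV[R]_N).
Hypotheses (cb : chain_cone (below s) b) (b1 : wsum b < 1) (fy : face_open A s y).

Let b1' : 0 < 1 - wsum b. Proof. by rewrite subr_gt0. Qed.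

Lemma joinEl i : lt i s -> join b y 0 i = b 0 i.
Proof.
case: fy => _ _ yle is_; rewrite !mxE; have [->|/yle si] := eqVneq (y 0 i) 0.
  by rewrite mulr0 addr0.
by move: (belowNle is_); rewrite si.
Qed.

Lemma joinEr i : ~~ lt i s -> join b y 0 i = (1 - wsum b) * y 0 i.
Proof.
case: cb => _ bb _ nis; rewrite !mxE; have [->|/bb] := eqVneq (b 0 i) 0.
  by rewrite add0r.
by rewrite /below/= (negbTE nis).
Qed.

Lemma join_simplex : simplex A (join b y).
Proof.
have [[[y0 yA yc] y1] ys yle] := fy; have [b0 bb bc] := cb.
split; last by rewrite wsumD wsumZ y1 mulr1 addrC subrK.
split=> [i|i|i j]; first by rewrite !mxE addr_ge0// mulr_ge0// ltW.
  have [is_|is_] := boolP (lt i s).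
    by move=> _; apply: Alow (below_le is_) _; exact: yA.
  by rewrite joinEr// mulf_eq0 negb_or => /andP[_ /yA].
have [is_|is_] := boolP (lt i s); have [js|js] := boolP (lt j s).
- by rewrite !joinEl//; exact: bc.
- rewrite (joinEr js) mulf_eq0 negb_or => _ /andP[_ /yle sj].
  by rewrite (le_trans (below_le is_) sj).
- rewrite (joinEr is_) mulf_eq0 negb_or => /andP[_ /yle si] _.
  by rewrite (le_trans (below_le js) si) orbT.
- rewrite !joinEr// !mulf_eq0 !negb_or => /andP[_ ?] /andP[_ ?].
  exact: yc.
Qed.

Lemma join_s : join b y 0 s != 0.
Proof.
have [_ ys _] := fy; rewrite joinEr ?ltii// mulf_neq0// gt_eqF//.
Qed.

Lemma lower_join : lower s (join b y) = b.
Proof.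
apply/rowP => i; rewrite mxE; case: ifPn => is_; first exact: joinEl.
case: cb => _ bb _; have [//|/bb] := eqVneq (b 0 i) 0.
by rewrite /below/= (negbTE is_).
Qed.

Lemma upper_join : upper s (join b y) = y.
Proof.
rewrite /upper lower_join /join addrAC subrr add0r scalerA mulVf ?scale1r//.
by rewrite gt_eqF.
Qed.

End JoinIn.
End Join.

Section Chart.
Variables (A : pred 'I_N) (W : split_lattice n) (s : 'I_N).
Hypothesis Alow : forall i j, le i j -> A j -> A i.
Hypothesis AW : forall i, A i -> Q i *m lproj R W = Q i.

Definition star : set E := stratum_space A W `&` [set x : E | x.1 0 s != 0].

Definition stratum : set E :=
  [set x | exists y t, [/\ face_open A s y, in_lat W t & x = Phi y t]].

Lemma leQ' i j : le i j -> Q' i *m Q' j = Q' j.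
Proof. by move=> ij; rewrite mulmxBl mul1mx mulmxBr mulmx1 leV// subrr subr0. Qed.

Lemma leQQ' i j : le i j -> Q i *m Q' j = 0.
Proof. by move=> ij; rewrite mulmxBr mulmx1 leV// subrr. Qed.

Lemma face_open_sub y : face_open A s y -> simplex [pred i | A i && le s i] y.
Proof.
move=> [[cy y1] _ yle]; split=> //; apply: (chain_cone_sub cy) => i yi /=.
by case: cy => _ yA _; rewrite yA// yle.
Qed.

Lemma cont_on_lower (T : topologicalType) (D : set T) a :
  cont_on D a -> cont_on D (fun x => lower s (a x)).
Proof.
move=> ca; apply: cont_on_mx => k i; rewrite ord1.
have [is_|nis] := boolP (lt i s).
  apply: (@cont_on_eq _ _ _ (fun x => a x 0 i)); last exact: cont_on_coord.
  by move=> x _; rewrite mxE is_.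
apply: (@cont_on_eq _ _ _ (fun=> 0)); last exact: cont_on_cst.
by move=> x _; rewrite mxE (negbTE nis).
Qed.

(** The simplices of the open star of a vertex s are joins of their faces below
    s with their faces containing s and above; the torus splits accordingly as
    the torus of V s times the quotient by it. *)
Lemma chart_hom : exists F G,
  hom_on star (stratum `*` euclidean_cone (stratum_space (below s) (V s))) F G /\
  forall a t, simplex A a -> in_lat W t -> a 0 s != 0 ->
    F (Phi a t) = (Phi (upper s a) t, Phi (lower s a) (t *m Q s)).
Proof.
(* D1 and D2 are all the parameters; K1 and K2 restrict t to a fundamental box,
   and replace the open conditions by closed ones. *)
pose K1 := simplex A `*` lat_box (R := R) W.
pose D1 : set ('rV[R]_N * 'rV[R]_n) :=
  [set p | [/\ simplex A p.1, in_lat W p.2 & p.1 0 s != 0]].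
pose K2 := (simplex [pred i | A i && le s i] `*` lat_box (R := R) W) `*`
  ((chain_cone (below s) `&` [set b | [set x | x <= 1] (wsum b)]) `*`
   lat_box (R := R) (V s)).
pose D2 : set (('rV[R]_N * 'rV[R]_n) * ('rV[R]_N * 'rV[R]_n)) :=
  [set p | [/\ face_open A s p.1.1, in_lat W p.1.2, chain_cone (below s) p.2.1,
     wsum p.2.1 < 1 & in_lat (V s) p.2.2]].
pose phi1 (p : 'rV[R]_N * 'rV[R]_n) := Phi p.1 p.2.
pose phi2 (p : ('rV[R]_N * 'rV[R]_n) * ('rV[R]_N * 'rV[R]_n)) :=
  (Phi p.1.1 p.1.2, Phi p.2.1 p.2.2).
pose psi1 (p : 'rV[R]_N * 'rV[R]_n) :=
  (Phi (upper s p.1) p.2, Phi (lower s p.1) (p.2 *m Q s)).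
pose psi2 (p : ('rV[R]_N * 'rV[R]_n) * ('rV[R]_N * 'rV[R]_n)) :=
  Phi (join p.2.1 p.1.1) (p.1.2 *m Q' s + p.2.2).
have [||||||||||||||||||F [G [FG FE _]]] := @hom_on_of_params _ _ _ _ K1 D1 K2 D2 star
   (stratum `*` euclidean_cone (stratum_space (below s) (V s))) (0 : E)
   ((0, 0) : E * E) phi1 phi2 psi1 psi2.
- exact: norm_hausdorff.
- exact: norm_hausdorff.
- by apply: compact_setX; [exact: simplex_compact|exact: lat_box_compact].
- apply: compact_setX; apply: compact_setX; try exact: lat_box_compact.
    exact: simplex_compact.
  by apply: chain_cone_compact => //; exact: closed_le.
- by apply: cont_on_Phi; [exact: cont_on_proj1|exact: cont_on_proj2].
- apply: cont_on_pair; apply: cont_on_Phi.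
  + by apply: cont_on_fst; exact: cont_on_proj1.
  + by apply: cont_on_snd; exact: cont_on_proj1.
  + by apply: cont_on_fst; exact: cont_on_proj2.
  + by apply: cont_on_snd; exact: cont_on_proj2.
- by move=> [a t] [[/= sa /lat_box_sub Wt] [_ as0]].
- move=> [[y t] [b u]] /= [[[_ /lat_box_sub Wt] [_ /lat_box_sub Wu]] []].
  move=> [y' [t' [fy' Wt' /Phi_eq[/= -> _]]]].
  by rewrite euclidean_coneE => -[b' [u' [cb' b1' Wu' /Phi_eq[/= -> _]]]].
- by move=> [a t] [/= sa Wt as0]; split=> //; exists a, t.
- move=> [[y t] [b u]] [/= fy Wt cb b1 Wu]; split; first by exists y, t.
  by rewrite euclidean_coneE; exists b, u.
- by move=> x [/stratum_space_param[p Kp <-] _]; exists p.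
- move=> [x z] [/= [y [t [fy Wt ->]]]]; rewrite euclidean_coneE.
  move=> [b [u [cb b1 Wu ->]]].
  have [t' Bt' tt'] := lat_box_repr Wt; have [u' Bu' uu'] := lat_box_repr Wu.
  exists ((y, t'), (b, u')).
    by split; split=> //=; [exact: face_open_sub|split=> //=; exact: ltW].
  by rewrite /phi2/= -(Phi_integral _ tt') -(Phi_integral _ uu').
- have cl : cont_on (K1 `&` D1) (fun p => lower s p.1).
    by apply: cont_on_lower; exact: cont_on_proj1.
  apply: cont_on_pair; apply: cont_on_Phi.
  + apply: cont_onZ; last by apply: cont_onB => //; exact: cont_on_proj1.
    apply: cont_onV.
      by move=> [a t] [_ [/= sa _ as0]]; rewrite gt_eqF// subr_gt0 (lower_lt1 sa as0).
    by apply: cont_onB; [exact: cont_on_cst|exact: cont_on_wsum].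
  + exact: cont_on_proj2.
  + exact: cl.
  + by apply: cont_on_mulmx; exact: cont_on_proj2.
- have cb : cont_on (K2 `&` D2) (fun p => p.2.1) by apply: cont_on_fst; exact: cont_on_proj2.
  apply: cont_on_Phi.
    apply: cont_onD => //; apply: cont_onZ.
      by apply: cont_onB; [exact: cont_on_cst|exact: cont_on_wsum].
    by apply: cont_on_fst; exact: cont_on_proj1.
  apply: cont_onD; first by apply: cont_on_mulmx; apply: cont_on_snd; exact: cont_on_proj1.
  by apply: cont_on_snd; exact: cont_on_proj2.
- move=> [a t] [a' t'] [/= sa Wt as0] [/= sa' Wt' as0'] /Phi_eq[/= e tt].
  rewrite /psi1/= -e; congr pair; apply/Phi_eq; split=> // i; rewrite !mxE.
    rewrite mulf_eq0 negb_or => /andP[_]; case: ifP => _; rewrite ?subrr ?eqxx//.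
    by rewrite subr0 => /tt.
  case: ifP => is_; rewrite ?eqxx// => ai.
  rewrite -mulmxBl; set d := t - t'.
  have -> : d *m Q s = d - d *m Q' s by rewrite mulmxBr mulmx1 subKr.
  rewrite mulmxBl; apply: is_integralB; first exact: tt.
  by apply: is_integral_lproj'; exact: tt.
- move=> [[y t] [b u]] [[y' t'] [b' u']] [/= fy Wt cb b1 Wu] [/= fy' Wt' cb' b1' Wu'].
  move=> e; have /Phi_eq[/= ey tt] := congr1 fst e.
  have /Phi_eq[/= eb uu] := congr1 snd e.
  rewrite /psi2/= -ey -eb; apply/Phi_eq; split=> // i.
  rewrite opprD addrACA -mulmxBl mulmxDl -mulmxA.
  have [_ ys _] := fy.
  have [is_|nis] := boolP (lt i s).
    rewrite (joinEl _ fy is_) => bi; apply: is_integralD; last exact: uu.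
    by rewrite mulmxA; apply: is_integral_lproj'; exact: tt.
  rewrite (joinEr _ cb nis) mulf_eq0 negb_or => /andP[_ yi].
  have si : le s i by case: fy => _ _; exact.
  rewrite leQ'//; apply: is_integralD; first exact: tt.
  by rewrite mulmxBl -Wu -Wu' -!mulmxA leQQ'// !mulmx0 subrr; exact: is_integral0.
- move=> [a t] [/= sa Wt as0].
  exists ((upper s a, t), (lower s a, t *m Q s)).
    split=> /=; [exact: upper_face|by []| |exact: (lower_lt1 sa as0)|exact: in_lat_proj].
    by case: sa => ca _; exact: lower_chain ca.
  rewrite /psi2/= (joinK sa as0)//; split=> //; congr Phi.
  by rewrite -mulmxDr subrK mulmx1.
- move=> [[y t] [b u]] [/= fy Wt cb b1 Wu].
  have [[[_ yA _] _] ys _] := fy.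
  have As : A s by exact: yA.
  exists (join b y, t *m Q' s + u).
    split=> /=; [exact: (join_simplex Alow cb b1 fy)| |exact: (join_s cb b1 fy)].
    rewrite /in_lat/= mulmxDl mulmxBr mulmx1 mulmxBl Wt -mulmxA AW//.
    by rewrite -[u in LHS]Wu -mulmxA AW// Wu.
  rewrite /psi1/= (lower_join cb fy) (upper_join cb b1 fy); split=> //; congr pair.
    apply/Phi_eq; split=> // i yi; have si : le s i by case: fy => _ _; exact.
    have -> : t *m Q' s + u - t = u - t *m Q s.
      by rewrite mulmxBr mulmx1 addrAC [t - _ - t]addrAC subrr add0r addrC.
    rewrite mulmxBl -Wu -!mulmxA leQQ'// !mulmx0 subrr; exact: is_integral0.
  by rewrite mulmxDl -mulmxA lproj'K mulmx0 add0r Wu.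
exists F, G; split=> // a t sa Wt as0; exact: (FE (a, t)).
Qed.

End Chart.

End Model.

(** * Complements of split lattices *)

Section Saturation.
Variables (R : realType).

(** The saturation of a lattice spanned by integer vectors splits off: in a
    Smith basis it is spanned by the basis vectors with a nonzero invariant
    factor. *)
Lemma saturation_split m n (M : 'M[int]_(m, n)) :
  exists (U : split_lattice n) (X : 'M[R]_(m, ldim U)) (Y : 'M[R]_(ldim U, m)),
    map_mx intr M = X *m map_mx intr (lbasis U) /\ map_mx intr (lbasis U) = Y *m map_mx intr M.
Proof.
have [L Lu [P Pu [d _ ME]]] := int_Smith_normal_form M.
(* the indices of the nonzero invariant factors *)
pose I := [pred i : 'I_n | (i < m)%N && (d`_i != 0)].
pose e (k : 'I_#|I|) : 'I_n := enum_val k.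
have eI k : (e k < m)%N && (d`_(e k) != 0) by have := enum_valP k.
have DC : rowsub e P *m colsub e (invmx P) = 1%:M.
  rewrite -mxsub_mul mulmxV//.
  by apply/matrixP => k l; rewrite !mxE (inj_eq enum_val_inj).
pose U := SplitLattice DC.
exists U, (map_mx intr (L *m \matrix_(i, k) (d`_i *+ (i == e k :> nat)))),
  (\matrix_(k, i) ((d`_(e k))%:~R^-1 *+ (i == e k :> nat)) *m map_mx intr (invmx L)).
split.
  rewrite -map_mxM; congr map_mx; rewrite {1}ME /= -mulmxA -[RHS]mulmxA; congr (_ *m _).
  apply/matrixP => i j; rewrite !mxE.
  transitivity (\sum_(k in I) d`_i *+ (i == k :> nat) * P k j).
    rewrite (bigID I)/= [X in _ + X]big1 ?addr0.
      by apply: eq_bigr => k _; rewrite mxE.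
    move=> k nk; rewrite mxE; case: eqP => [ik|_]; last by rewrite mulr0n mul0r.
    by move: nk; rewrite -ik ltn_ord /= negbK => /eqP ->; rewrite mul0rn mul0r.
  by rewrite big_enum_val; apply: eq_bigr => k _; rewrite !mxE.
have Mi : invmx L *m M = (\matrix_(i, j) (d`_i *+ (i == j :> nat))) *m P.
  by rewrite {1}ME !mulmxA mulVmx// mul1mx.
rewrite -mulmxA -map_mxM Mi map_mxM mulmxA.
have -> : \matrix_(k < #|I|, i < m) ((d`_(e k))%:~R^-1 *+ (i == e k :> nat)) *m
    map_mx intr (\matrix_(i, j) (d`_i *+ (i == j :> nat))) =
    rowsub e (1%:M : 'M[R]_n).
  apply/matrixP => k j; rewrite !mxE.
  have /andP[em d0] := eI k.
  rewrite (bigD1 (Ordinal em))//= big1 ?addr0; last first.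
    move=> i ne; rewrite mxE; case: eqP => [ie|_]; last by rewrite mulr0n mul0r.
    by move: ne; rewrite -val_eqE/= ie eqxx.
  rewrite !mxE eqxx mulr1n /= -(inj_eq val_inj) /=; case: eqP => _.
    by rewrite mulr1n mulVf// intr_eq0.
  by rewrite mulr0n mulr0.
by rewrite mul_rowsub_mx mul1mx; apply/matrixP => i j; rewrite !mxE.
Qed.

Lemma row_free_basis n (U : split_lattice n) :
  row_free (map_mx (intr : int -> R) (lbasis U)).
Proof.
apply/row_freeP; exists (map_mx intr (lcoord U)).
by rewrite -map_mxM lbasisK map_mx1.
Qed.

Lemma lbasis_proj n (U : split_lattice n) :
  map_mx intr (lbasis U) *m lproj R U = map_mx intr (lbasis U).
Proof. by rewrite -map_mxM mulmxA lbasisK mul1mx. Qed.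

(** The complement of V in W is the saturation of the image of W under the
    projection along V. *)
Lemma lattice_complement n (V W : split_lattice n) :
  lproj R V *m lproj R W = lproj R V ->
  exists U : split_lattice n,
    [/\ (ldim V + ldim U)%N = ldim W,
      forall t, in_lat (R := R) W t -> in_lat U (t *m lproj' R V) &
      forall u, in_lat (R := R) U u -> in_lat W u /\ u *m lproj' R V = u].
Proof.
move=> VW.
have [U [X [Y [TX UY]]]] :=
  saturation_split (lcoord W *m lbasis W *m (1%:M - lcoord V *m lbasis V)).
have TE : map_mx (intr : int -> R) (lcoord W *m lbasis W *m
    (1%:M - lcoord V *m lbasis V)) = lproj R W *m lproj' R V.
  by rewrite map_mxM lproj'E.
have TW : lproj R W *m lproj' R V *m lproj R W = lproj R W *m lproj' R V.
  by rewrite mulmxBr mulmx1 mulmxBl lproj_idem -mulmxA VW.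
have TV : lproj R W *m lproj' R V *m lproj' R V = lproj R W *m lproj' R V.
  by rewrite -mulmxA [lproj' R V *m _]mulmxBr mulmx1 lproj'K subr0.
rewrite TE in TX UY.
pose DU := map_mx (intr : int -> R) (lbasis U).
pose DV := map_mx (intr : int -> R) (lbasis V).
pose DW := map_mx (intr : int -> R) (lbasis W).
have DUW : DU *m lproj R W = DU by rewrite /DU UY -mulmxA TW.
have DUV : DU *m lproj' R V = DU by rewrite /DU UY -mulmxA TV.
have DVW : DV *m lproj R W = DV.
  by rewrite -{1}[DV]lbasis_proj -mulmxA VW lbasis_proj.
have pW : lproj R W = map_mx intr (lcoord W) *m DW by rewrite -map_mxM.
have pV : lproj R V = map_mx intr (lcoord V) *m DV by rewrite -map_mxM.
exists U; split.
- have e1 : (col_mx DV DU <= DW)%MS.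
    rewrite col_mx_sub; apply/andP; split.
      by rewrite -DVW pW mulmxA submxMl.
    by rewrite -DUW pW mulmxA submxMl.
  have e2 : (DW <= col_mx DV DU)%MS.
    have -> : DW = DW *m lproj R V + DW *m lproj' R V.
      by rewrite -mulmxDr subrKC mulmx1.
    apply: addmx_sub.
      by rewrite pV mulmxA; apply: submx_trans (submxMl _ _) _; rewrite -addsmxE addsmxSl.
    rewrite -[DW]lbasis_proj -mulmxA TX mulmxA -/DU.
    by apply: submx_trans (submxMl _ _) _; rewrite -addsmxE addsmxSr.
  have fr : row_free (col_mx DV DU).
    apply/row_freeP; exists (row_mx (map_mx intr (lcoord V))
       (lproj' R V *m map_mx intr (lcoord U))).
    rewrite mul_col_row -map_mxM lbasisK map_mx1 !mulmxA DUV.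
    rewrite -[DU *m map_mx _ (lcoord U)]map_mxM lbasisK map_mx1.
    have -> : DV *m lproj' R V = 0 by rewrite mulmxBr mulmx1 lbasis_proj subrr.
    have -> : DU *m map_mx intr (lcoord V) = 0.
      rewrite -DUV -mulmxA [lproj' R V *m _]mulmxBl mul1mx -map_mxM.
      by rewrite -mulmxA lbasisK mulmx1 subrr mulmx0.
    by rewrite mul0mx -scalar_mx_block.
  have := mxrankS e1; have := mxrankS e2.
  move: fr (row_free_basis W); rewrite /row_free -/DW => /eqP -> /eqP ->.
  by move=> h1 h2; apply/eqP; rewrite eqn_leq h1 h2.
- move=> t Wt; rewrite /in_lat/= -{1}Wt -[t *m _ *m _]mulmxA TX mulmxA -mulmxA.
  by rewrite lbasis_proj -mulmxA -TX mulmxA Wt.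
- move=> u Uu; have -> : u = u *m map_mx intr (lcoord U) *m DU.
    by rewrite -mulmxA -map_mxM.
  by split; rewrite /in_lat/= -[LHS]mulmxA ?DUW ?DUV.
Qed.

End Saturation.

(** * The stratification of the model *)

Section Stratification.
Variables (R : realType) (n N : nat) (le : rel 'I_N).
Variable V : 'I_N -> split_lattice n.
Hypotheses (le_refl : reflexive le) (le_trans : transitive le).
Hypothesis le_anti : antisymmetric le.
Hypothesis leV : forall i j, le i j -> lproj R (V i) *m lproj R (V j) = lproj R (V i).

Local Notation E := (model_space R n N).
Local Notation Q i := (lproj R (V i)).
Local Notation Q' i := (lproj' R (V i)).
Local Notation Phi := (Phi (R := R) V).
Local Notation stratum := (stratum (R := R) le V).
Local Notation star := (star (R := R) le V).
Local Notation face_open := (face_open (R := R) le).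
Local Notation simplex := (simplex (R := R) le).
Local Notation stratum_space := (stratum_space (R := R) le V).
Local Notation below := (below le).
Local Notation d i := (ldim (V i)).

(** A stratum is the product of an open dual cell with the torus of W modulo
    V s, which is a standard torus by lattice_complement. *)
Lemma stratum_loc_euclidean (A : pred 'I_N) W s e :
  Q s *m lproj R W = Q s -> loc_euclidean R e (face_open A s) ->
  loc_euclidean R (e + (ldim W - d s)) (stratum A W s).
Proof.
move=> AW eface; have [U [dU WU UW]] := lattice_complement AW.
have -> : (ldim W - d s = ldim U)%N by rewrite -dU addKn.
pose DU : 'M[R]_(_, n) := map_mx intr (lbasis U).
pose CU : 'M[R]_(n, _) := map_mx intr (lcoord U).
have CD : CU *m DU = lproj R U by rewrite -map_mxM.
have DC : DU *m CU = 1%:M by rewrite -map_mxM lbasisK map_mx1.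
have DU_U x : in_lat U (x *m DU) by rewrite /in_lat/= -mulmxA lbasis_proj.
pose K1 := simplex [pred i | A i && le s i] `*` lat_box (R := R) W.
pose D1 : set ('rV[R]_N * 'rV[R]_n) := [set p | face_open A s p.1 /\ in_lat W p.2].
pose K2 := simplex [pred i | A i && le s i] `*` unit_box (0 : 'rV[R]_(ldim U)).
pose D2 : set ('rV[R]_N * 'rV[R]_(ldim U)) := [set p | face_open A s p.1].
pose phi1 (p : 'rV[R]_N * 'rV[R]_n) := Phi p.1 p.2.
pose phi2 (p : 'rV[R]_N * 'rV[R]_(ldim U)) := (p.1, torus_emb p.2).
pose psi1 (p : 'rV[R]_N * 'rV[R]_n) := (p.1, torus_emb (p.2 *m Q' s *m CU)).
pose psi2 (p : 'rV[R]_N * 'rV[R]_(ldim U)) := Phi p.1 (p.2 *m DU).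
have ctor (T : topologicalType) (D : set T) k (f : T -> 'rV[R]_k) :
    cont_on D f -> cont_on D (fun x => torus_emb (f x)).
  by move=> cf; apply: cont_on_comp_continuous cf _; exact: torus_emb_continuous.
have [||||||||||||||||||f [g [fg _ _]]] := @hom_on_of_params _ _ _ _ K1 D1 K2 D2
   (stratum A W s) (face_open A s `*` range (@torus_emb R (ldim U)))
   (0 : E) ((0, (0, 0)) : _ * (_ * _)) phi1 phi2 psi1 psi2.
- exact: norm_hausdorff.
- exact: norm_hausdorff.
- by apply: compact_setX; [exact: simplex_compact|exact: lat_box_compact].
- by apply: compact_setX; [exact: simplex_compact|exact: unit_box_compact].
- by apply: cont_on_Phi; [exact: cont_on_proj1|exact: cont_on_proj2].
- by apply: cont_on_pair; [exact: cont_on_proj1|apply: ctor; exact: cont_on_proj2].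
- move=> [y t] [[_ /= /lat_box_sub Wt]] [y' [t' [fy' _ /Phi_eq[/= e' _]]]].
  by split=> //=; rewrite e'.
- by move=> [y t] [_ [/= fy _]].
- by move=> [y t] [/= fy Wt]; exists y, t.
- by move=> [y t] /= fy; split=> //=; exists t.
- move=> x [y [t [fy Wt ->]]]; have [t' Bt' tt'] := lat_box_repr Wt.
  exists (y, t'); last by apply/esym; exact: Phi_integral.
  by split=> //=; exact: face_open_sub.
- move=> [y p] [/= fy [t _ <-]]; have [t' Bt' tt'] := unit_box_repr 0 t.
  exists (y, t'); first by split=> //=; exact: face_open_sub.
  by rewrite /phi2/=; congr pair; apply/esym/torus_embE.
- apply: cont_on_pair; first exact: cont_on_proj1.
  by apply: ctor; apply: cont_on_mulmx; apply: cont_on_mulmx; exact: cont_on_proj2.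
- by apply: cont_on_Phi; [exact: cont_on_proj1|apply: cont_on_mulmx; exact: cont_on_proj2].
- move=> [y t] [y' t'] [/= fy Wt] [/= fy' Wt'] /Phi_eq[/= e' tt].
  rewrite /psi1/= -e'; congr pair; apply/torus_embE.
  rewrite -mulmxBl -mulmxBl; apply: is_integralM; apply: tt.
  by case: fy.
- move=> [y t] [y' t'] /= fy fy' e'.
  have /= ey := congr1 fst e'; have /torus_embE/= tt := congr1 snd e'.
  rewrite /psi2/= -ey; apply: Phi_integral; rewrite -mulmxBl.
  exact: is_integralM.
- move=> [y t] [/= fy Wt]; exists (y, t *m Q' s *m CU) => //; split=> //.
  apply/Phi_eq; split=> //= i yi; have si : le s i by case: fy => _ _; exact.
  rewrite -mulmxA CD (WU _ Wt) mulmxBl -mulmxA (leQ' leV si) subrr.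
  exact: is_integral0.
- move=> [y t] /= fy; have [Wt tQ] := UW _ (DU_U t).
  exists (y, t *m DU) => //; split=> //.
  by rewrite /psi1/= tQ -mulmxA DC mulmx1.
apply: (loc_euclidean_hom fg); apply: loc_euclidean_prod => //.
exact: loc_euclidean_torus.
Qed.

Hypothesis dlt : forall i j, lt le i j -> (d i < d j)%N.

(** The open dual cells of the order complex of A are Euclidean, of the
    dimensions that occur in a disc of dimension M divided into dual cells. *)
Record admissible (A : pred 'I_N) (W : split_lattice n) (M : nat) : Prop := {
  adm_lower : forall i j, le i j -> A j -> A i;
  adm_proj : forall i, A i -> Q i *m lproj R W = Q i;
  adm_dim : forall i, A i -> (d i <= M)%N;
  adm_euclidean : forall i, A i -> loc_euclidean R (M - d i) (face_open A i) }.

Lemma dim_le (U W : split_lattice n) :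
  lproj R U *m lproj R W = lproj R U -> (ldim U <= ldim W)%N.
Proof. by move=> /lattice_complement[Z [<- _ _]]; exact: leq_addr. Qed.

(** The open dual cell of i has dimension M - d i, and the torus of W modulo
    V i has dimension ldim W - d i. *)
Definition stratum_dim (W : split_lattice n) (M : nat) (i : 'I_N) : nat :=
  (M + ldim W - 2 * d i)%N.

(** A point belongs to the k-th term when the vertices of the simplex carrying
    it all have strata of dimension at most k. *)
Definition model_filtration (W : split_lattice n) (M : nat) (k : nat) : set E :=
  [set x : E | forall i, (k < stratum_dim W M i)%N -> x.1 0 i = 0].

Section Embedded.
Variables (A : pred 'I_N) (W : split_lattice n) (M : nat).
Hypothesis adm : admissible A W M.
Variables (T : topologicalType) (iota : T -> E).
Hypotheses (cT : compact [set: T]) (iotac : continuous iota)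
  (iotaI : injective iota) (iotaE : range iota = stratum_space A W).

Let X k : set T := iota @^-1` model_filtration W M k.

Lemma embedding_inverse : [set: T] !=set0 ->
  exists g, hom_on [set: T] (stratum_space A W) iota g.
Proof.
move=> [x0 _]; rewrite -iotaE.
by apply: compact_injection_hom => //; exact: norm_hausdorff.
Qed.

Lemma embedded_hausdorff : hausdorff_space T.
Proof.
move=> x y xy; apply: iotaI.
apply: (@norm_hausdorff _ E) => U U' Ux U'y.
have [z [Uz U'z]] := xy _ _ (iotac Ux) (iotac U'y).
by exists (iota z).
Qed.

Section AtVertex.
Variable (s : 'I_N).
Hypothesis As : A s.
Variables (F : E -> E * E) (G : E * E -> E).
Hypothesis FG : hom_on (star A W s)
  (stratum A W s `*` euclidean_cone (stratum_space (below s) (V s))) F G.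
Hypothesis FE : forall a t, simplex A a -> in_lat W t -> a 0 s != 0 ->
  F (Phi a t) = (Phi (upper le s a) t, Phi (lower le s a) (t *m Q s)).

Local Notation j := (stratum_dim W M s).
Local Notation m := (M + ldim W)%N.

Let dsM : (d s <= M)%N. Proof. exact: (adm_dim adm). Qed.
Let dsW : (d s <= ldim W)%N. Proof. by apply: dim_le; exact: (adm_proj adm). Qed.

Lemma star_support a i : simplex A a -> a 0 s != 0 -> a 0 i != 0 ->
  lt le i s \/ (d s <= d i)%N.
Proof.
move=> [[_ _ ac] _] as0 ai; have /orP[si|is_] := ac _ _ as0 ai.
  by right; have [->//|ne] := eqVneq s i; apply/ltnW/dlt/andP.
by have [->|ne] := eqVneq i s; [right|left; rewrite /lt is_].
Qed.

(** In the star of s only the vertices below s have strata larger than that of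
    s, and their coefficients are read off from the cone coordinate. *)
Lemma star_filtration i x : star A W s (iota x) ->
  X (j + i + 1)%N x <-> ((F (iota x)).2 = 0 \/ exists r l, [/\ 0 <= r, r < 1,
    stratum_space (below s) (V s) l /\ model_filtration (V s) (d s).-1 i l &
    (F (iota x)).2 = r *: l]).
Proof.
move=> [[a [t [sa Wt ix]]]]; rewrite /X /= ix /= => as0; rewrite FE//=.
have low_lt k : lower le s a 0 k != 0 -> lt le k s /\ a 0 k != 0.
  by rewrite mxE; case: ifP => //; rewrite eqxx.
have arith k : lt le k s ->
    ((i < stratum_dim (V s) (d s).-1 k)%N = (j + i + 1 < stratum_dim W M k)%N).
  move=> /dlt; rewrite /stratum_dim => dks; apply/idP/idP; lia.
split=> [Xa|Xa k kj].
- have : euclidean_cone (stratum_space (below s) (V s)) (Phi (lower le s a) (t *m Q s)).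
    rewrite euclidean_coneE; exists (lower le s a), (t *m Q s); split=> //.
    + by case: sa => ca _; exact: lower_chain ca.
    + exact: (lower_lt1 sa as0).
    + exact: in_lat_proj.
  move=> [|[r [l [r0 r1 Ll e]]]]; first by left.
  have [rz|rn] := eqVneq r 0; first by left; rewrite e rz scale0r.
  right; exists r, l; split=> //; split=> // k kj.
  apply: contrapT => /eqP lk.
  have ek : lower le s a 0 k = r * l.1 0 k.
    by have := congr1 (fun z : E => z.1 0 k) e; rewrite /= => ->; rewrite mxE.
  have [ks ak] : lt le k s /\ a 0 k != 0 by apply: low_lt; rewrite ek mulf_neq0.
  by move/eqP: ak; apply; apply: Xa; rewrite -arith.
- apply: contrapT => /eqP ak.
  have [ks|dk] := star_support sa as0 ak; last first.
    by move: kj; rewrite /stratum_dim; lia.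
  have lk : lower le s a 0 k = a 0 k by rewrite mxE ks.
  case: Xa => [e|[r [l [r0 r1 [_ Xl] e]]]].
    have := congr1 (fun z : E => z.1 0 k) e; rewrite /= lk => a0.
    by rewrite a0 mxE eqxx in ak.
  have := congr1 (fun z : E => z.1 0 k) e; rewrite /= lk mxE Xl ?arith// mulr0.
  by move=> a0; rewrite a0 eqxx in ak.
Qed.

Lemma star_filtration0 x : star A W s (iota x) ->
  X j x <-> (F (iota x)).2 = 0.
Proof.
move=> [[a [t [sa Wt ix]]]]; rewrite /X /= ix /= => as0; rewrite FE//=.
split=> [Xa|e k kj].
  suff -> : lower le s a = 0 by rewrite Phi0.
  apply/rowP => k; rewrite !mxE; case: ifP => // ks.
  by apply: Xa; have := dlt ks; rewrite /stratum_dim; lia.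
apply: contrapT => /eqP ak.
have [ks|dk] := star_support sa as0 ak; last first.
  by move: kj; rewrite /stratum_dim; lia.
have := congr1 (fun z : E => z.1 0 k) e; rewrite /= mxE ks => a0.
by rewrite a0 mxE eqxx in ak.
Qed.

(** The part S0 of the stratum over which the chart is taken is a Euclidean
    neighbourhood for the stratification, and the whole stratum for the link
    bundle. *)
Lemma model_chart (U B : topologicalType) (S0 : set E) (S1 : set U)
    (p : E -> U) (q : U -> E) (b : B -> U) :
  [set: T] !=set0 ->
  S0 `<=` stratum A W s -> hom_on S0 S1 p q ->
  continuous b -> injective b -> (forall u, S1 u <-> exists x, b x = u) ->
  (forall (Z : topologicalType) (h : Z -> B), continuous (b \o h) -> continuous h) ->
  exists f : [set x | star A W s (iota x) /\ S0 (F (iota x)).1] ->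
             B * open_cone R (stratum_space (below s) (V s)),
    conical_chart m X j
      (fun i => set_val @^-1` model_filtration (V s) (d s).-1 i) f /\
    forall y, b (f y).1 = p (F (iota (set_val y))).1 /\
              cone_emb (f y).2 = (F (iota (set_val y))).2.
Proof.
move=> T0 S0S pq bc bI bS bini.
have [g ig] := embedding_inverse T0.
have hom : hom_on [set x | star A W s (iota x) /\ S0 (F (iota x)).1]
    (S1 `*` euclidean_cone (stratum_space (below s) (V s)))
    ((fun z => (p z.1, z.2)) \o (F \o iota))
    ((g \o G) \o (fun z => (q z.1, z.2))).
  apply: (hom_on_comp (B := S0 `*` euclidean_cone (stratum_space (below s) (V s)))).
    apply: (hom_on_comp (B := [set x | star A W s x /\ S0 (F x).1])).
      have [_ _ ig1 ig2] := ig.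
      apply: (hom_on_sub ig) => //; first by move=> x [[]].
      move=> x [[sx xs] S0x]; have [_ e] := ig2 _ sx.
      by rewrite /= e.
    have [_ _ FG1 FG2] := FG.
    apply: (hom_on_sub FG) => //; first by move=> x [].
    - by move=> [x y] [/= /S0S ? ?].
    - by move=> x [/FG1[[_ ?] _] ?]; split.
    - by move=> [x y] [/= S0x ?]; have [|? e] := FG2 (x, y);
        [split=> //=; exact: S0S|rewrite /= e].
  apply: (hom_on_pair (f := p) (f' := id) (g := q) (g' := id) pq).
  by split=> //; exact: cont_on_id.
have H1 : forall i y, (i < m - j)%N ->
    [set x | star A W s (iota x) /\ S0 (F (iota x)).1] y ->
    X (j + i + 1)%N y <-> ((F (iota y)).2 = 0 \/ exists r l, [/\ 0 <= r, r < 1,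
    stratum_space (below s) (V s) l /\ model_filtration (V s) (d s).-1 i l &
    (F (iota y)).2 = r *: l]).
  by move=> i y _ [sy _]; exact: star_filtration.
have H2 : forall y, [set x | star A W s (iota x) /\ S0 (F (iota x)).1] y ->
    X j y <-> (F (iota y)).2 = 0.
  by move=> y [sy _]; exact: star_filtration0.
have := chart_of_hom (@stratum_space_compact R n N le V _ _) (@mass_continuous R n N)
  (@massZ R n N) (@mass_stratum_space R n N le V _ _) hom bc bI bS bini H1 H2.
exact.
Qed.

Lemma star_near x : star A W s (iota x) -> \forall y \near x, star A W s (iota y).
Proof.
move=> [_ /= xs].
have cs : cont_on [set: T] (fun y => (iota y).1 0 s).
  by apply: cont_on_coord; apply: cont_on_fst; exact: continuous_cont_on.
have n0 : nbhs ((iota x).1 0 s) [set r | r != 0].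
  by apply: open_nbhs_nbhs; split=> //; exact: open_neq.
have := cont_on_near cs I n0; apply: nbhsS => y ys.
by split; [rewrite -iotaE; exists y|exact: ys].
Qed.

Lemma vertex_link x :
  ((0 < d s)%N -> stratified R ((d s).-1 + d s)
    (fun i => set_val @^-1` model_filtration (V s) (d s).-1 i :
              set (stratum_space (below s) (V s)))) ->
  star A W s (iota x) -> X j x ->
  link_at R (stratified R) m X j x
    (fun i => set_val @^-1` model_filtration (V s) (d s).-1 i :
              set (stratum_space (below s) (V s))).
Proof.
move=> sL sx Xx; split.
- exact/compact_set_type/stratum_space_compact.
- move=> jm; have d0 : (0 < d s)%N by move: jm; rewrite /stratum_dim; lia.
  have -> : (m - j - 1 = (d s).-1 + d s)%N by rewrite /stratum_dim; lia.
  exact: sL.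
- move=> jm; have d0 : (d s = 0)%N by move: jm dsM dsW; rewrite /stratum_dim; lia.
  apply/seteqP; split=> // l _; have [a [_ [[[_ aA _] a1] _ _]]] := set_valP l.
  have a0 : a = 0.
    apply/rowP => i; rewrite mxE; apply: contrapT => /eqP/aA /=.
    by rewrite /below /= => /dlt; rewrite d0.
  by move/eqP: a1; rewrite a0 -(scale0r 0) wsumZ mul0r eq_sym oner_eq0.
have [Fc _ F1 _] := FG; have [[Sx Cx] _] := F1 _ sx.
have jE : (M - d s + (ldim W - d s) = j)%N by rewrite /stratum_dim; lia.
have := stratum_loc_euclidean (adm_proj adm As) (adm_euclidean adm As).
rewrite jE => /(_ _ Sx)[N0 [f0 [g0 [N0S N0x fg0]]]].
have T0 : [set: T] !=set0 by exists x.
have idc : continuous (@id 'rV[R]_j) by move=> y; exact: cvg_id.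
have idI : injective (@id 'rV[R]_j) by [].
have idS (u : 'rV[R]_j) : [set: 'rV[R]_j] u <-> exists x, id x = u.
  by split=> // _; exists u.
have [f [fch _]] := model_chart T0 N0S fg0 idc idI idS (fun _ _ hc => hc).
exists [set y | star A W s (iota y) /\ N0 (F (iota y)).1], f; split=> //.
have cF : cont_on [set y | star A W s (iota y)] (fun y => (F (iota y)).1).
  apply: cont_on_fst; apply: (cont_on_comp (g := F) (f := iota) (B := star A W s)) => //.
  exact: continuous_cont_on.
have := cont_on_near cF sx N0x; apply: filterS2 (star_near sx) => y sy H.
by split=> //; apply: H => //; have [[]] := F1 _ sy.
Qed.

End AtVertex.

(** Some vertex of the simplex carrying x accounts for x being in X_k but not
    in X_(k-1). *)
Lemma filtration_vertex k x : filt_diff X k x ->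
  exists s, [/\ A s, star A W s (iota x) & stratum_dim W M s = k].
Proof.
move=> [Xk nXk]; have : stratum_space A W (iota x) by rewrite -iotaE; exists x.
move=> ss; have [a [t [[[a0 aA ac] a1] Wt ix]]] := ss.
have [s [as0 sk]] : exists s, a 0 s != 0 /\ (k <= stratum_dim W M s)%N.
  case: k Xk nXk => [|k] Xk /= nXk.
    suff [s as0] : exists s, a 0 s != 0 by exists s.
    apply: contrapT => no; have a0' : wsum a = 0.
      by apply: big1 => i _; apply: contrapT => /eqP ai; apply: no; exists i.
    by move/eqP: a1; rewrite a0' eq_sym oner_eq0.
  apply: contrapT => no; apply: nXk => i ki; rewrite ix /=.
  by apply: contrapT => /eqP ai; apply: no; exists i.
have ck : (stratum_dim W M s <= k)%N.
  rewrite leqNgt; apply/negP => kc; move/eqP: as0; apply.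
  by have := Xk s kc; rewrite ix.
exists s; split; [exact: aA| |by apply/eqP; rewrite eqn_leq ck].
by split=> //=; rewrite ix.
Qed.

End Embedded.

Hypothesis adm_below : forall s, (0 < d s)%N -> admissible (below s) (V s) (d s).-1.

(** By induction on a bound for the ranks: the link at s is the model for the
    elements below s, whose ranks are less than d s. *)
Theorem model_stratified (A : pred 'I_N) W M (T : topologicalType) (iota : T -> E) :
  admissible A W M -> (0 < M + ldim W)%N ->
  compact [set: T] -> continuous iota -> injective iota ->
  range iota = stratum_space A W ->
  stratified R (M + ldim W) (fun k => iota @^-1` model_filtration W M k).
Proof.
move=> adm; have [b Ab] : exists b, forall i, A i -> (d i < b)%N.
  by exists M.+1 => i Ai; rewrite ltnS; exact: (adm_dim adm).
elim/ltn_ind: b A W M T iota adm Ab => b IH A W M T iota adm Ab m0 cT ic iI iE.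
apply: stratified_cone => //.
- exact: compact_paracompact.
- exact: embedded_hausdorff ic iI.
- apply/seteqP; split=> // x _ i; rewrite /stratum_dim; lia.
- move=> i _ x Xx k ik; apply: Xx; lia.
- move=> i _.
  have -> : iota @^-1` model_filtration W M i =
      \bigcap_(k in [set k | (i < stratum_dim W M k)%N])
        ((fun x => (iota x).1 0 k) @^-1` [set 0]).
    by apply/seteqP; split=> x Xx k; exact: Xx.
  apply: closed_bigI => k _; apply: closed_preimage; last exact: closed_eq.
  apply: cont_on_setT; apply: cont_on_coord; apply: cont_on_fst.
  exact: continuous_cont_on.
- move=> j x jm fx; have [s [As sx js]] := filtration_vertex iE fx.
  have [F [G [FG FE]]] := chart_hom le_refl le_trans le_anti leV s
    (adm_lower adm) (adm_proj adm).
  exists _, (fun i => set_val @^-1` model_filtration (V s) (d s).-1 i :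
              set (set_type (stratum_space (below s) (V s)))).
  rewrite -js; apply: (vertex_link adm cT ic iI iE As FG FE _ sx); last first.
    by rewrite js; case: fx.
  move=> d0; apply: (IH (d s) (Ab _ As) (below s) (V s) (d s).-1 _ set_val) => //.
  + exact: adm_below.
  + by move=> i /dlt.
  + lia.
  + exact/compact_set_type/stratum_space_compact.
  + exact: set_val_continuous.
  + apply/seteqP; split=> [_ [l _ <-]|l Ll]; first exact: set_valP.
    by exists (elt_of Ll).
Qed.

End Stratification.

(** * Polyhedral cones *)

Section Polyhedral.
Variables (R : realType) (n : nat).
Implicit Types (u x y : 'rV[R]_n) (s : seq 'rV[int]_n).

Lemma dotrvE u x : dotrv u x = (x *m u^T) 0 0.
Proof. by rewrite mxE; apply: eq_bigr => i _; rewrite !mxE mulrC. Qed.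

Lemma dotrvDr u x y : dotrv u (x + y) = dotrv u x + dotrv u y.
Proof. by rewrite !dotrvE mulmxDl mxE. Qed.

Lemma dotrvZr u r x : dotrv u (r *: x) = r * dotrv u x.
Proof. by rewrite !dotrvE -scalemxAl mxE. Qed.

Lemma dotrv0r u : dotrv u 0 = 0.
Proof. by rewrite dotrvE mul0mx mxE. Qed.

Lemma dotrvNr u x : dotrv u (- x) = - dotrv u x.
Proof. by rewrite -scaleN1r dotrvZr mulN1r. Qed.

Lemma dotrvDl u v x : dotrv (u + v) x = dotrv u x + dotrv v x.
Proof. by rewrite !dotrvE linearD mulmxDr mxE. Qed.

Lemma dotrvZl u r x : dotrv (r *: u) x = r * dotrv u x.
Proof. by rewrite !dotrvE linearZ -scalemxAr mxE. Qed.

Lemma dotrvNl u x : dotrv (- u) x = - dotrv u x.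
Proof. by rewrite -scaleN1r dotrvZl mulN1r. Qed.

Lemma dotrv_sumr (I : Type) (r : seq I) (P : pred I) (F : I -> 'rV[R]_n) u :
  dotrv u (\sum_(i <- r | P i) F i) = \sum_(i <- r | P i) dotrv u (F i).
Proof. by apply: (big_morph _ (dotrvDr u) (dotrv0r u)). Qed.

Lemma cone_hull0 s : cone_hull (R := R) s 0.
Proof. by exists (fun=> 0) => //; rewrite big1// => v _; rewrite scale0r. Qed.

Lemma cone_hullD s x y : cone_hull s x -> cone_hull s y -> cone_hull s (x + y).
Proof.
move=> [a a0 ->] [b b0 ->]; exists (fun v => a v + b v).
  by move=> v; rewrite addr_ge0.
by rewrite -big_split; apply: eq_bigr => v _; rewrite scalerDl.
Qed.

Lemma cone_hullZ s r x : 0 <= r -> cone_hull s x -> cone_hull s (r *: x).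
Proof.
move=> r0 [a a0 ->]; exists (fun v => r * a v); first by move=> v; rewrite mulr_ge0.
by rewrite scaler_sumr; apply: eq_bigr => v _; rewrite scalerA.
Qed.

Lemma cone_hull_gen s v : v \in s -> cone_hull s (realrv R v).
Proof.
move=> vs; exists (fun w => (w == v)%:R / (count_mem v s)%:R).
  by move=> w; rewrite divr_ge0.
transitivity (\sum_(w <- s | w == v) (count_mem v s)%:R^-1 *: realrv R v).
  rewrite big_const_seq iter_addr_0 -scaler_nat scalerA divff ?scale1r//.
  by rewrite pnatr_eq0 -lt0n -has_count has_pred1.
rewrite big_mkcond; apply: eq_bigr => w _; case: eqP => [->|_].
  by rewrite mul1r.
by rewrite mul0r scale0r.
Qed.

Lemma cone_hull_sum s (r : seq 'rV[int]_n) (a : 'rV[int]_n -> R) :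
  {subset r <= s} -> (forall v, 0 <= a v) ->
  cone_hull s (\sum_(v <- r) a v *: realrv R v).
Proof.
move=> rs a0; elim: r rs => [|v r IH] rs; first by rewrite big_nil; exact: cone_hull0.
rewrite big_cons; apply: cone_hullD.
  by apply: cone_hullZ => //; apply: cone_hull_gen; apply: rs; rewrite mem_head.
by apply: IH => w wr; apply: rs; rewrite inE wr orbT.
Qed.

Lemma cone_hull_cons s v :
  cone_hull (v :: s) = [set x | exists2 t, 0 <= t & cone_hull s (x - t *: realrv R v)].
Proof.
apply/seteqP; split=> x.
  move=> [a a0 ->]; exists (a v) => //.
  by rewrite big_cons addrAC subrr add0r; exact: cone_hull_sum.
move=> [t t0 [a a0 e]].
rewrite -[x](subrK (t *: realrv R v)) e; apply: cone_hullD.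
  by apply: cone_hull_sum => // w ws; rewrite inE ws orbT.
by apply: cone_hullZ => //; apply: cone_hull_gen; rewrite mem_head.
Qed.

Lemma seq_argmin (T : eqType) (r : seq T) (f : T -> R) :
  r != [::] -> exists2 p, p \in r & forall q, q \in r -> f p <= f q.
Proof.
elim: r => // p r IH _; have [->|/IH[q qr qmin]] := eqVneq r [::].
  by exists p; rewrite ?inE ?eqxx// => q; rewrite inE => /eqP ->.
have [pq|qp] := lerP (f p) (f q).
  exists p; rewrite ?mem_head// => z; rewrite inE => /orP[/eqP ->//|/qmin].
  exact: le_trans.
exists q; rewrite ?inE ?qr ?orbT// => z; rewrite inE => /orP[/eqP ->|/qmin//].
exact: ltW.
Qed.

Lemma seq_ubound (T : eqType) (r : seq T) (f : T -> R) :
  exists2 t, 0 <= t & forall q, q \in r -> f q <= t.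
Proof.
elim: r => [|p r [t t0 tP]]; first by exists 0.
exists (t + `|f p|); first by rewrite addr_ge0.
move=> z; rewrite inE => /orP[/eqP ->|/tP fz].
  by rewrite (le_trans (ler_norm _))// lerDr.
by rewrite (le_trans fz)// lerDl.
Qed.

(** Fourier-Motzkin elimination of the coefficient of one generator at a time
    turns a finitely generated cone into a finite system of inequalities. *)
Lemma cone_hull_halfspaces s :
  exists U : seq 'rV[R]_n, cone_hull s = [set x | forall u, u \in U -> 0 <= dotrv u x].
Proof.
elim: s => [|v s [U sU]].
  exists ([seq delta_mx 0 i | i <- enum 'I_n] ++ [seq - delta_mx 0 i | i <- enum 'I_n]).
  have dE i x : dotrv (delta_mx 0 i) x = x 0 i.
    rewrite /dotrv (bigD1 i)//= mxE !eqxx mul1r big1 ?addr0// => j ji.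
    by rewrite mxE eqxx /= (negbTE ji) mul0r.
  apply/seteqP; split=> x.
    by move=> [a _ ->] u _; rewrite big_nil dotrv0r.
  move=> H; exists (fun=> 0) => //; rewrite big_nil.
  apply/rowP => i; rewrite mxE; apply/eqP; rewrite eq_le; apply/andP; split.
    rewrite -oppr_ge0 -(dE i) -dotrvNl; apply: H.
    by rewrite mem_cat; apply/orP; right; apply/map_f; rewrite mem_enum.
  rewrite -(dE i); apply: H.
  by rewrite mem_cat; apply/orP; left; apply/map_f; rewrite mem_enum.
rewrite cone_hull_cons sU; set w := realrv R v.
(* The coefficient t of v is at most (u . x) / (u . w) for u in Up and at
   least that for u in Un; elimination pairs the two kinds of bounds. *)
pose Up := [seq u <- U | 0 < dotrv u w].
pose U0 := [seq u <- U | dotrv u w == 0].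
pose Un := [seq u <- U | dotrv u w < 0].
exists (U0 ++ Up ++ [seq dotrv p w *: q - dotrv q w *: p | p <- Up, q <- Un]).
apply/seteqP; split=> x.
  move=> [t t0 H] u; rewrite !mem_cat => /or3P[].
  - rewrite mem_filter => /andP[/eqP u0 /H].
    by rewrite dotrvDr dotrvNr dotrvZr u0 mulr0 subr0.
  - rewrite mem_filter => /andP[up /H].
    rewrite dotrvDr dotrvNr dotrvZr subr_ge0; apply: le_trans.
    by rewrite mulr_ge0// ltW.
  - move=> /allpairsP[[p q] /= []]; rewrite !mem_filter => /andP[pp /H Hp].
    move=> /andP[qn /H Hq] ->; rewrite dotrvDl dotrvNl !dotrvZl.
    move: Hp Hq; rewrite !(dotrvDr, dotrvNr, dotrvZr) => Hp Hq.
    have := mulr_ge0 (ltW pp) Hq.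
    have : 0 <= - dotrv q w * (dotrv p x - t * dotrv p w).
      by rewrite mulr_ge0// oppr_ge0 ltW.
    by lra.
move=> H.
have H0 u : u \in U -> dotrv u w = 0 -> 0 <= dotrv u x.
  by move=> uU u0; apply: H; rewrite !mem_cat mem_filter u0 eqxx uU.
have Hp u : u \in U -> 0 < dotrv u w -> 0 <= dotrv u x.
  by move=> uU u0; apply: H; rewrite !mem_cat !mem_filter u0 uU !orbT.
have Hpn p q : p \in U -> q \in U -> 0 < dotrv p w -> dotrv q w < 0 ->
    0 <= dotrv p w * dotrv q x - dotrv q w * dotrv p x.
  move=> pU qU p0 q0.
  rewrite -!dotrvZl -dotrvNl -dotrvDl; apply: H; rewrite !mem_cat.
  apply/orP; right; apply/orP; right; apply/allpairsP; exists (p, q).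
  by rewrite !mem_filter p0 q0 pU qU.
have [Up0|/(seq_argmin (fun u => dotrv u x / dotrv u w))[p]] := eqVneq Up [::].
  have [t t0 tP] := seq_ubound U (fun u => dotrv u x / dotrv u w).
  exists t => // u uU; rewrite dotrvDr dotrvNr dotrvZr.
  have [un|up|u0] := ltgtP (dotrv u w) 0; last by rewrite u0 mulr0 subr0 H0.
    by have := tP u uU; rewrite ler_ndivrMr// subr_ge0.
  have : u \in Up by rewrite mem_filter up.
  by rewrite Up0.
rewrite mem_filter => /andP[p0 pU] pmin.
exists (dotrv p x / dotrv p w); first by rewrite divr_ge0 ?Hp// ltW.
move=> u uU; rewrite dotrvDr dotrvNr dotrvZr.
have [un|up|u0] := ltgtP (dotrv u w) 0; last by rewrite u0 mulr0 subr0 H0.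
  have -> : dotrv u x - dotrv p x / dotrv p w * dotrv u w =
    (dotrv p w * dotrv u x - dotrv u w * dotrv p x) / dotrv p w.
    by field; rewrite gt_eqF.
  by rewrite divr_ge0 ?Hpn// ltW.
rewrite subr_ge0 -ler_pdivlMr//; apply: pmin.
by rewrite mem_filter up.
Qed.

End Polyhedral.

(** * Homogeneous maps and quotient coordinates *)

(** Coordinates P on the quotient of the row space of B by that of A, with a
    section H. *)
Lemma quotient_coordinates (K : fieldType) (n m1 m2 : nat)
    (A : 'M[K]_(m1, n)) (B : 'M[K]_(m2, n)) : (A <= B)%MS ->
  exists (P : 'M[K]_(n, \rank B - \rank A)) (H : 'M[K]_(\rank B - \rank A, n)),
    [/\ (H <= B)%MS, H *m P = 1%:M, A *m P = 0 &
      forall x : 'rV_n, (x <= B)%MS -> x *m P = 0 -> (x <= A)%MS].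
Proof.
move=> AB; pose Z := (B :\: A)%MS.
have capE : (B :&: A :=: A)%MS by exact/capmx_idPr.
have rZ : (\rank Z = \rank B - \rank A)%N.
  by rewrite -(mxrank_cap_compl B A) capE addKn.
have ZA0 : (Z :&: <<A>> = 0)%MS.
  apply/eqP; rewrite -submx0 (cap_eqmx (eqmx_refl Z) (genmxE A)) capmx_diff.
  exact: submx_refl.
rewrite -rZ; exists (proj_mx Z <<A>>%MS *m pinvmx (row_base Z)), (row_base Z).
have HZ : (row_base Z <= Z)%MS by rewrite eq_row_base.
split.
- by apply: submx_trans HZ (diffmxSl _ _).
- by rewrite mulmxA proj_mx_id// mulmxVp// row_base_free.
- by rewrite mulmxA proj_mx_0 ?mul0mx// genmxE.
- move=> x xB; rewrite mulmxA => x0.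
  have xZA : (x <= Z + <<A>>)%MS.
    apply: submx_trans xB _; rewrite -(addsmx_diff_cap_eq B A) addsmxS//.
    by rewrite capE genmxE.
  have pz : x *m proj_mx Z <<A>>%MS = 0.
    rewrite -(@mulmxKpV _ _ _ _ (x *m proj_mx Z <<A>>%MS) (row_base Z)).
      by rewrite x0 mul0mx.
    by rewrite eq_row_base proj_mx_sub.
  rewrite -(add_proj_mx ZA0 xZA) pz add0r; rewrite -(genmxE A); exact: proj_mx_sub.
Qed.

(** A homogeneous injective map on a closed cone is proper, by compactness of
    the unit sphere of the cone. *)
Lemma homogeneous_hom (R : realType) (N e : nat) (K : set 'rV[R]_N)
    (f : 'rV[R]_N -> 'rV[R]_e) :
  closed K -> K 0 -> (forall r a, 0 <= r -> K a -> K (r *: a)) ->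
  continuous f -> (forall r a, f (r *: a) = r *: f a) ->
  (forall a a', K a -> K a' -> f a = f a' -> a = a') ->
  (forall k, exists2 a, K a & f a = k) ->
  exists g, hom_on K [set: 'rV[R]_e] f g.
Proof.
move=> cK K0 KZ cf fZ fI fS.
have f0 : f 0 = 0 by rewrite -(scale0r (0 : 'rV_N)) fZ scale0r.
have cn d : continuous (fun a : 'rV[R]_d => `|a|).
  by apply: cont_on_setT; apply: cont_on_norm; exact: cont_on_id.
have KBc r : compact (K `&` [set a | `|a| <= r]).
  apply: bounded_closed_compact.
    exists r; split; first exact: num_real.
    by move=> s rs a [_ /= ar]; exact: le_trans ar (ltW rs).
  apply: closedI => //; exact: (closed_preimage (cn N) (@closed_le R r)).
have [e0 e0_gt0 eP] : exists2 e0 : R, 0 < e0 & forall a, K a -> `|a| = 1 -> e0 <= `|f a|.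
  pose K1 := (K `&` [set a | `|a| <= 1]) `&` [set a | `|a| = 1].
  have cK1 : compact K1 by apply: compact_closedI => //; exact: (closed_preimage (cn N) (@closed_eq R 1)).
  have : \forall k \near (0 : 'rV[R]_e), forall a, K1 a -> f a = k -> False.
    apply: (@compact_fiber_near _ _ K1 f 0 set0) => //; first exact: continuous_cont_on.
    move=> a [[Ka _] /= a1] fa; have a0 : a = 0 by apply: fI => //; rewrite f0.
    by move/eqP: a1; rewrite a0 normr0 eq_sym oner_eq0.
  move=> /nbhs_ballP[e0 /= e00 He]; exists e0 => // a Ka a1.
  rewrite leNgt; apply/negP => fae.
  have : ball (0 : 'rV[R]_e) e0 (f a) by rewrite -ball_normE /ball_/= sub0r normrN.
  by move=> /He/(_ a); apply=> //; split; [split=> //=; rewrite a1|].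
have fbound a : K a -> e0 * `|a| <= `|f a|.
  move=> Ka; have [->|a0] := eqVneq a 0; first by rewrite normr0 mulr0.
  have na : 0 < `|a| by rewrite normr_gt0.
  have : e0 <= `|f (`|a|^-1 *: a)|.
    apply: eP; first by apply: KZ => //; rewrite invr_ge0.
    by rewrite normrZ gtr0_norm ?invr_gt0// mulVf// gt_eqF.
  by rewrite fZ normrZ gtr0_norm ?invr_gt0// mulrC ler_pdivlMr.
have /choice[g gE] : forall k, exists a, K a /\ f a = k.
  by move=> k; have [a Ka fa] := fS k; exists a.
exists g; split.
- exact: continuous_cont_on.
- apply: cont_on_local => k _; pose r := `|k| + 1.
  exists [set k' | `|k'| < r].
    have H : nbhs `|k| [set x | x < r].
      by apply: open_nbhs_nbhs; split; [exact: open_lt|rewrite /= ltrDl].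
    exact: (cn e k _ H).
  apply: (@compact_param_cont _ _ _ (K `&` [set a | `|a| <= r / e0]) f _ g id).
  - exact: norm_hausdorff.
  - exact: KBc.
  - exact: continuous_cont_on.
  - exact: cont_on_id.
  - move=> k' [_ /= k'r]; have [Kg fg] := gE k'; exists (g k') => //; split=> //=.
    by rewrite ler_pdivlMr// mulrC (le_trans (fbound _ Kg))// fg ltW.
  - by move=> a [Ka _] _; have [Kg fg] := gE (f a); exact: fI.
- by move=> a Ka; split=> //; have [Kg fg] := gE (f a); exact: fI.
- by move=> k _; have [] := gE k.
Qed.

(** * Open dual cells in a complete fan *)

(** The integral points of the linear span of a cone. That in_lat U is not
    larger than the span is expressed by duality. *)
Lemma cone_lattice (R : realType) (n : nat) (s : seq 'rV[int]_n) :
  exists U : split_lattice n,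
    (forall x, cone_hull (R := R) s x -> in_lat U x) /\
    (forall k (A : 'M[R]_(n, k)), (forall x, cone_hull s x -> x *m A = 0) ->
       forall x, in_lat U x -> x *m A = 0).
Proof.
pose M : 'M[int]_(size s, n) := \matrix_(k < size s) s`_k.
have [U [X [Y [MX DY]]]] := saturation_split R M.
have rowM k : row k (map_mx intr M) = realrv R s`_k.
  by apply/rowP => j; rewrite !mxE.
have MU : map_mx intr M *m lproj R U = map_mx intr M.
  by rewrite MX -mulmxA lbasis_proj.
exists U; split=> [x [a _ ->]|k A HA x Ux].
  rewrite /in_lat/= mulmx_suml !big_seq; apply: eq_bigr => v vs.
  have kv : (index v s < size s)%N by rewrite index_mem.
  rewrite -scalemxAl; congr (_ *: _).
  have := congr1 (row (Ordinal kv)) MU.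
  by rewrite row_mul rowM /= nth_index.
rewrite -Ux /lproj map_mxM DY -!mulmxA.
have -> : map_mx intr M *m A = 0.
  apply/row_matrixP => i; rewrite row_mul rowM row0; apply: HA.
  by apply: cone_hull_gen; exact: mem_nth.
by rewrite !mulmx0.
Qed.

Section FanGeometry.
Variables (R : realType) (n N : nat) (Sigma : set (set 'rV[R]_n)).
Hypothesis fanS : complete_fan Sigma.
Variable c : 'I_N -> set 'rV[R]_n.
Hypotheses (cI : injective c) (cS : forall i, Sigma (c i)).
Hypothesis cSurj : forall sigma, Sigma sigma -> exists i, c i = sigma.

Definition fan_le : rel 'I_N := fun i j => `[< c i `<=` c j >].
Local Notation le := fan_le.
Local Notation lt := (lt fan_le).

Lemma fan_leP i j : reflect (c i `<=` c j) (le i j).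
Proof. exact: asboolP. Qed.

Lemma fan_le_refl : reflexive le.
Proof. by move=> i; apply/fan_leP. Qed.

Lemma fan_le_trans : transitive le.
Proof. by move=> j i k /fan_leP ij /fan_leP jk; apply/fan_leP => x /ij/jk. Qed.

Lemma fan_le_anti : antisymmetric le.
Proof.
by move=> i j /andP[/fan_leP ij /fan_leP ji]; apply: cI; apply/seteqP; split.
Qed.

Lemma face_functional i j : le i j -> exists u : 'rV[R]_n,
  (forall x, c j x -> 0 <= dotrv u x) /\
  (forall x, c j x -> (c i x <-> dotrv u x = 0)).
Proof.
move=> /fan_leP ij; have [_ [u u0 uE]] := fan_meet fanS (cS i) (cS j).
exists u; split=> // x cjx; split=> [cix|ux].
  have : (c i `&` c j) x by split.
  by rewrite uE => -[].
have : (c j `&` [set x | dotrv u x = 0]) x by [].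
by rewrite -uE => -[].
Qed.

Lemma face_exists j u : (forall x, c j x -> 0 <= dotrv u x) ->
  exists r, forall x, c r x <-> c j x /\ dotrv u x = 0.
Proof.
move=> u0; have [r rE] := cSurj (fan_faces fanS (cS j)
  (ex_intro2 _ _ u u0 erefl : cone_face (c j `&` [set x | dotrv u x = 0]) (c j))).
by exists r => x; rewrite rE.
Qed.

Variable gens : 'I_N -> seq 'rV[int]_n.
Hypothesis gensE : forall i, c i = cone_hull (gens i).
Variable V : 'I_N -> split_lattice n.
Hypothesis V_sub : forall i x, c i x -> in_lat (V i) x.
Hypothesis V_span : forall i k (A : 'M[R]_(n, k)),
  (forall x, c i x -> x *m A = 0) -> forall x, in_lat (V i) x -> x *m A = 0.

Definition center i : 'rV[R]_n := \sum_(v <- gens i) realrv R v.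
Local Notation b := center.

Lemma center_in i : c i (b i).
Proof.
rewrite gensE; exists (fun=> 1) => //; apply: eq_bigr => v _; by rewrite scale1r.
Qed.

(** The sum of the generators is a relatively interior point: a nonnegative
    functional vanishing there vanishes on each generator. *)
Lemma center_interior i u : (forall x, c i x -> 0 <= dotrv u x) ->
  dotrv u (b i) = 0 -> forall x, c i x -> dotrv u x = 0.
Proof.
move=> u0; rewrite dotrv_sumr => /eqP; rewrite big_seq psumr_eq0; last first.
  by move=> v vs; apply: u0; rewrite gensE; exact: cone_hull_gen.
move=> /allP H x; rewrite {1}gensE => -[a _ ->].
rewrite dotrv_sumr big_seq big1// => v vs; rewrite dotrvZr.
by have := H v vs; rewrite vs /= => /eqP ->; rewrite mulr0.
Qed.

Lemma span_functional i u : (forall x, c i x -> dotrv u x = 0) ->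
  forall x, in_lat (V i) x -> dotrv u x = 0.
Proof.
move=> u0 x Vx; rewrite dotrvE (@V_span i _ u^T)// ?mxE// => y cy.
by apply/matrixP => k l; rewrite !ord1 -dotrvE u0// mxE.
Qed.

(** A cone of the fan cuts c i along a face of c i; a face through a relatively
    interior point is the whole cone. *)
Lemma center_le i j : c j (b i) -> le i j.
Proof.
move=> bj; have [[u u0 uE] _] := fan_meet fanS (cS i) (cS j).
have ub : dotrv u (b i) = 0.
  have : (c i `&` c j) (b i) by split=> //; exact: center_in.
  by rewrite uE => -[].
apply/fan_leP => x cx; have : (c i `&` [set x | dotrv u x = 0]) x.
  by split=> //=; exact: center_interior ub x cx.
by rewrite -uE => -[].
Qed.

(** Vanishing of 1 - lproj (V j) on c i extends to the span of c i. *)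
Lemma fan_leV i j : le i j -> lproj R (V i) *m lproj R (V j) = lproj R (V i).
Proof.
move=> /fan_leP ij; apply/eqP; rewrite -subr_eq0 -[X in _ - X]mulmx1 -mulmxBr.
apply/eqP/row_matrixP => k; rewrite row_mul row0.
apply: (@V_span i); last by rewrite rowE; exact: in_lat_proj.
by move=> x /ij/V_sub Vx; rewrite mulmxBr mulmx1 Vx subrr.
Qed.

Lemma in_lat_le i j (x : 'rV[R]_n) : le i j -> in_lat (V i) x -> in_lat (V j) x.
Proof.
by move=> ij Vx; rewrite /in_lat/= -{1}Vx -mulmxA fan_leV.
Qed.

(** The functional cutting out a proper face vanishes on the span of the face
    and is positive at interior points of the cone. *)
Lemma proper_face_functional i j : lt i j -> exists u : 'rV[R]_n,
  [/\ forall x, c j x -> 0 <= dotrv u x,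
      forall x, c j x -> dotrv u x = 0 -> c i x,
      forall x, in_lat (V i) x -> dotrv u x = 0 & 0 < dotrv u (b j)].
Proof.
move=> ij; have [u [u0 uE]] := face_functional (below_le ij).
have ui x : c i x -> dotrv u x = 0.
  by move=> cx; apply/uE => //; apply: (fan_leP _ _ (below_le ij)).
exists u; split=> //; first by move=> x cx ux; apply/uE.
- exact: span_functional.
- rewrite lt_neqAle u0 ?andbT; last exact: center_in.
  apply/eqP => ub; move: (belowNle fan_le_anti ij) => /negP; apply.
  by apply: center_le; apply/uE => //; exact: center_in.
Qed.

(** If the ranks were equal, the center of the larger cone would lie in the span
    of the smaller one, where the functional cutting out the face vanishes. *)
Lemma fan_dlt i j : lt i j -> (ldim (V i) < ldim (V j))%N.
Proof.
move=> ij; have VV := fan_leV (below_le ij).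
have [U [dU WU _]] := lattice_complement VV.
rewrite -dU -[X in (X < _)%N]addn0 ltn_add2l lt0n; apply/negP => /eqP U0.
have [u [_ _ uV ub]] := proper_face_functional ij.
have Vj := V_sub (center_in j).
have : in_lat (V i) (b j).
  have := WU _ Vj; rewrite /in_lat/=.
  have -> : lproj R U = 0.
    rewrite /lproj map_mxM; apply/matrixP => k l; rewrite !mxE big1// => m _.
    by have := ltn_ord m; rewrite {2}U0.
  by rewrite mulmx0 mulmxBr mulmx1 => /esym/eqP; rewrite subr_eq0 => /eqP.
by move=> /uV ub0; move: ub; rewrite ub0 ltxx.
Qed.

Let rows i : (ldim (V i)).-tuple 'rV[R]_n :=
  [tuple row k (map_mx (intr : int -> R) (lbasis (V i))) | k < ldim (V i)].

Let rowsE i (k : 'I_(ldim (V i))) :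
  (rows i)`_k = row k (map_mx (intr : int -> R) (lbasis (V i))).
Proof. by rewrite (nth_map k) ?size_enum_ord// nth_ord_enum. Qed.

Lemma mem_span_rows i x : (x \in <<rows i>>%VS) <-> in_lat (V i) x.
Proof.
split=> [xr|<-].
  rewrite (coord_span xr) /in_lat/= mulmx_suml; apply: eq_bigr => k _.
  rewrite -scalemxAl; congr (_ *: _).
  by rewrite rowsE -row_mul lbasis_proj.
rewrite /lproj map_mxM mulmxA mulmx_sum_row; apply: memv_suml => k _.
apply: memvZ; apply: memv_span; apply/tnthP; exists k.
by rewrite tnth_mktuple.
Qed.

Lemma lin_spanE i : lin_span (c i) = <<rows i>>%VS.
Proof.
have rowsP : (forall x, c i x -> x \in <<rows i>>%VS) /\
    forall W : {vspace 'rV[R]_n}, (forall x, c i x -> x \in W) -> (<<rows i>> <= W)%VS.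
  split=> [x /V_sub/mem_span_rows//|W WE]; apply/subvP => x /mem_span_rows Vx.
  pose f : 'End('rV[R]_n) := (\1 - projv W)%VF.
  have fE y : f y = y - projv W y by rewrite add_lfunE opp_lfunE id_lfunE.
  have : x *m lin1_mx f = 0.
    apply: V_span Vx => y /WE yW; rewrite mul_rV_lin1 [LHS]fE.
    by rewrite projv_id// subrr.
  rewrite mul_rV_lin1 => fx0; have : f x = 0 by exact: fx0.
  rewrite fE => /eqP; rewrite subr_eq0 => /eqP ->.
  exact: memv_proj.
pose P := [set U : {vspace 'rV[R]_n} | (forall x, c i x -> x \in U) /\
  forall W : {vspace 'rV[R]_n}, (forall x, c i x -> x \in W) -> (U <= W)%VS].
have [h1 h2] : P (lin_span (c i)).
  by apply: xgetPex; exists <<rows i>>%VS.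
have [r1 r2] := rowsP.
by apply/eqP; rewrite eqEsubv h2//= r2.
Qed.

Lemma mem_lin_span i x : (x \in lin_span (c i)) <-> in_lat (V i) x.
Proof. by rewrite lin_spanE; exact: mem_span_rows. Qed.

Lemma dim_lin_span i : \dim (lin_span (c i)) = ldim (V i).
Proof.
rewrite lin_spanE; have fr : free (rows i).
  apply/freeP => k k0 j; have : (\row_l k l) *m map_mx (intr : int -> R) (lbasis (V i)) = 0.
    rewrite mulmx_sum_row -[RHS]k0; apply: eq_bigr => l _.
    by rewrite mxE rowsE.
  move=> /(congr1 (mulmx^~ (map_mx intr (lcoord (V i))))).
  rewrite mul0mx -mulmxA -map_mxM lbasisK map_mx1 mulmx1 => /rowP/(_ j).
  by rewrite !mxE.
by move: fr; rewrite /free => /eqP ->; rewrite size_tuple.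
Qed.

Definition centers : 'M[R]_(N, n) := \matrix_i center i.
Local Notation Bm := centers.

Definition between s t : pred 'I_N := [pred i | lt s i && lt i t].

Local Notation cc s t := (chain_cone (R := R) le (between s t)).

Lemma dotrv_centers u (a : 'rV[R]_N) :
  dotrv u (a *m Bm) = \sum_i a 0 i * dotrv u (b i).
Proof.
rewrite mulmx_sum_row dotrv_sumr; apply: eq_bigr => i _.
by rewrite dotrvZr rowK.
Qed.

Lemma center_below i j : le i j -> c j (b i).
Proof. by move=> /fan_leP; apply; exact: center_in. Qed.

Lemma in_latD i (x y : 'rV[R]_n) : in_lat (V i) x -> in_lat (V i) y -> in_lat (V i) (x + y).
Proof. by rewrite /in_lat/= mulmxDl => -> ->. Qed.

Lemma in_latZ i r (x : 'rV[R]_n) : in_lat (V i) x -> in_lat (V i) (r *: x).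
Proof. by rewrite /in_lat/= -scalemxAl => ->. Qed.

Lemma in_latN i (x : 'rV[R]_n) : in_lat (V i) x -> in_lat (V i) (- x).
Proof. by rewrite /in_lat/= mulNmx => ->. Qed.

(** Of the inequalities of c t that are equalities on the face s, the first to
    become one along the ray from v in the direction of - b t cuts out a smaller
    cone, in whose span the remainder is decomposed by induction. *)
Lemma center_decomp_exists s t v : lt s t -> in_lat (V t) v ->
  exists (r : R) a w, [/\ cc s t a, in_lat (V s) w, v = r *: b t + a *m Bm + w &
    forall w', in_lat (V s) w' -> c t (v + w') -> 0 <= r].
Proof.
have [k] := ubnP (ldim (V t)); elim: k t v => // k IH t v dk st Vv.
have [U cU] := cone_hull_halfspaces R (gens t); rewrite -gensE in cU.
have U0 u : u \in U -> forall x, c t x -> 0 <= dotrv u x.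
  by move=> uU x; rewrite cU => /(_ u uU).
have Ub0 u i : u \in U -> le i t -> 0 <= dotrv u (b i).
  by move=> uU it; apply: (U0 u uU); exact: center_below.
(* the inequalities that are equalities on s but strict at the center of t *)
pose L := [seq u <- U | (dotrv u (b s) == 0) && (0 < dotrv u (b t))].
have st' := below_le st.
have [fu [fu0 fus fuV fub]] := proper_face_functional st.
have L0 : L != [::].
  apply/negP => /eqP Lnil.
  have [e e0 eP] := seq_ubound U (fun u => dotrv u (b t) / dotrv u (b s)).
  have : c t ((e + 1) *: b s - b t).
    rewrite cU => u uU; rewrite dotrvDr dotrvNr dotrvZr.
    have := Ub0 _ _ uU st'; rewrite le_eqVlt => /orP[/eqP us0|us].
      rewrite -us0 mulr0 sub0r oppr_ge0 leNgt; apply/negP => ut.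
      have : u \in L by rewrite mem_filter -us0 eqxx ut uU.
      by rewrite Lnil.
    have := eP u uU; rewrite ler_pdivrMr// => h.
    by rewrite subr_ge0 (le_trans h)// ler_pM2r// lerDl.
  move=> /fu0; rewrite dotrvDr dotrvNr dotrvZr (fuV (b s)) ?mulr0 ?sub0r.
    by rewrite oppr_ge0 leNgt fub.
  exact: V_sub (center_in s).
have [u0 u0L u0min] := seq_argmin (fun u => dotrv u v / dotrv u (b t)) L0.
move: (u0L); rewrite mem_filter => /andP[/andP[/eqP u0s u0t] u0U].
pose r := dotrv u0 v / dotrv u0 (b t).
pose v' := v - r *: b t.
have u0v' : dotrv u0 v' = 0.
  rewrite /v' /r dotrvDr dotrvNr dotrvZr -mulrA mulVf ?mulr1 ?subrr//.
  by rewrite gt_eqF.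
have u0V x : in_lat (V s) x -> dotrv u0 x = 0.
  apply: span_functional => y cy; apply: (center_interior _ u0s cy) => z cz.
  by apply: (U0 _ u0U); exact: (fan_leP _ _ st').
have Vv' : in_lat (V t) v'.
  by apply: in_latD => //; apply: in_latN; apply: in_latZ; exact: V_sub (center_in t).
(* A large multiple of b s brings v' into the cone t, and then into the face
   rho cut out by u0. *)
have [l l0 lP] := seq_ubound U (fun u => - dotrv u v' / dotrv u (b s)).
have cv' : c t (v' + l *: b s).
  rewrite cU => u uU; rewrite dotrvDr dotrvZr.
  have [ut|ut] := eqVneq (dotrv u (b t)) 0.
    have uV : forall x, in_lat (V t) x -> dotrv u x = 0.
      by apply: span_functional => y cy; exact: (center_interior (U0 u uU) ut cy).
    rewrite !uV ?mulr0 ?addr0//; apply: in_lat_le st' _; exact: V_sub (center_in s).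
  have ut0 : 0 < dotrv u (b t) by rewrite lt0r ut Ub0//; exact: fan_le_refl.
  have := Ub0 _ _ uU st'; rewrite le_eqVlt => /orP[/eqP us0|us].
    rewrite -us0 mulr0 addr0 /v' dotrvDr dotrvNr dotrvZr subr_ge0 -ler_pdivlMr//.
    by apply: u0min; rewrite mem_filter -us0 eqxx ut0 uU.
  have := lP u uU; rewrite ler_pdivrMr// => h.
  by rewrite addrC -lerBlDr sub0r.
have [rho rhoE] := face_exists (U0 u0 u0U).
have crho : c rho (v' + l *: b s).
  apply/rhoE; split=> //; rewrite dotrvDr dotrvZr u0v' u0s mulr0 addr0//.
have srho : le s rho.
  apply/fan_leP => x cx; apply/rhoE; split; first exact: (fan_leP _ _ st').
  by apply: u0V; exact: V_sub.
have rhot : lt rho t.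
  apply: le_below; first by apply/fan_leP => x /rhoE[].
  by apply/eqP => rt; have := center_in t; rewrite -{1}rt => /rhoE[_ e];
    move: u0t; rewrite e ltxx.
have rge w' : in_lat (V s) w' -> c t (v + w') -> 0 <= r.
  move=> Vw' cvw; rewrite divr_ge0 ?(ltW u0t)//.
  by have := U0 _ u0U _ cvw; rewrite dotrvDr (u0V _ Vw') addr0.
have Vbs : in_lat (V s) (l *: b s) by apply: in_latZ; exact: V_sub (center_in s).
have [rs|rs] := eqVneq rho s.
  rewrite rs in crho; exists r, 0, v'; split=> //; first exact: chain_cone0.
    have -> : v' = (v' + l *: b s) - l *: b s by rewrite addrK.
    by apply: in_latD; [exact: V_sub|exact: in_latN].
  by rewrite mul0mx addr0 /v' addrC subrK.
have srho' : lt s rho by apply: le_below => //; rewrite eq_sym.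
have Vrv' : in_lat (V rho) v'.
  have -> : v' = (v' + l *: b s) - l *: b s by rewrite addrK.
  by apply: in_latD; [exact: V_sub|apply: in_latN; exact: in_lat_le srho _].
have drho : (ldim (V rho) < k)%N.
  by have := fan_dlt rhot => /leq_trans; apply; rewrite -ltnS.
have [r' [a [w [[a0 ab ac] Vw v'E r'0]]]] := IH rho v' drho srho' Vrv'.
have {}r'0 : 0 <= r' by apply: r'0 crho.
exists r, (a + r' *: delta_mx 0 rho), w; split=> //.
- have aE i : (a + r' *: delta_mx 0 rho) 0 i = a 0 i + r' * (i == rho)%:R.
    by rewrite !mxE eqxx.
  have supp i : a 0 i + r' * (i == rho)%:R != 0 -> le i rho /\ between s t i.
    have [->|ir] := eqVneq i rho; first by rewrite /between /= srho' rhot fan_le_refl.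
    rewrite mulr0 addr0 => /ab /andP[/= si ir']; split; first exact: below_le.
    apply/andP; split=> //=; apply: le_below.
      exact: fan_le_trans (below_le ir') (below_le rhot).
    apply/eqP => it; move: ir' (belowNle fan_le_anti rhot); rewrite it => /below_le.
    by move=> ->.
  split=> [i|i|i j]; rewrite !aE.
  + by rewrite addr_ge0// mulr_ge0.
  + by move=> /supp[].
  + have [->|ir] := eqVneq i rho; first by move=> _ /supp[-> _]; rewrite orbT.
    have [->|jr] := eqVneq j rho.
      by move=> ai _; have [|-> //] := supp i; rewrite (negbTE ir).
    by rewrite !mulr0 !addr0; exact: ac.
- rewrite mulmxDl -scalemxAl -rowE rowK.
  have -> : v = r *: b t + v' by rewrite /v' addrC subrK.
  by rewrite {1}v'E -!addrA; congr (_ + _); rewrite addrCA; congr (_ + _).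
Qed.

(** The largest cone in the support of a chain, or s for the empty chain. *)
Lemma chain_top s t (a : 'rV[R]_N) : lt s t -> cc s t a -> exists rho,
  [/\ le s rho, lt rho t, forall i, a 0 i != 0 -> le i rho &
      rho = s \/ a 0 rho != 0].
Proof.
move=> st [a0 ab ac]; have [[i0 ai0]|no] := pselect (exists i, a 0 i != 0); last first.
  exists s; split=> //; [exact: fan_le_refl| |by left].
  by move=> i ai; case: no; exists i.
case: (@arg_maxnP _ i0 (fun i => a 0 i != 0) (fun i => ldim (V i)) ai0) => rho ar rmax.
have /andP[/= sr rt] := ab _ ar.
exists rho; split=> //; [exact: below_le| |by right].
move=> i ai; have /orP[//|ri] := ac _ _ ai ar.
have [<-|ne] := eqVneq rho i; first exact: fan_le_refl.
have /fan_dlt : lt rho i by exact: le_below.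
by move=> /leq_trans/(_ (rmax i ai)); rewrite ltnn.
Qed.

(** Evaluating a functional that cuts out the top of the support of a shows
    that the other representation involves no center outside that top. *)
Lemma center_decomp_top s t (a a' : 'rV[R]_N) r w rho : lt s t ->
  cc s t a -> cc s t a' -> in_lat (V s) w -> 0 <= r ->
  a *m Bm = a' *m Bm + r *: b t + w ->
  le s rho -> lt rho t -> (forall i, a 0 i != 0 -> le i rho) ->
  r = 0 /\ forall i, a' 0 i != 0 -> le i rho.
Proof.
move=> st [a0 ab ac] [a'0 a'b a'c] Vw r0 e srho rhot top.
have [u [u0 uc uV ub]] := proper_face_functional rhot.
have uz i : le i rho -> dotrv u (b i) = 0.
  by move=> ir; apply: uV; apply: V_sub; exact: center_below.
have ge0 i : 0 <= a' 0 i * dotrv u (b i).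
  have [->|/a'b/andP[_ /= it]] := eqVneq (a' 0 i) 0; first by rewrite mul0r.
  by rewrite mulr_ge0// u0//; apply: center_below; exact: below_le.
have := congr1 (dotrv u) e; rewrite !dotrvDr dotrvZr !dotrv_centers.
rewrite (uV w) ?addr0; last exact: in_lat_le srho Vw.
rewrite big1; last first.
  move=> i _; have [->|/top/uz ->] := eqVneq (a 0 i) 0; first by rewrite mul0r.
  by rewrite mulr0.
move=> /esym/eqP; rewrite paddr_eq0 ?sumr_ge0//; last by rewrite mulr_ge0// ltW.
rewrite mulf_eq0 (gt_eqF ub) orbF => /andP[].
rewrite psumr_eq0// => /allP s0 /eqP r00; split=> // i ai.
have := s0 i (mem_index_enum i); rewrite mulf_eq0 (negbTE ai) /= => /eqP ui.
apply: center_le; apply: uc => //; apply: center_below.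
by have /andP[_ /= it] := a'b _ ai; exact: below_le.
Qed.

(** The two supports have the same top. If it is s, both sides vanish;
    otherwise the term of the top plays the part of b t in a smaller cone. *)
Lemma center_decomp_uniq s t (a a' : 'rV[R]_N) r w : lt s t ->
  cc s t a -> cc s t a' -> in_lat (V s) w ->
  a *m Bm = a' *m Bm + r *: b t + w -> a = a' /\ r = 0.
Proof.
have [k] := ubnP (ldim (V t)); elim: k t a a' r w => // k IH t a a' r w dk st.
wlog r0 : a a' r w / 0 <= r.
  move=> H ca ca' Vw e; have [r0|r0] := lerP 0 r; first exact: H ca ca' Vw e.
  have r0' : 0 <= - r by rewrite oppr_ge0 ltW.
  have e2 : a' *m Bm = a *m Bm + - r *: b t + - w.
    by rewrite e scaleNr addrAC !addrK.
  have [-> /eqP] := H a' a _ _ r0' ca' ca (in_latN Vw) e2.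
  by rewrite oppr_eq0 => /eqP.
move=> ca ca' Vw e.
have [rho [srho rhot top rtop]] := chain_top st ca.
have [r00 top'] := center_decomp_top st ca ca' Vw r0 e srho rhot top.
split=> //; rewrite r00 scale0r addr0 in e.
have e' : a' *m Bm = a *m Bm + 0 *: b t + - w.
  by rewrite e scale0r addr0 addrK.
have [rho' [srho' rhot' topp rtop']] := chain_top st ca'.
have [_ toppp] := center_decomp_top st ca' ca (in_latN Vw) (lexx 0) e' srho' rhot' topp.
have none (x : 'rV[R]_N) : cc s t x -> (forall i, x 0 i != 0 -> le i s) -> x = 0.
  move=> [_ xb _] xs; apply/rowP => i; rewrite mxE; apply: contrapT => /eqP xi.
  have /andP[/= si _] := xb _ xi.
  by have := belowNle fan_le_anti si; rewrite xs.
case: rtop => [rs|arho].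
  have -> : a = 0 by apply: none => // i ai; rewrite -rs; exact: top.
  by apply/esym; apply: none => // i ai; rewrite -rs; exact: top'.
case: rtop' => [rs|arho'].
  have -> : a = 0 by apply: none => // i ai; rewrite -rs; exact: toppp.
  by apply/esym; apply: none => // i ai; rewrite -rs; exact: topp.
have rr : rho' = rho.
  by apply: fan_le_anti; rewrite top'// toppp.
rewrite {}rr in arho' srho' rhot' topp toppp.
have [a0 ab ac] := ca; have [a'0 a'b a'c] := ca'.
have /andP[/= slr _] := ab _ arho.
pose del (x : 'rV[R]_N) := x - x 0 rho *: delta_mx 0 rho.
have delE x i : del x 0 i = if i == rho then 0 else x 0 i.
  rewrite !mxE eqxx /=; case: eqP => [->|_]; first by rewrite mulr1 subrr.
  by rewrite mulr0 subr0.
have cdel x : cc s t x -> (forall i, x 0 i != 0 -> le i rho) -> cc s rho (del x).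
  move=> [x0 xb xc] xr; split=> [i|i|i j]; rewrite !delE.
  - by case: eqP.
  - have [_|ir] := eqVneq i rho; first by rewrite eqxx.
    move=> xi; have /andP[/= si _] := xb _ xi; rewrite /between /= si /=.
    by apply: le_below => //; exact: xr.
  - have [_|_] := eqVneq i rho; first by rewrite eqxx.
    have [_ _|_] := eqVneq j rho; first by rewrite eqxx.
    exact: xc.
have delB x : del x *m Bm = x *m Bm - x 0 rho *: b rho.
  by rewrite mulmxBl -scalemxAl -rowE rowK.
have dr : (ldim (V rho) < k)%N.
  by have := fan_dlt rhot => /leq_trans; apply; rewrite -ltnS.
have [||||de re] := IH rho (del a) (del a') (a' 0 rho - a 0 rho) w dr slr => //.
- exact: cdel.
- exact: cdel.
- by rewrite !delB e scalerBl addrA subrK addrAC.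
move/eqP: re; rewrite subr_eq0 => /eqP re.
have dK x : x = del x + x 0 rho *: delta_mx 0 rho by rewrite subrK.
by rewrite (dK a) (dK a') de re.
Qed.

(** The cones on the centers of the chains strictly between s and t subdivide
    the space V t / (V s + R b t): this is the boundary of the cone t, seen
    modulo the face s and projected from the interior point b t, with its
    barycentric subdivision. *)
Lemma between_hom s t : lt s t -> exists f g,
  hom_on (cc s t) [set: 'rV[R]_((ldim (V t)).-1 - ldim (V s))] f g.
Proof.
move=> st; pose DV i : 'M[R]_(_, n) := map_mx intr (lbasis (V i)).
have DVP i (x : 'rV[R]_n) : (x <= DV i)%MS <-> in_lat (V i) x.
  split=> [/submxP[k ->]|<-]; first by rewrite /in_lat/= -mulmxA lbasis_proj.
  by rewrite /lproj map_mxM mulmxA submxMl.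
pose A := col_mx (DV s) (b t).
have Vbt : in_lat (V t) (b t) := V_sub (center_in t).
have AP (x : 'rV[R]_n) : (x <= A)%MS -> exists r w, in_lat (V s) w /\ x = r *: b t + w.
  move=> /submxP[k ->]; exists (rsubmx k 0 0), (lsubmx k *m DV s); split.
    by apply/DVP; exact: submxMl.
  by rewrite -{1}(hsubmxK k) mul_row_col addrC [rsubmx k in LHS]mx11_scalar mul_scalar_mx.
have AB : (A <= DV t)%MS.
  rewrite col_mx_sub; apply/andP; split; last exact/DVP.
  apply/row_subP => k; apply/DVP; apply: (in_lat_le (below_le st)); apply/DVP.
  exact: row_sub.
have rB : \rank (DV t) = ldim (V t) by apply/eqP; exact: row_free_basis.
have rA : \rank A = (ldim (V s)).+1.
  have [u [_ _ uV ub]] := proper_face_functional st.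
  suff /eqP -> : row_free A by rewrite addn1.
  rewrite -kermx_eq0; apply/rowV0P => k /sub_kermxP.
  rewrite -(hsubmxK k) mul_row_col [rsubmx k]mx11_scalar mul_scalar_mx => k0.
  have : dotrv u (lsubmx k *m DV s + rsubmx k 0 0 *: b t) = 0 by rewrite k0 dotrv0r.
  rewrite dotrvDr dotrvZr uV ?add0r; last by apply/DVP; exact: submxMl.
  move=> /eqP; rewrite mulf_eq0 (gt_eqF ub) orbF => /eqP r0.
  move: k0; rewrite r0 scale0r addr0.
  move=> /(congr1 (mulmx^~ (map_mx intr (lcoord (V s))))).
  rewrite mul0mx -mulmxA -map_mxM lbasisK map_mx1 mulmx1 => ->.
  by rewrite raddf0 row_mx0.
have eE : (\rank (DV t) - \rank A = (ldim (V t)).-1 - ldim (V s))%N.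
  by rewrite rA rB; lia.
have [] := quotient_coordinates AB; rewrite eE => P [H [HB HP AP0 PA]].
have bmP a : cc s t a -> in_lat (V t) (a *m Bm).
  move=> [_ ab _]; apply/DVP; rewrite mulmx_sum_row; apply: summx_sub => i _.
  have [->|/ab/andP[_ /= it]] := eqVneq (a 0 i) 0; first by rewrite scale0r sub0mx.
  apply: scalemx_sub; apply/DVP; rewrite rowK.
  exact: (in_lat_le (below_le it) (V_sub (center_in i))).
exists (fun a => a *m Bm *m P); apply: homogeneous_hom.
- exact: chain_cone_closed.
- exact: chain_cone0.
- by move=> r a r0; exact: chain_coneZ.
- apply: cont_on_setT; apply: cont_on_mulmx; apply: cont_on_mulmx; exact: cont_on_id.
- by move=> r a; rewrite -!scalemxAl.
- move=> a a' ca ca' e.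
  have : (a *m Bm - a' *m Bm <= A)%MS.
    apply: PA; last by rewrite mulmxBl e subrr.
    by apply/DVP; apply: in_latD; [exact: bmP|apply: in_latN; exact: bmP].
  move=> /AP[r [w [Vw e']]].
  have e2 : a *m Bm = a' *m Bm + r *: b t + w by rewrite -addrA -e' addrC subrK.
  by have [->] := center_decomp_uniq st ca ca' Vw e2.
- move=> k; have Vv : in_lat (V t) (k *m H) by apply/DVP; exact: mulmx_sub.
  have [r [a [w [ca Vw vE _]]]] := center_decomp_exists st Vv.
  exists a => //; have -> : a *m Bm = k *m H - (r *: b t + w).
    by apply/eqP; rewrite eq_sym subr_eq vE addrA [a *m Bm + _]addrC.
  rewrite mulmxBl -[k *m H *m P]mulmxA HP mulmx1.
  have -> : (r *: b t + w) *m P = 0; last by rewrite subr0.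
  have /submxP[l ->] : ((r *: b t + w)%R <= A)%MS.
    rewrite /A -addsmxE; apply: addmx_sub.
      by apply: scalemx_sub; exact: addsmxSr.
    by apply: submx_trans (addsmxSl _ _); exact/DVP.
  by rewrite -mulmxA AP0 mulmx0.
Qed.

(** Dividing by the coefficient of s turns the open dual cell of s into the
    cone over the order complex of what lies strictly between s and t. *)
Lemma face_open_below_hom s t : lt s t -> exists f g,
  hom_on (face_open (R := R) le (below le t) s)
    [set: 'rV[R]_((ldim (V t)).-1 - ldim (V s))] f g.
Proof.
move=> st; have [f [g fg]] := between_hom st.
pose e := vertex R s; have eE i : e 0 i = (i == s)%:R := vertexE R s i.
have we : wsum e = 1 := wsum_vertex R s.
pose p (y : 'rV[R]_N) := (y 0 s)^-1 *: (y - y 0 s *: e).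
pose q (a : 'rV[R]_N) := (1 + wsum a)^-1 *: (e + a).
have pE (y : 'rV[R]_N) i : y 0 s != 0 -> p y 0 i = if i == s then 0 else (y 0 s)^-1 * y 0 i.
  move=> ys; rewrite !mxE eqxx /=; case: eqP => [->|_].
    by rewrite mulr1 subrr mulr0.
  by rewrite mulr0 subr0.
suff pq : hom_on (face_open (R := R) le (below le t) s) (cc s t) p q.
  by exists (f \o p), (q \o g); exact: hom_on_comp pq fg.
have w0 a : cc s t a -> 0 < 1 + wsum a.
  by move=> ca; rewrite ltr_pwDl//; exact: wsum_ge0 ca.
have as0 a : cc s t a -> a 0 s = 0.
  move=> [_ ab _]; apply: contrapT => /eqP/ab; rewrite /between /= => /andP[].
  by rewrite ltii.
have ci (T : topologicalType) (D : set T) (h : T -> 'rV[R]_N) i :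
    cont_on D h -> cont_on D (fun x => h x 0 i) by exact: cont_on_coord.
split.
- apply: cont_onZ.
    by apply: cont_onV; [move=> y []|apply: ci; exact: cont_on_id].
  apply: cont_onB; first exact: cont_on_id.
  by apply: cont_onZ; [apply: ci; exact: cont_on_id|exact: cont_on_cst].
- apply: cont_onZ; last by apply: cont_onD; [exact: cont_on_cst|exact: cont_on_id].
  apply: cont_onV; first by move=> a ca; rewrite gt_eqF// w0.
  by apply: cont_onD; [exact: cont_on_cst|apply: cont_on_wsum; exact: cont_on_id].
- move=> y [[[y0 yb yc] y1] ys yle]; split.
    split=> [i|i|i j]; rewrite !pE//.
    + by case: eqP => // _; rewrite mulr_ge0// invr_ge0.
    + have [_|is_] := eqVneq i s; first by rewrite eqxx.
      rewrite mulf_eq0 negb_or => /andP[_ yi].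
      by apply/andP; split; [apply: le_below; [exact: yle|rewrite eq_sym]|exact: yb].
    + have [_|_] := eqVneq i s; first by rewrite eqxx.
      have [_ _|_] := eqVneq j s; first by rewrite eqxx.
      by rewrite !mulf_eq0 !negb_or => /andP[_ ?] /andP[_ ?]; exact: yc.
  have wp : 1 + wsum (p y) = (y 0 s)^-1.
    rewrite /p wsumZ wsumD -scaleNr wsumZ y1 we; field; exact: ys.
  by rewrite /q wp invrK scalerDr /p scalerA divff// scale1r addrC subrK.
- move=> a ca; have [a0 ab ac] := ca; have wa := w0 _ ca.
  have qE i : q a 0 i = (1 + wsum a)^-1 * ((i == s)%:R + a 0 i).
    by rewrite !mxE eqxx.
  have qs : q a 0 s = (1 + wsum a)^-1 by rewrite qE eqxx as0// addr0 mulr1.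
  have supp i : q a 0 i != 0 -> i = s \/ a 0 i != 0.
    rewrite qE mulf_eq0 negb_or => /andP[_].
    by have [->|_] := eqVneq i s; [left|rewrite /= add0r; right].
  split; last first.
    have qs0 : q a 0 s != 0 by rewrite qs invr_eq0 gt_eqF.
    apply/rowP => i; rewrite pE//; have [->|/negbTE is_] := eqVneq i s.
      by rewrite as0.
    by rewrite qs invrK qE is_ add0r mulrA divff ?mul1r// gt_eqF.
  split.
  - split; last by rewrite /q wsumZ wsumD we mulVf// gt_eqF.
    split=> [i|i /supp[->|/ab/andP[]]//|i j].
      by rewrite qE mulr_ge0 ?invr_ge0 ?(ltW wa)// addr_ge0.
    move=> /supp[->|ai] /supp[->|aj].
    + by rewrite fan_le_refl.
    + by have /andP[/= /below_le ->] := ab _ aj.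
    + by have /andP[/= /below_le ->] := ab _ ai; rewrite orbT.
    + exact: ac.
  - by rewrite qs invr_eq0 gt_eqF.
  - move=> i /supp[->|/ab/andP[/= /below_le//]]; exact: fan_le_refl.
Qed.

Lemma below_admissible t : (0 < ldim (V t))%N ->
  admissible R le V (below le t) (V t) (ldim (V t)).-1.
Proof.
move=> t0; split.
- move=> i j ij jt; apply: le_below.
    exact: fan_le_trans ij (below_le jt).
  apply/eqP => it; move: (belowNle fan_le_anti jt); rewrite -it.
  by rewrite ij.
- by move=> i /below_le; exact: fan_leV.
- by move=> i /fan_dlt dit; rewrite -ltnS (prednK t0).
- move=> i it; have [f [g fg]] := face_open_below_hom it.
  apply: (loc_euclidean_hom fg); apply: loc_euclidean_open; exact: openT.
Qed.

End FanGeometry.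

(** * Discs and spheres *)

(** The points t0 and u0 only serve as values outside the subsets. *)
Lemma homeomorphism_hom_on (T U : topologicalType) (t0 : T) (u0 : U) (A : set T)
    (B : set U) (f : A -> B) : homeomorphism f ->
  exists f' g', hom_on A B f' g' /\ forall x : A, f' (set_val x) = set_val (f x).
Proof.
move=> [g [cf cg fg gf]].
have ext (X Y : topologicalType) (C : set X) (D : set Y) (y0 : Y) (h : C -> D) :
    continuous h -> exists h' : X -> Y, cont_on C h' /\
      forall x : C, h' (set_val x) = set_val (h x).
  move=> ch; have /choice[h' h'E] : forall x : X, exists y : Y,
      forall z : C, set_val z = x -> y = set_val (h z).
    move=> x; have [[z zx]|no] := pselect (exists z : C, set_val z = x).
      exists (set_val (h z)) => z' z'x; congr (set_val (h _)); apply: set_val_inj.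
      by rewrite zx z'x.
    by exists y0 => z zx; case: no; exists z.
  exists h'; split; last by move=> x; exact: h'E.
  move=> x Cx O Ox; pose z : C := elt_of Cx.
  have hz : h' x = set_val (h z) by exact: h'E.
  have : nbhs z (fun w : C => O (set_val (h w))).
    rewrite hz in Ox.
    have := @set_val_continuous _ D (h z) O Ox; exact: ch.
  move=> [W [[W' oW' <-] /= W'z WO]].
  rewrite /= !nbhs_simpl /within /=.
  have : nbhs x W' by apply: open_nbhs_nbhs.
  apply: nbhsS => y W'y Cy /=; rewrite (h'E y (elt_of Cy))//.
  exact: (WO (elt_of Cy)).
have [f' [cf' f'E]] := ext _ _ _ _ u0 _ cf.
have [g' [cg' g'E]] := ext _ _ _ _ t0 _ cg.
exists f', g'; split=> //; split=> //.
- move=> x Ax; rewrite -[x](set_val_elt Ax) f'E g'E fg; split=> //.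
  exact: set_valP.
- move=> y By; rewrite -[y](set_val_elt By) g'E f'E gf; split=> //.
  exact: set_valP.
Qed.

Section SumOfSquares.
Variables (R : realType) (k : nat).
Implicit Types y : 'rV[R]_k.

Definition sqnorm y : R := \sum_i y 0 i ^+ 2.

Lemma sqnorm_ge0 y : 0 <= sqnorm y.
Proof. by apply: sumr_ge0 => i _; exact: sqr_ge0. Qed.

Lemma sqnormZ r y : sqnorm (r *: y) = r ^+ 2 * sqnorm y.
Proof. by rewrite mulr_sumr; apply: eq_bigr => i _; rewrite mxE exprMn. Qed.

Lemma sqnorm_eq0 y : sqnorm y = 0 -> y = 0.
Proof.
move=> /eqP; rewrite psumr_eq0; last by move=> i _; exact: sqr_ge0.
move=> /allP H; apply/rowP => i; rewrite mxE; apply/eqP.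
by have := H i (mem_index_enum i); rewrite sqrf_eq0.
Qed.

Lemma cont_on_sqnorm (T : topologicalType) (D : set T) (h : T -> 'rV[R]_k) :
  cont_on D h -> cont_on D (fun x => sqnorm (h x)).
Proof.
move=> ch; apply: cont_on_sum => i _; apply: (@cont_on_eq _ _ _ (fun x => h x 0 i * h x 0 i)).
  by move=> x _; rewrite expr2.
by apply: cont_onM; exact: cont_on_coord.
Qed.

Lemma sqnorm_closed : closed (unit_sphere R k) /\ closed (unit_disc R k).
Proof.
have cs : continuous sqnorm by apply: cont_on_setT; apply: cont_on_sqnorm; exact: cont_on_id.
split; [exact: (closed_preimage cs (@closed_eq R 1))|exact: (closed_preimage cs (@closed_le R 1))].
Qed.

Lemma unit_disc_bounded y : unit_disc R k y -> forall i, y 0 i \in `[(-1), 1].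
Proof.
move=> yd i; rewrite in_itv /= -ler_norml -(@expr_le1 _ 2)// real_normK ?num_real//.
apply: le_trans yd; rewrite (bigD1 i)//= lerDl.
by apply: sumr_ge0 => j _; exact: sqr_ge0.
Qed.

Lemma unit_disc_compact : compact (unit_disc R k).
Proof.
apply: (@subclosed_compact _ _ [set v : 'rV[R]_k | forall i, v 0 i \in `[(-1), 1]]).
- by case: sqnorm_closed.
- by apply: (@rV_compact R k (fun i => `[(-1), 1]%classic)) => i; exact: segment_compact.
- exact: unit_disc_bounded.
Qed.

Lemma unit_sphere_disc : unit_sphere R k `<=` unit_disc R k.
Proof. by move=> y yS; rewrite /unit_disc /= yS. Qed.

Lemma unit_sphere_compact : compact (unit_sphere R k).
Proof.
apply: subclosed_compact unit_disc_compact unit_sphere_disc.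
by case: sqnorm_closed.
Qed.

Lemma polar_neq0 y : unit_disc R k y ->
  y = 0 \/ exists r z, [/\ 0 < r, r <= 1, unit_sphere R k z & y = r *: z].
Proof.
move=> yd; have [y0|y0] := eqVneq y 0; [by left|right].
have yp : 0 < sqnorm y.
  by rewrite lt0r sqnorm_ge0 andbT; apply/eqP => /sqnorm_eq0/eqP; rewrite (negbTE y0).
pose r := Num.sqrt (sqnorm y); have r0 : 0 < r by rewrite sqrtr_gt0.
have r2 : r ^+ 2 = sqnorm y by rewrite sqr_sqrtr// ltW.
exists r, (r^-1 *: y); split => //.
- by rewrite -(@expr_le1 _ 2) ?r2// ltW.
- by rewrite /unit_sphere /= -/(sqnorm _) sqnormZ exprVn r2 mulVf// gt_eqF.
- by rewrite scalerA divff ?scale1r// gt_eqF.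
Qed.

Lemma polar y : (exists z, unit_sphere R k z) -> unit_disc R k y ->
  exists r z, [/\ 0 <= r, r <= 1, unit_sphere R k z & y = r *: z].
Proof.
move=> [z0 z0S] /polar_neq0[->|[r [z [/ltW ? ? ? ?]]]]; last by exists r, z.
by exists 0, z0; split=> //; rewrite scale0r.
Qed.

Lemma sphere_scale r z : unit_sphere R k z -> sqnorm (r *: z) = r ^+ 2.
Proof. by move=> zS; rewrite sqnormZ [sqnorm z]zS mulr1. Qed.

End SumOfSquares.

(** * Regular cell complexes as order complexes *)

Lemma cont_on_compact (T U : topologicalType) (K : set T) (f : T -> U) :
  cont_on K f -> compact K -> compact (f @` K).
Proof.
move=> cf; apply: continuous_compact; rewrite continuous_subspace_in => x /set_mem Kx O Ofx.
by have := cf x Kx O Ofx; rewrite /= nbhs_simpl (nbhs_subspace_in Kx).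
Qed.

(** The pasting lemma for finitely many closed sets. *)
Lemma glue_closed (I : finType) (B : pred I) (T U : topologicalType)
    (F : I -> set T) (h : T -> U) :
  (forall i, B i -> closed (F i)) -> (forall i, B i -> cont_on (F i) h) ->
  cont_on [set x | exists2 i, B i & F i x] h.
Proof.
move=> clF ch x _ O Ox.
have : \forall y \near x, forall i, B i -> F i y -> O (h y).
  apply: (@filter_forall _ _ (fun i => [set y | B i -> F i y -> O (h y)])) => i.
  have [Bi|nBi] := pselect (B i); last first.
    by apply: (nbhsS (P := setT)); [move=> y _ /nBi|exact: filterT].
  have [Fx|nFx] := pselect (F i x).
    by have := cont_on_near (ch i Bi) Fx Ox; apply: nbhsS => y H _; exact: H.
  have : nbhs x (~` F i) by apply: open_nbhs_nbhs; split=> //; exact/closed_openC/clF.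
  by apply: nbhsS => y nFy _ /nFy.
rewrite /= !nbhs_simpl /within /=; apply: nbhsS => y H [i Bi Fy]; exact: H Fy.
Qed.

Section CellComplexModel.
Variables (R : realType) (N : nat) (le : rel 'I_N) (rk : 'I_N -> nat).
Hypotheses (le_refl : reflexive le) (le_trans : transitive le).
Hypothesis le_anti : antisymmetric le.
Hypothesis lt_rk : forall i j, lt le i j -> (rk i < rk j)%N.
Variables (P : topologicalType) (p0 : P) (F : 'I_N -> set P).
Hypothesis hP : hausdorff_space P.

Local Notation lt := (lt le).
Local Notation simplex := (simplex (R := R) le).

Definition cell_bd i : set P := [set x | exists2 j, lt i j & F j x].

Hypothesis F_anti : forall i j, le i j -> F j `<=` F i.
Hypothesis F_cell : forall i, exists k (f : 'rV[R]_k -> P) g,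
  hom_on (unit_disc R k) (F i) f g /\
  forall y, unit_disc R k y -> (unit_sphere R k y <-> cell_bd i (f y)).
Hypothesis F_int : forall x, exists i, F i x /\ ~ cell_bd i x.
Hypothesis F_uniq : forall x i j,
  F i x -> ~ cell_bd i x -> F j x -> ~ cell_bd j x -> i = j.

Lemma interior_above i x : F i x -> exists l, [/\ le i l, F l x & ~ cell_bd l x].
Proof.
pose M := \max_j rk j.
have rkM j : (rk j <= M)%N by exact: leq_bigmax.
have [m] := ubnP (M - rk i); elim: m i => // m IH i mi Fx.
have [[j ij Fj]|nb] := pselect (cell_bd i x); last by exists i.
have [|l [jl Fl nl]] := IH j _ Fj.
  have := lt_rk ij; have := rkM j; move: mi; lia.
by exists l; split=> //; apply: le_trans jl; exact: below_le.
Qed.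

Lemma cell_closed i : closed (F i).
Proof.
have [k [f [g [[cf _ fg gf] _]]]] := F_cell i.
have -> : F i = f @` unit_disc R k.
  apply/seteqP; split=> [x Fx|_ [y yd <-]]; last by case: (fg _ yd).
  by have [? e] := gf _ Fx; exists (g x).
apply: compact_closed => //.
exact: cont_on_compact (@unit_disc_compact R k).
Qed.

Local Notation vertex := (@vertex R N).
Local Notation toward := (@toward R N).

Lemma chain_bottom (A : pred 'I_N) (a : 'rV[R]_N) : chain_cone le A a -> a != 0 ->
  exists j, a 0 j != 0 /\ forall i, a 0 i != 0 -> le j i.
Proof.
move=> [a0 aA ac] an0; have [i0 ai0] : exists i, a 0 i != 0.
  apply: contrapT => no; move/eqP: an0; apply; apply/rowP => i; rewrite mxE.
  by apply: contrapT => /eqP ai; apply: no; exists i.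
case: (@arg_minnP _ i0 (fun i => a 0 i != 0) rk ai0) => j aj jmin.
exists j; split=> // i ai; have /orP[//|ij] := ac _ _ aj ai.
have [->|ne] := eqVneq i j; first exact: le_refl.
have /lt_rk : lt i j by exact: le_below.
by move=> /leq_trans/(_ (jmin i ai)); rewrite ltnn.
Qed.

(** A map on the boundary of a cell extends over the cell by coning. *)
Lemma cone_cell i k (f : 'rV[R]_k -> P) g h0 :
  hom_on (unit_disc R k) (F i) f g ->
  (forall y, unit_disc R k y -> (unit_sphere R k y <-> cell_bd i (f y))) ->
  cont_on (cell_bd i) h0 ->
  exists h, [/\ cont_on (F i) h, h (f 0) = vertex i &
    forall r z, 0 <= r -> r <= 1 -> unit_sphere R k z ->
      h (f (r *: z)) = toward i r (h0 (f z))].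
Proof.
move=> [cf cg fg gf] sb ch0.
have [[z0 z0S]|noS] := pselect (exists z, unit_sphere R k z); last first.
  exists (fun=> vertex i); split=> //; first exact: cont_on_cst.
  by move=> r z _ _ zS; case: noS; exists z.
have disc r z : 0 <= r -> r <= 1 -> unit_sphere R k z -> unit_disc R k (r *: z).
  move=> r0 r1 zS; rewrite /unit_disc /= -/(sqnorm _) sphere_scale//.
  by rewrite expr_le1.
have finj y y' : unit_disc R k y -> unit_disc R k y' -> f y = f y' -> y = y'.
  by move=> /fg[_ {2}<-] /fg[_ {2}<-] ->.
have wd r z r' z' : 0 <= r -> r <= 1 -> unit_sphere R k z ->
    0 <= r' -> r' <= 1 -> unit_sphere R k z' -> f (r *: z) = f (r' *: z') ->
    toward i r (h0 (f z)) = toward i r' (h0 (f z')).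
  move=> r0 r1 zS r'0 r'1 z'S /finj e; have {}e := e (disc _ _ r0 r1 zS) (disc _ _ r'0 r'1 z'S).
  have rr : r = r'.
    have := congr1 (@sqnorm R k) e; rewrite !sphere_scale// => /eqP.
    by rewrite eqrXn2// => /eqP.
  rewrite -rr in e *; have [->|rn] := eqVneq r 0; first by rewrite !toward0.
  by rewrite (scalerI rn e).
have /choice[h hE] : forall x, exists v, forall r z, 0 <= r -> r <= 1 ->
    unit_sphere R k z -> f (r *: z) = x -> v = toward i r (h0 (f z)).
  move=> x; have [[[r z] /= [[r0 r1 zS] e]]|no] :=
      pselect (exists rz, [/\ 0 <= rz.1, rz.1 <= 1 & unit_sphere R k rz.2] /\
                          f (rz.1 *: rz.2) = x).
    exists (toward i r (h0 (f z))) => r' z' r'0 r'1 z'S e'.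
    by apply: wd => //; rewrite e e'.
  by exists 0 => r z r0 r1 zS e; case: no; exists (r, z).
exists h; split.
- pose K : set (R * 'rV[R]_k) := `[0, 1]%classic `*` unit_sphere R k.
  apply: (@compact_param_cont _ _ _ K
    (fun rz : R * 'rV[R]_k => f (rz.1 *: rz.2)) (F i) h
    (fun rz : R * 'rV[R]_k => toward i rz.1 (h0 (f rz.2)))) => //.
  + by apply: compact_setX; [exact: segment_compact|exact: unit_sphere_compact].
  + apply: (cont_on_comp (f := fun rz : R * 'rV[R]_k => rz.1 *: rz.2) (g := f)
      (B := unit_disc R k)) => //.
      apply: cont_onZ.
        exact: cont_on_proj1.
      exact: cont_on_proj2.
    move=> [r z] [/=]; rewrite in_itv /= => /andP[r0 r1] zS; exact: disc.
  + have c1 : cont_on (K `&` (fun rz => f (rz.1 *: rz.2)) @^-1` F i) (@fst R 'rV[R]_k).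
      exact: cont_on_proj1.
    apply: cont_on_toward => //.
    apply: (cont_on_comp (f := fun rz : R * 'rV[R]_k => f rz.2) (g := h0)
      (B := cell_bd i)) => //.
      apply: (cont_on_comp (f := @snd R 'rV[R]_k) (g := f)
        (B := unit_disc R k)) => //.
        exact: cont_on_proj2.
      by move=> [r z] [[_ /= zS] _]; exact: unit_sphere_disc.
    move=> [r z] [[_ /= zS] _]; apply/sb => //; exact: unit_sphere_disc.
  + move=> x Fx; have [gd e] := gf _ Fx.
    have [r [z [r0 r1 zS rz]]] := polar (ex_intro _ z0 z0S) gd.
    by exists (r, z); [split=> //=; rewrite in_itv /= r0|rewrite /= -rz].
  + move=> [r z] [/=]; rewrite in_itv /= => /andP[r0 r1] zS _.
    exact: hE.
- by rewrite (hE _ 0 z0)// ?scale0r// toward0.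
- by move=> r z r0 r1 zS; exact: hE.
Qed.

(** Every point other than the apex i lies on a segment from i to a point of
    the simplices above i. *)
Lemma simplex_rest i a : simplex (le i) a -> a 0 i != 1 ->
  exists j a', [/\ lt i j, simplex (le j) a' & a = toward i (1 - a 0 i) a'].
Proof.
move=> [[a0 ai ac] a1] ai1.
have ale1 : a 0 i <= 1.
  by rewrite -a1 /wsum (bigD1 i)//= lerDl sumr_ge0.
have r0 : 0 < 1 - a 0 i by rewrite subr_gt0 lt_neqAle ai1.
pose a' : 'rV[R]_N := (1 - a 0 i)^-1 *: (a - a 0 i *: vertex i).
have a'E j : a' 0 j = if j == i then 0 else (1 - a 0 i)^-1 * a 0 j.
  rewrite !mxE eqxx /=; case: eqP => [->|_]; first by rewrite mulr1 subrr mulr0.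
  by rewrite mulr0 subr0.
have supp j : a' 0 j != 0 -> a 0 j != 0 /\ lt i j.
  rewrite a'E; have [_|ji] := eqVneq j i; first by rewrite eqxx.
  rewrite mulf_eq0 negb_or => /andP[_ aj]; split=> //.
  by apply: le_below; [exact: ai|rewrite eq_sym].
have ca' : chain_cone le predT a'.
  split=> // [j|j l /supp[aj _] /supp[al _]]; last exact: ac.
  by rewrite a'E; case: ifP => // _; rewrite mulr_ge0// invr_ge0 ltW.
have wa' : wsum a' = 1.
  by rewrite wsumZ wsumD -scaleNr wsumZ wsum_vertex a1 mulr1 mulVf// gt_eqF.
have [j [aj jle]] := chain_bottom ca' (simplex_neq0 (conj ca' wa')).
exists j, a'; split; first by case: (supp _ aj).
  by split=> //; apply: chain_cone_sub ca' jle.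
rewrite /toward /a' scalerA divff ?gt_eqF// scale1r subKr.
by rewrite addrC subrK.
Qed.

(** The cells are matched one at a time, in order of increasing dimension. *)
Lemma partial_model (A : {set 'I_N}) : (forall i j, i \in A -> le i j -> j \in A) ->
  exists h : P -> 'rV[R]_N,
  [/\ forall i, i \in A -> cont_on (F i) h,
      forall i x, i \in A -> F i x -> simplex (le i) (h x),
      forall i a, i \in A -> simplex (le i) a -> exists2 x, F i x & h x = a &
      forall i j x y, i \in A -> j \in A -> F i x -> F j y -> h x = h y -> x = y].
Proof.
have [m] := ubnP #|A|; elim: m A => // m IH A Am Aup.
have [->|/finset.set0Pn[i0 Ai0]] := eqVneq A finset.set0.
  by exists (fun=> 0); split=> [i|i x|i a|i j x y]; rewrite finset.in_set0.
(* Minimal rank is largest dimension: the boundary of F i is already mapped. *)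
case: (@arg_minnP _ i0 (fun i => i \in A) rk Ai0) => i Ai imin.
have [|k l|h0 [h0c h0s h0S h0I]] := IH (A :\ i).
- by move: Am; rewrite (cardsD1 i) Ai.
- rewrite !inE => /andP[ki Ak] kl; rewrite (Aup _ _ Ak kl) andbT.
  apply/eqP => li; rewrite li in kl.
  have /lt_rk : lt k i by exact: le_below.
  by rewrite ltnNge imin.
have upi j : lt i j -> j \in A :\ i.
  move=> ij; rewrite !inE (Aup _ _ Ai (below_le ij)) andbT.
  by apply/eqP => ji; move: ij; rewrite ji ltii.
have noti j : j \in A :\ i -> ~~ le j i.
  rewrite !inE => /andP[ji Aj]; apply/negP => le_ji.
  have /lt_rk : lt j i by exact: le_below.
  by rewrite ltnNge imin.
have [k [f [g [fg sb]]]] := F_cell i.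
have [|hi [hic hi0 hiE]] := cone_cell (h0 := h0) fg sb.
  apply: glue_closed => j ij; [exact: cell_closed|exact: h0c (upi _ ij)].
have [cf cg fgx gfx] := fg.
have polarF x : F i x -> x = f 0 \/ exists r z,
    [/\ 0 < r, r <= 1, unit_sphere R k z & x = f (r *: z)].
  move=> Fx; have [gd e] := gfx _ Fx.
  have [g0|[r [z [r0 r1 zS gz]]]] := polar_neq0 gd; first by left; rewrite -e g0.
  by right; exists r, z; rewrite -gz e.
have bdz z : unit_sphere R k z -> exists2 j, lt i j & F j (f z).
  by move=> zS; apply/sb => //; exact: unit_sphere_disc.
have hi_bd x : cell_bd i x -> hi x = h0 x.
  move=> bx; have Fx : F i x by have [j ij] := bx; exact: F_anti (below_le ij) _.
  have [gd e] := gfx _ Fx.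
  have zS : unit_sphere R k (g x) by apply/sb => //; rewrite e.
  have := hiE 1 (g x) ler01 (lexx 1) zS; rewrite scale1r e => ->.
  exact: toward1.
have inter j x : j \in A :\ i -> F j x -> F i x -> cell_bd i x.
  move=> Aj Fj Fi; have [l [jl Fl nl]] := interior_above Fj.
  have [l' [il' Fl' nl']] := interior_above Fi.
  have ll := F_uniq Fl nl Fl' nl'; rewrite -{}ll in il'.
  exists l => //; apply: le_below => //; apply/eqP => il.
  by move: (noti _ Aj); rewrite il jl.
have /choice[h hP'] : forall x, exists v, (F i x -> v = hi x) /\ (~ F i x -> v = h0 x).
  by move=> x; have [Fx|nFx] := pselect (F i x); [exists (hi x)|exists (h0 x)].
have hhi x : F i x -> h x = hi x by case: (hP' x).
have hh0 j x : j \in A :\ i -> F j x -> h x = h0 x.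
  move=> Aj Fj; have [Fx|nFx] := pselect (F i x); last by case: (hP' x) => _; apply.
  by rewrite hhi// hi_bd//; exact: inter Fj Fx.
have inA' j : j \in A -> j != i -> j \in A :\ i by move=> Aj ji; rewrite !inE ji.
have hpol x : F i x -> (x = f 0 /\ h x = vertex i) \/ exists r z,
    [/\ 0 < r, r <= 1, unit_sphere R k z & x = f (r *: z) /\ h x = toward i r (h0 (f z))].
  move=> Fx; have [e|[r [z [r0 r1 zS e]]]] := polarF _ Fx.
    by left; rewrite hhi// e hi0.
  by right; exists r, z; split=> //; rewrite hhi// e hiE// ltW.
have h0z z : unit_sphere R k z -> h0 (f z) 0 i = 0.
  move=> zS; have [j ij Fj] := bdz _ zS.
  have [[_ hj _] _] := h0s _ _ (upi _ ij) Fj.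
  apply: contrapT => /eqP/hj ji; by move: (belowNle le_anti ij); rewrite ji.
exists h; split.
- move=> j Aj; have [->|/(inA' _ Aj) Aj'] := eqVneq j i.
    by apply: cont_on_eq hic => x Fx; rewrite hhi.
  by apply: cont_on_eq (h0c _ Aj') => x Fx; rewrite (hh0 j).
- move=> j x Aj; have [->|/(inA' _ Aj) Aj'] := eqVneq j i; last first.
    by move=> Fx; rewrite (hh0 j)//; exact: h0s.
  move=> Fx; have [[_ ->]|[r [z [r0 r1 zS [_ ->]]]]] := hpol _ Fx.
    by apply: vertex_simplex => //=.
  have [l il Fl] := bdz _ zS; have [ch wh] := h0s _ _ (upi _ il) Fl.
  have up a : h0 (f z) 0 a != 0 -> le i a.
    by move=> ha; apply: le_trans (below_le il) _; case: ch => _ + _; apply.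
  apply: toward_simplex => //=; last exact: ltW.
  by split=> //; exact: chain_cone_sub ch up.
- move=> j a Aj; have [->|/(inA' _ Aj) Aj'] := eqVneq j i; last first.
    by move=> /(h0S _ _ Aj')[x Fx e]; exists x => //; rewrite (hh0 j).
  move=> sa; have [a1|a1] := eqVneq (a 0 i) 1.
    have ae : a = vertex i.
      have [[a0 _ _] w1] := sa; apply/rowP => l; rewrite vertexE.
      have [->//|li] := eqVneq l i.
      move: w1; rewrite /wsum (bigD1 i)//= a1 => /eqP.
      rewrite -subr_eq0 addrAC subrr add0r psumr_eq0// => /allP/(_ l (mem_index_enum l)).
      by rewrite li => /eqP.
    have d0 : unit_disc R k 0 by rewrite /unit_disc /= big1// => l _; rewrite mxE expr0n.
    have [Ff _] := fgx _ d0.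
    by exists (f 0) => //; rewrite hhi// hi0.
  have [l [a' [il sa' ->]]] := simplex_rest sa a1.
  have [x Fx e] := h0S _ _ (upi _ il) sa'.
  have Fix_ : F i x by exact: F_anti (below_le il) _ Fx.
  have [gd ge] := gfx _ Fix_.
  have zS : unit_sphere R k (g x) by apply/sb => //; rewrite ge; exists l.
  have [[a0 _ _] w1] := sa.
  have ai1 : a 0 i <= 1 by rewrite -w1 /wsum (bigD1 i)//= lerDl sumr_ge0.
  have r0 : 0 <= 1 - a 0 i by rewrite subr_ge0.
  have r1 : 1 - a 0 i <= 1 by rewrite lerBlDr lerDl.
  have zd : unit_disc R k ((1 - a 0 i) *: g x).
    by rewrite /unit_disc /= -/(sqnorm _) sphere_scale// expr_le1.
  exists (f ((1 - a 0 i) *: g x)); first by case: (fgx _ zd).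
  by rewrite hhi ?hiE ?ge ?e//; case: (fgx _ zd).
- have main x y j : F i x -> j \in A :\ i -> F j y -> h x = h y -> x = y.
    move=> Fx Aj Fy; rewrite (hh0 j y)// => e.
    have hyi : h0 y 0 i = 0.
      have [[_ hj _] _] := h0s _ _ Aj Fy.
      by apply: contrapT => /eqP/hj ji; move: (noti _ Aj); rewrite ji.
    have [[_ ex]|[r [z [r0 r1 zS [xE ex]]]]] := hpol _ Fx.
      by move: hyi; rewrite -e ex vertexE eqxx => /eqP; rewrite oner_eq0.
    have r11 : r = 1.
      move: hyi; rewrite -e ex towardE eqxx mulr1 h0z// mulr0 addr0 => /eqP.
      by rewrite subr_eq0 => /eqP.
    have [l il Fl] := bdz _ zS.
    rewrite xE r11 scale1r; apply: (h0I l j) => //; first exact: upi.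
    by rewrite -e ex r11 toward1.
  move=> j l x y Aj Al Fx Fy e.
  have [ji|/(inA' _ Aj) Aj'] := eqVneq j i; have [li|/(inA' _ Al) Al'] := eqVneq l i.
  + rewrite {}ji in Fx; rewrite {}li in Fy.
    have [[xE ex]|[r [z [r0 r1 zS [xE ex]]]]] := hpol _ Fx;
      have [[yE ey]|[r' [z' [r'0 r'1 z'S [yE ey]]]]] := hpol _ Fy.
    * by rewrite xE yE.
    * have := congr1 (fun a : 'rV_N => a 0 i) e; rewrite ex ey towardE vertexE eqxx.
      by rewrite h0z// mulr0 addr0 mulr1 => e'; exfalso; move: e' => /=; lra.
    * have := congr1 (fun a : 'rV_N => a 0 i) e; rewrite ex ey towardE vertexE eqxx.
      by rewrite h0z// mulr0 addr0 mulr1 => e'; exfalso; move: e' => /=; lra.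
    * have rr : r = r'.
        have := congr1 (fun a : 'rV_N => a 0 i) e; rewrite ex ey !towardE eqxx.
        by rewrite !h0z// !mulr0 !addr0 !mulr1; lra.
      have [l1 il1 F1] := bdz _ zS; have [l2 il2 F2] := bdz _ z'S.
      have fz : f z = f z'.
        apply: (h0I l1 l2) => //; try exact: upi.
        move: e; rewrite ex ey rr => /addrI; apply: scalerI.
        by rewrite gt_eqF.
      have zz : z = z'.
        have [_ <-] := fgx _ (unit_sphere_disc zS).
        by have [_ <-] := fgx _ (unit_sphere_disc z'S); rewrite fz.
      by rewrite xE yE rr zz.
  + by rewrite {}ji in Fx; exact: main Fx Al' Fy e.
  + by rewrite {}li in Fy; apply/esym; exact: main Fy Aj' Fx (esym e).
  + by apply: (h0I j l) => //; move: e; rewrite (hh0 j)// (hh0 l).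
Qed.

(** A regular cell complex is the order complex of its face poset, since every
    cell is the cone over its boundary sphere. *)
Theorem cell_complex_model : exists h : P -> 'rV[R]_N,
  [/\ continuous h, injective h, range h = simplex predT &
      forall i x, F i x <-> forall j, h x 0 j != 0 -> le i j].
Proof.
have [|h [hc hs hS hI]] := @partial_model (finset.setTfor 'I_N); first by move=> *; rewrite finset.in_setT.
have cover x : exists i, F i x by have [i []] := F_int x; exists i.
have below_pred i a : simplex (le i) a -> simplex predT a.
  by move=> [ca a1]; split=> //; apply: chain_cone_sub ca _.
exists h; split.
- apply: cont_on_setT.
  have -> : [set: P] = [set x | exists2 i, predT i & F i x].
    by apply/seteqP; split=> // x _; have [i] := cover x; exists i.
  by apply: glue_closed => i _; [exact: cell_closed|apply: hc; rewrite finset.in_setT].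
- move=> x y e; have [i Fx] := cover x; have [j Fy] := cover y.
  by apply: (hI i j) => //; rewrite finset.in_setT.
- apply/seteqP; split=> [_ [x _ <-]|a sa].
    by have [i Fx] := cover x; apply: (below_pred i); apply: hs => //; rewrite finset.in_setT.
  have [ca _] := sa; have [j [_ jle]] := chain_bottom ca (simplex_neq0 sa).
  have [|//|x Fx <-] := hS j a; first by rewrite finset.in_setT.
    by case: sa => _ w1; split=> //; apply: chain_cone_sub ca jle.
  by exists x.
- move=> i x; split=> [Fx|hx].
    by have [|[_ h2 _] _] := hs i x _ Fx; rewrite ?finset.in_setT.
  have [j Fj] := cover x; have [|ca w1] := hs j x _ Fj; first by rewrite finset.in_setT.
  have [||y Fy e] := hS i (h x); first by rewrite finset.in_setT.
    by split=> //; apply: chain_cone_sub ca hx.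
  by rewrite (hI j i x y)// inE.
Qed.

End CellComplexModel.

(** * Strata, link bundle and density *)

Lemma connected_star (R : realType) (T : topologicalType) (S : set T) (p : T) :
  S p ->
  (forall x, S x -> exists h : R -> T, [/\ cont_on (`[0, 1]%classic : set R) h, h 0 = p, h 1 = x &
     forall r, 0 <= r -> r <= 1 -> S (h r)]) ->
  connected S.
Proof.
move=> Sp HS.
have -> : S = \bigcup_(C in [set C : set T | [/\ C p, C `<=` S & connected C]]) C.
  apply/seteqP; split=> [x Sx|x [C [_ CS _] Cx]]; last exact: CS.
  have [h [ch h0 h1 hS]] := HS x Sx.
  exists (h @` (`[0, 1]%classic : set R)); last first.
    by exists 1 => //=; rewrite in_itv /= ler01 lexx.
  split.
  - by exists 0 => //=; rewrite in_itv /= ler01 lexx.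
  - by move=> y [r /=]; rewrite in_itv /= => /andP[r0 r1] <-; exact: hS.
  - apply: connected_continuous_connected; first exact: segment_connected.
    rewrite continuous_subspace_in => r /set_mem rI O Or.
    by have := ch r rI O Or; rewrite /= nbhs_simpl (nbhs_subspace_in rI).
apply: (@bigcup_connected T (set T) id
  [set C : set T | [/\ C p, C `<=` S & connected C]]).
  by exists p => C; case.
by move=> C; case.
Qed.

Section Bundle.
Variables (R : realType) (n N : nat) (le : rel 'I_N).
Variable V : 'I_N -> split_lattice n.
Hypotheses (le_refl : reflexive le) (le_trans : transitive le).
Hypothesis le_anti : antisymmetric le.
Hypothesis leV : forall i j, le i j -> lproj R (V i) *m lproj R (V j) = lproj R (V i).

Local Notation E := (model_space R n N).
Local Notation Q i := (lproj R (V i)).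
Local Notation Phi := (Phi (R := R) V).
Local Notation stratum := (stratum (R := R) le V).
Local Notation star := (star (R := R) le V).
Local Notation face_open := (face_open (R := R) le).
Local Notation simplex := (simplex (R := R) le).
Local Notation stratum_space := (stratum_space (R := R) le V).
Local Notation below := (below le).
Local Notation d i := (ldim (V i)).

Hypothesis dlt : forall i j, lt le i j -> (d i < d j)%N.
Hypothesis adm_below : forall s, (0 < d s)%N ->
  admissible R le V (below s) (V s) (d s).-1.

Variables (A : pred 'I_N) (W : split_lattice n) (M : nat).
Hypothesis adm : admissible R le V A W M.
Variables (T : topologicalType) (iota : T -> E).
Hypotheses (cT : compact [set: T]) (iotac : continuous iota)
  (iotaI : injective iota) (iotaE : range iota = stratum_space A W).

Local Notation J := (stratum_dim V W M).
Local Notation m := (M + ldim W)%N.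
Let X k : set T := iota @^-1` model_filtration (R := R) V W M k.

Let dM i : A i -> (d i <= M)%N. Proof. exact: (adm_dim adm). Qed.
Let dW i : A i -> (d i <= ldim W)%N.
Proof. by move=> Ai; apply: (@dim_le R); exact: (adm_proj adm). Qed.

Lemma face_open_star s y r : A s -> face_open A s y -> 0 <= r -> r <= 1 ->
  face_open A s (toward s r y).
Proof.
move=> As [sy ys yle] r0 r1; split; first exact: toward_simplex.
- have [[y0 _ _] _] := sy; rewrite towardE eqxx mulr1.
  have [->|rn0] := eqVneq r 0; first by rewrite subr0 mul0r addr0 oner_neq0.
  by rewrite gt_eqF// ltr_wpDl ?subr_ge0// mulr_gt0// lt0r ?rn0 ?ys// y0.
- by move=> i /toward_support[->|/yle].
Qed.

Lemma vertex_face_open s : A s -> face_open A s (vertex R s).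
Proof.
move=> As; split; first exact: vertex_simplex.
  by rewrite vertexE eqxx oner_neq0.
by move=> i; rewrite vertexE; have [->|_] := eqVneq i s; rewrite //= eqxx.
Qed.

Lemma stratum_sub s : stratum A W s `<=` stratum_space A W.
Proof. by move=> x [y [t [[sy _ _] Wt ->]]]; exists y, t. Qed.

(** Strata are star-shaped about the vertex, in both coordinates. *)
Lemma stratum_connected s : A s -> connected (iota @^-1` stratum A W s).
Proof.
move=> As; have vs := vertex_face_open As.
have W0 : in_lat (R := R) W 0 by rewrite /in_lat/= mul0mx.
have Sv : stratum A W s (Phi (vertex R s) 0) by exists (vertex R s), 0.
have [p _ pE] : range iota (Phi (vertex R s) 0) by rewrite iotaE; exact: (stratum_sub Sv).
have [g [_ cg ig gi]] := embedding_inverse cT iotac iotaI iotaE (ex_intro _ p I).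
apply: (@connected_star R _ _ p); first by rewrite /preimage /= pE.
move=> x [y [t [fy Wt xE]]].
have inS r : 0 <= r -> r <= 1 ->
    stratum A W s (Phi (toward s r y) (r *: t)).
  move=> r0 r1; exists (toward s r y), (r *: t); split=> //.
    exact: face_open_star.
  by rewrite /in_lat/= -scalemxAl Wt.
exists (fun r => g (Phi (toward s r y) (r *: t))); split.
- apply: (@cont_on_comp _ _ _ (`[0, 1]%classic : set R) (stratum_space A W)
    (fun r : R => Phi (toward s r y) (r *: t)) g) => //.
    have ci : cont_on (`[0, 1]%classic : set R) id by exact: cont_on_id.
    apply: cont_on_Phi; last by apply: cont_onZ => //; exact: cont_on_cst.
    by apply: cont_on_toward => //; exact: cont_on_cst.
  move=> r /=; rewrite in_itv /= => /andP[r0 r1]; apply: (@stratum_sub s); exact: inS.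
- by rewrite toward0 scale0r -pE; case: (ig p I).
- by rewrite toward1 scale1r -xE; case: (ig x I).
- move=> r r0 r1; rewrite /preimage /=.
  have Sr := inS r r0 r1.
  by have [_ ->] := gi _ (stratum_sub Sr).
Qed.

Lemma stratum_diff s : A s -> iota @^-1` stratum A W s `<=` filt_diff X (J s).
Proof.
move=> As x [y [t [fy Wt xE]]]; have [[[y0 yA yc] y1] ys yle] := fy; split.
  move=> i ci; rewrite xE /=; apply: contrapT => /eqP yi.
  have si := yle _ yi; have [si'|si'] := eqVneq s i.
    by move: ci; rewrite si' ltnn.
  have := dlt (le_below si si'); move: ci; rewrite /stratum_dim; lia.
case e : (J s) => [|c] //= Xc.
by have := Xc s; rewrite xE /= e => /(_ (ltnSn c)) ysz; rewrite ysz eqxx in ys.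
Qed.

Lemma diff_stratum s x : A s -> filt_diff X (J s) x -> (iota x).1 0 s != 0 ->
  stratum A W s (iota x).
Proof.
move=> As [Xx _]; have : stratum_space A W (iota x) by rewrite -iotaE; exists x.
move=> [a [t [sa Wt xE]]]; rewrite xE /= => as0; exists a, t; split=> //; split=> //.
move=> i ai; have [[a0 aA ac] _] := sa.
have /orP[//|is_] := ac _ _ as0 ai.
have [->|ne] := eqVneq i s; first exact: le_refl.
have di := dlt (le_below is_ ne).
have := Xx i; rewrite xE /= => Xi; move: ai; rewrite Xi ?eqxx//.
by have := dM As; have := dW As; rewrite /stratum_dim; lia.
Qed.

Lemma same_level a i j : simplex A a -> a 0 i != 0 -> a 0 j != 0 ->
  J i = J j -> i = j.
Proof.
move=> [[_ aA ac] _] ai aj cij.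
have := dM (aA _ ai); have := dW (aA _ ai); have := dM (aA _ aj); have := dW (aA _ aj).
move=> h1 h2 h3 h4; have dij : d i = d j by move: cij; rewrite /stratum_dim; lia.
have [//|ne] := eqVneq i j.
have /orP[ij|ji] := ac _ _ ai aj.
  by have := dlt (le_below ij ne); rewrite dij ltnn.
by rewrite eq_sym in ne; have := dlt (le_below ji ne); rewrite dij ltnn.
Qed.

(** In a layer X_j minus X_(j-1) the strata are separated by the coordinates of
    the vertices of that level, exactly one of which is nonzero. *)
Lemma is_stratum_model j S : is_stratum X j S ->
  exists2 s, A s & J s = j /\ S = iota @^-1` stratum A W s.
Proof.
move=> [x fx ->]; have [s [As [_ /= xs] sj]] := filtration_vertex iotaE fx.
exists s => //; split=> //; rewrite -sj in fx *.
have Sx := diff_stratum As fx xs.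
apply/seteqP; split; last first.
  by apply: connected_component_max => //; [exact: stratum_diff|exact: stratum_connected].
set C := connected_component _ _.
have CA : C `<=` filt_diff X (J s) by exact: connected_component_sub.
have Cx : C x by exact: connected_component_refl.
have cc i : continuous (fun y : T => (iota y).1 0 i).
  apply: cont_on_setT; apply: cont_on_coord; apply: cont_on_fst.
  exact: continuous_cont_on.
(* The component lies in the open and closed part of the layer where the
   coefficient of s is nonzero. *)
pose B := C `&` [set y | (iota y).1 0 s != 0].
have BC : B = C.
  apply: (component_connected (A := filt_diff X (J s)) (x := x)).
  - by exists x.
  - exists [set y | (iota y).1 0 s != 0] => //.
    by apply: (open_comp (f := fun y : T => (iota y).1 0 s) (D := [set r | r != 0]));
      [move=> y _; exact: cc|exact: open_neq].
  - exists (\bigcap_(i in [set i | J i = J s /\ i <> s])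
      ((fun y : T => (iota y).1 0 i) @^-1` [set 0])).
      apply: closed_bigI => i _; apply: closed_preimage; first exact: cc.
      exact: closed_eq.
    apply/seteqP; split=> y [Cy ys]; split=> //.
      move=> i [ci nis] /=; apply: contrapT => /eqP yi; apply: nis.
      have : stratum_space A W (iota y) by rewrite -iotaE; exists y.
      move=> [a [t [sa _ ye]]]; rewrite ye /= in yi.
      have as0 : a 0 s != 0 by move: ys; rewrite /= ye.
      exact: (same_level sa yi as0 ci).
    have [s' [As' [_ /= ys'] cs']] := filtration_vertex iotaE (CA _ Cy).
    have [<-//|/eqP ne] := eqVneq s' s.
    by have := ys s' (conj cs' ne); rewrite /= => y0; rewrite y0 eqxx in ys'.
move=> y Cy; apply: diff_stratum => //; first exact: CA.
by move: Cy; rewrite -BC => -[].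
Qed.

(** The homeomorphism of chart_hom is defined over the whole stratum and not
    merely near a point, and it is the identity on the stratum. *)
Lemma model_trivial_link_bundle : trivial_link_bundle R m X.
Proof.
move=> j S jm /is_stratum_model[s As [<- ->]].
have [F [G [FG FE]]] := chart_hom le_refl le_trans le_anti leV s
  (adm_lower adm) (adm_proj adm).
have sL : (0 < d s)%N -> stratified R ((d s).-1 + d s)
    (fun i => set_val @^-1` model_filtration (R := R) V (V s) (d s).-1 i :
              set (stratum_space (below s) (V s))).
  move=> d0; apply: (model_stratified le_refl le_trans le_anti leV dlt adm_below
     (adm_below d0) (iota := set_val)) => //.
  - lia.
  - exact/compact_set_type/stratum_space_compact.
  - exact: set_val_continuous.
  - apply/seteqP; split=> [_ [l _ <-]|l Ll]; first exact: set_valP.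
    by exists (elt_of Ll).
have strat_star y : stratum A W s y -> star A W s y.
  by move=> Sy; split; [exact: stratum_sub Sy|case: Sy => a [t [[_ ? _] _ ->]]].
have FS y : stratum A W s y -> F y = (y, 0).
  move=> [a [t [fa Wt ->]]]; have [sa as0 ale] := fa.
  have low0 : lower le s a = 0.
    apply/rowP => i; rewrite !mxE; case: ifP => // is_; apply: contrapT => /eqP/ale si.
    by move: (belowNle le_anti is_); rewrite si.
  rewrite FE// low0 Phi0 /upper low0 subr0 -(scale0r (0 : 'rV_N)) wsumZ mul0r.
  by rewrite subr0 invr1 scale1r.
pose S' := iota @^-1` stratum A W s.
pose b (x : S') : E := iota (set_val x).
have T0 : [set: T] !=set0.
  have : range iota (Phi (vertex R s) 0).
    rewrite iotaE; apply: (@stratum_sub s); exists (vertex R s), 0; split=> //.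
      exact: vertex_face_open.
    by rewrite /in_lat/= mul0mx.
  by move=> [x _ _]; exists x.
have [g [_ cg ig gi]] := embedding_inverse cT iotac iotaI iotaE T0.
have bc : continuous b.
  move=> x; apply: (@continuous_comp _ _ _ set_val iota).
    exact: set_val_continuous.
  exact: iotac.
have bI : injective b by move=> x y /iotaI /set_val_inj.
have bS u : stratum A W s u <-> exists x, b x = u.
  split=> [Su|[x <-]]; last exact: (set_valP x).
  have [x _ xu] : range iota u by rewrite iotaE; exact: stratum_sub Su.
  have S'x : S' x by rewrite /S' /preimage /= xu.
  by exists (elt_of S'x); rewrite /b set_val_elt.
have bini (Z : topologicalType) (h : Z -> S') : continuous (b \o h) -> continuous h.
  move=> ch; apply: set_type_initial; apply: cont_on_setT.
  apply: (@cont_on_eq _ _ _ (g \o (b \o h))).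
    by move=> z _ /=; case: (ig (set_val (h z)) I).
  apply: (@cont_on_comp _ _ _ setT (stratum_space A W) (b \o h) g) => //.
    exact: (continuous_cont_on (A := setT) ch).
  by move=> z _; apply: (@stratum_sub s); apply/bS; exists (h z).
have idh : hom_on (stratum A W s) (stratum A W s) id id.
  by split=> //; exact: cont_on_id.
have [f [fch fE]] := model_chart dlt adm cT iotac iotaI iotaE As FG FE T0
  (@subset_refl _ _) idh bc bI bS bini.
have [_ _ F1 _] := FG.
exists (set_type (stratum_space (below s) (V s))),
  (fun i => set_val @^-1` model_filtration (R := R) V (V s) (d s).-1 i),
  [set x | star A W s (iota x) /\ stratum A W s (F (iota x)).1], f; split.
- move=> x Sx; apply: (vertex_link leV dlt adm cT iotac iotaI iotaE As FG FE sL).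
    exact: strat_star.
  by case: (stratum_diff As Sx).
- rewrite openE => x [sx _]; have := star_near iotac iotaE sx.
  by apply: nbhsS => y sy; split=> //; case: (F1 _ sy) => -[].
- by move=> x Sx; split; [exact: strat_star|rewrite FS].
- exact: fch.
- move=> y x yx; have Sx : stratum A W s (iota (set_val y)).
    by rewrite yx; exact: (set_valP x).
  have [e1 e2] := fE y; rewrite FS// in e1 e2.
  rewrite [f y]surjective_pairing; congr pair.
    by apply: bI; rewrite e1 /b yx.
  apply: (cone_emb_inj (@massZ R n N) (@mass_stratum_space R n N le V _ _)).
  by rewrite e2 cone_emb_apex.
Qed.

Variable i0 : 'I_N.
Hypotheses (Ai0 : A i0) (i0_le : forall i, A i -> le i0 i) (d0 : d i0 = 0%N).

Lemma embedded_point_repr x : exists a t,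
  [/\ simplex A a, in_lat W t & iota x = Phi a t].
Proof. by have : stratum_space A W (iota x) by rewrite -iotaE; exists x. Qed.

(** In dimension 0 the poset has i0 as its only element of A, and the space is
    a point. *)
Lemma model_stratified_all : stratified R m X.
Proof.
have [m0|m0] := posnP m; last first.
  exact: (model_stratified le_refl le_trans le_anti leV dlt adm_below adm).
have all0 i : A i -> i = i0.
  move=> Ai; apply: contrapT => /eqP ne; rewrite eq_sym in ne.
  by have := dlt (le_below (i0_le Ai) ne); have := dM Ai; lia.
have uniq (x y : T) : x = y.
  have [a [t [[[a0 aA _] a1] Wt ex]]] := embedded_point_repr x.
  have [b [u [[[b0 bA _] b1] Wu ey]]] := embedded_point_repr y.
  have vert (c : 'rV[R]_N) : (forall i, c 0 i != 0 -> A i) -> wsum c = 1 ->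
      c = vertex R i0.
    move=> cA c1; have c0 i : i != i0 -> c 0 i = 0.
      by move=> ne; apply: contrapT => /eqP/cA/all0 e; rewrite e eqxx in ne.
    apply/rowP => i; rewrite vertexE; have [->|ne] := eqVneq i i0; last exact: c0.
    by move: c1; rewrite /wsum (bigD1 i0)//= big1 ?addr0// => j; exact: c0.
  have W0 (v : 'rV[R]_n) : in_lat W v -> v = 0.
    move=> <-; suff -> : lproj R W = 0 by rewrite mulmx0.
    rewrite /lproj map_mxM; apply/matrixP => k l; rewrite !mxE big1// => i _.
    have W00 : ldim W = 0%N by lia.
    by have := ltn_ord i; rewrite {2}W00.
  apply: iotaI; rewrite ex ey (vert a)// (vert b)// (W0 t)// (W0 u)//.
rewrite m0; apply: stratified_discrete => //.
- have [x _ _] : range iota (Phi (vertex R i0) 0).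
    rewrite iotaE; apply: (@stratum_sub i0); exists (vertex R i0), 0; split=> //.
      exact: vertex_face_open.
    by rewrite /in_lat/= mul0mx.
  have -> : [set: T] = [set x] by apply/seteqP; split=> // y _; exact: uniq.
  exact: countable1.
- move=> B; have [[x Bx]|no] := pselect (exists x, B x).
    have -> : B = setT by apply/seteqP; split=> // y _; rewrite (uniq y x).
    exact: openT.
  have -> : B = set0 by apply/seteqP; split=> // y By; case: no; exists y.
  exact: open0.
- by apply/seteqP; split=> // x _ i; rewrite /stratum_dim m0.
Qed.

(** Points that move a little toward the vertex i0 enter its stratum, which is
    the open one. *)
Lemma model_dense : dense (~` filt_pred X m).
Proof.
have : forall x, (iota x).1 0 i0 != 0 -> (~` filt_pred X m) x.
  case e : m => [|k] x x0 //= Xx; have := Xx i0; rewrite /stratum_dim e d0 muln0 subn0.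
  by move=> /(_ (ltnSn k)) z; rewrite z eqxx in x0.
move=> big O [x Ox] oO.
have [a [t [sa Wt ex]]] := embedded_point_repr x.
have [[a0 aA ac] a1] := sa.
(* a for r = 0, and a point with positive coefficient at i0 for r > 0 *)
pose rev r : 'rV[R]_N := toward i0 (1 - r) a.
have csimp r : 0 <= r -> r <= 1 -> simplex A (rev r).
  move=> r0 r1; apply: toward_simplex => //; last by lra.
  - by move=> j /aA/i0_le.
  - by rewrite subr_ge0.
have [g [_ cg ig gi]] := embedding_inverse cT iotac iotaI iotaE (ex_intro _ x I).
have inSS r : 0 <= r -> r <= 1 -> stratum_space A W (Phi (rev r) t).
  by move=> r0 r1; exists (rev r), t; split=> //; exact: csimp.
have cgam : cont_on (`[0, 1]%classic : set R) (fun r => g (Phi (rev r) t)).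
  apply: (@cont_on_comp _ _ _ (`[0, 1]%classic : set R) (stratum_space A W)
    (fun r : R => Phi (rev r) t) g) => //.
    have ci : cont_on (`[0, 1]%classic : set R) id by exact: cont_on_id.
    apply: cont_on_Phi; last exact: cont_on_cst.
    by apply: cont_on_toward; [apply: cont_onB => //; exact: cont_on_cst|exact: cont_on_cst].
  by move=> r /=; rewrite in_itv /= => /andP[r0 r1]; exact: inSS.
have g0 : g (Phi (rev 0) t) = x.
  by rewrite /rev subr0 toward1 -ex; case: (ig x I).
have I0 : (`[0, 1]%classic : set R) 0 by rewrite /= in_itv /= lexx ler01.
have nO : nbhs (g (Phi (rev 0) t)) O by rewrite g0; exact: open_nbhs_nbhs.
have /nbhs_ballP[e /= e0 He] := cont_on_near cgam I0 nO.
pose r := Num.min (e / 2) 1.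
have r0 : 0 < r by rewrite lt_min ltr01 divr_gt0.
have r1 : r <= 1 by rewrite ge_min lexx orbT.
have re : r < e by rewrite gt_min; apply/orP; left; lra.
exists (g (Phi (rev r) t)); split.
  apply: He; last by rewrite in_itv /= ltW.
  by rewrite -ball_normE /ball_/= sub0r normrN gtr0_norm.
apply: big; have [_ ->] := gi _ (inSS r (ltW r0) r1).
rewrite /= towardE eqxx mulr1 subKr gt_eqF// ltr_wpDr// mulr_ge0// subr_ge0//.
Qed.

Lemma model_pseudomanifold : pseudomanifold R m X.
Proof.
split.
- exact: compact_paracompact.
- exact: (embedded_hausdorff iotac iotaI).
- exact: model_stratified_all.
- case e : m => [|k] //=.
  have sub : forall i, A i -> J i = (k.+1 - 2 * d i)%N by move=> i _; rewrite /stratum_dim e.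
  have XA j x : (forall i, A i -> (j < J i)%N -> (iota x).1 0 i = 0) -> X j x.
    move=> H i ji; have [Ai|nAi] := boolP (A i); first exact: H.
    have [a [t [[[_ aA _] _] _ ->]]] := embedded_point_repr x.
    by apply: contrapT => /eqP/aA; rewrite (negbTE nAi).
  case: k e sub => [|k] e sub /=.
    apply/seteqP; split=> // x Xx.
    have [a [t [[[_ aA _] a1] _ ex]]] := embedded_point_repr x.
    move/eqP: a1; rewrite /wsum big1 ?(eq_sym 0) ?oner_eq0// => i _.
    apply: contrapT => /eqP ai; have Ai := aA _ ai.
    have := Xx i; rewrite sub// ex /= => H; move/eqP: ai; apply; apply: H.
    by have := dM Ai; have := dW Ai; lia.
  apply/seteqP; split=> x Xx; apply: XA => i Ai; rewrite sub// => ki; apply: Xx;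
    rewrite sub//; lia.
- exact: model_dense.
Qed.

End Bundle.

(** * The toric variety as a model *)

Section TorusQuotient.
Variables (R : realType) (n : nat).

Lemma torus_piE (x y : 'rV[R]_n) : torus_pi x = torus_pi y <-> is_integral (x - y).
Proof.
split=> [/eqmodP/asboolP[z e]|[z e]]; first by exists z.
by apply/eqmodP/asboolP; exists z.
Qed.

Lemma torus_pi_repr (t : torus R n) : torus_pi (repr t) = t.
Proof. exact: reprK. Qed.

Lemma repr_torus_pi (x : 'rV[R]_n) : is_integral (repr (torus_pi x) - x).
Proof. by apply/torus_piE; rewrite torus_pi_repr. Qed.

Lemma torus_pi_continuous : continuous (@torus_pi R n).
Proof. exact: (@pi_continuous _ (torus R n)). Qed.

Lemma torus_compact : compact [set: torus R n].
Proof.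
have -> : [set: torus R n] = @torus_pi R n @` unit_box 0.
  apply/seteqP; split=> // t _; have [y By ty] := unit_box_repr 0 (repr t).
  by exists y => //; rewrite -[t]torus_pi_repr; apply/esym/torus_piE.
apply: continuous_compact; last exact: unit_box_compact.
exact/continuous_subspaceT/torus_pi_continuous.
Qed.

Lemma torus_lift_continuous (Z : topologicalType) (f : 'rV[R]_n -> Z) :
  continuous f -> (forall x y, is_integral (x - y) -> f x = f y) ->
  continuous (fun t : torus R n => f (repr t)).
Proof.
move=> cf fI; apply: (@repr_comp_continuous _ (torus R n) _ f cf) => x y /eqP xy.
by apply/eqP/fI/torus_piE.
Qed.

(** Up to an integral vector, x - y is in the span of U exactly when its
    component along lproj' is integral. *)
Lemma same_coset_integral (U : split_lattice n) (W : {vspace 'rV[R]_n}) x y :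
  (forall z, (z \in W) <-> in_lat U z) ->
  (same_coset W (torus_pi x) (torus_pi y) <-> is_integral ((x - y) *m lproj' R U)).
Proof.
move=> WU; split=> [[x' [v [/WU Uv /torus_piE xx /torus_piE yy]]]|xy].
  have -> : (x - y) *m lproj' R U =
      ((x - x') - (y - (x' + v))) *m lproj' R U - v *m lproj' R U.
    by rewrite -mulmxBl; congr (_ *m _); apply/rowP => i; rewrite !mxE; ring.
  have -> : v *m lproj' R U = 0 by rewrite mulmxBr mulmx1 Uv subrr.
  by rewrite subr0; apply: is_integral_lproj'; exact: is_integralB.
exists x, (- ((x - y) *m lproj R U)); split=> //.
  by rewrite memvN; apply/WU; exact: in_lat_proj.
apply/torus_piE; rewrite -[is_integral _]/(is_integral _).
have -> : y - (x - (x - y) *m lproj R U) = 0 - (x - y) *m lproj' R U.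
  rewrite [in RHS]mulmxBr mulmx1; apply/rowP => i; rewrite !mxE; ring.
by apply: is_integralB => //; exact: is_integral0.
Qed.

End TorusQuotient.

Section Polytope.
Variables (R : realType) (N : nat) (le : rel 'I_N).
Hypotheses (le_refl : reflexive le) (le_trans : transitive le).
Hypothesis le_anti : antisymmetric le.
Variables (P : topologicalType) (p0 : P) (F : 'I_N -> set P).
Variable rk : 'I_N -> nat.
Hypothesis lt_rk : forall i j, lt le i j -> (rk i < rk j)%N.
Variable h : P -> 'rV[R]_N.
Hypotheses (cP : compact [set: P]) (hc : continuous h) (hI : injective h)
  (hE : range h = simplex le predT)
  (hF : forall i x, F i x <-> forall j, h x 0 j != 0 -> le i j).

(** The face with x in its interior is the smallest vertex of the simplex that
    carries h x. *)
Lemma face_openE i x : face_open le predT i (h x) <-> F i x /\ ~ cell_bd le F i x.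
Proof.
have sx : simplex le predT (h x) by rewrite -hE; exists x.
split=> [[_ xi ile]|[Fx nx]].
  split; first exact/hF.
  by move=> [j /(belowNle le_anti) /negP ji /hF Fj]; apply: ji; exact: Fj.
have ile := (hF i x).1 Fx; split=> //.
have [cx _] := sx; have [j [xj jle]] := chain_bottom le_refl lt_rk cx (simplex_neq0 sx).
have [->//|ij] := eqVneq i j; case: nx; exists j; first exact: le_below (ile _ xj) ij.
exact/hF.
Qed.

(** Open cells are open balls. *)
Lemma face_open_euclidean i k f g :
  hom_on (unit_disc R k) (F i) f g ->
  (forall y, unit_disc R k y -> (unit_sphere R k y <-> cell_bd le F i (f y))) ->
  loc_euclidean R k (face_open (R := R) le predT i).
Proof.
move=> fg bd; have hN : hausdorff_space 'rV[R]_N by exact: norm_hausdorff.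
have [q hq] := compact_injection_hom p0 hN cP hc hI; rewrite hE in hq.
have [_ _ _ qh] := hq.
pose B := [set y : 'rV[R]_k | sqnorm y < 1].
have Bdisc y : B y -> unit_disc R k y by move=> /ltW.
have oB : open B.
  have cs : continuous (@sqnorm R k).
    by apply: cont_on_setT; apply: cont_on_sqnorm; exact: cont_on_id.
  exact: (open_comp (fun x _ => cs x) (@open_lt R 1)).
have H1 : hom_on (face_open (R := R) le predT i) [set x | F i x /\ ~ cell_bd le F i x] q h.
  apply: (hom_on_sub (hom_on_sym hq)) => //.
  - by move=> a [].
  - by move=> a fa; have [sa _ _] := fa; have [_ e] := qh _ sa; apply/face_openE; rewrite e.
  - by move=> x /face_openE.
have [_ _ F1 F2] := fg.
have H2 : hom_on [set x | F i x /\ ~ cell_bd le F i x] B g f.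
  apply: (hom_on_sub (hom_on_sym fg)) => //.
  - by move=> x [].
  - move=> x [Fx nx]; have [dx e] := F2 _ Fx; rewrite /B /= lt_neqAle dx andbT.
    by apply/eqP => /(bd _ dx).1; rewrite e.
  - move=> y By; have dy := Bdisc _ By; split; first by case: (F1 _ dy).
    by move=> /(bd _ dy).2 => e; move: By; rewrite /B /= /sqnorm e ltxx.
exact: (loc_euclidean_hom (hom_on_comp H1 H2) (loc_euclidean_open oB)).
Qed.

End Polytope.

Section ToricEmbedding.
Variables (R : realType) (n N : nat) (le : rel 'I_N).
Variable V : 'I_N -> split_lattice n.
Hypotheses (le_refl : reflexive le) (le_trans : transitive le).
Hypothesis le_anti : antisymmetric le.
Hypothesis leV : forall i j, le i j -> lproj R (V i) *m lproj R (V j) = lproj R (V i).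
Hypothesis dlt : forall i j, lt le i j -> (ldim (V i) < ldim (V j))%N.
Variables (P : topologicalType) (faces : set (set P)) (delta : set P -> set 'rV[R]_n).
Variable F : 'I_N -> set P.
Hypotheses (F_faces : forall i, faces (F i))
  (F_surj : forall G, faces G -> exists i, F i = G).
Hypothesis delta_span : forall i z, (z \in lin_span (delta (F i))) <-> in_lat (V i) z.
Hypothesis F_bd : forall i, face_bd faces (F i) = cell_bd le F i.
Hypothesis F_int : forall x, exists i, F i x /\ ~ cell_bd le F i x.
Variable h : P -> 'rV[R]_N.
Hypotheses (hc : continuous h) (hI : injective h)
  (hE : range h = simplex le predT)
  (hF : forall i x, F i x <-> forall j, h x 0 j != 0 -> le i j).

Let T := toric_variety faces delta.

Definition toric_emb (z : T) : model_space R n N :=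
  Phi V (h (repr z).1) (repr (repr z).2).

(** The coset condition at the smallest vertex of the support of h p implies
    those at the other vertices. *)
Lemma toric_pair_emb (a b : P * torus R n) : 
  \pi_T a = \pi_T b -> Phi V (h a.1) (repr a.2) = Phi V (h b.1) (repr b.2).
Proof.
move=> /eqmodP/asboolP[ab H]; apply/Phi_eq; split; first by rewrite ab.
have [l [Fl nl]] := F_int a.1; have [_ _ lle] := (face_openE le_refl le_anti dlt hE hF _ _).2 (conj Fl nl).
have /(same_coset_integral _ _ (delta_span l)) Il : same_coset (lin_span (delta (F l)))
    (torus_pi (repr a.2)) (torus_pi (repr b.2)).
  by rewrite !torus_pi_repr; apply: H => //; split=> //; rewrite F_bd.
move=> i /lle li; rewrite -(leQ' leV li) mulmxA.
exact: is_integral_lproj'.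
Qed.

Lemma toric_emb_pi p x : toric_emb (\pi_T (p, torus_pi x)) = Phi V (h p) x.
Proof.
rewrite /toric_emb (@toric_pair_emb _ (p, torus_pi x)) ?reprK//=.
by apply: Phi_integral; exact: repr_torus_pi.
Qed.

Lemma toric_emb_injective : injective toric_emb.
Proof.
move=> z w /Phi_eq[/hI e tt]; rewrite -[z]reprK -[w]reprK.
apply/eqmodP/asboolP; split=> // G /F_surj[i <-] [Fi]; rewrite F_bd => ni.
have [_ ii _] := (face_openE le_refl le_anti dlt hE hF _ _).2 (conj Fi ni).
rewrite -[(repr z).2]torus_pi_repr -[(repr w).2]torus_pi_repr.
by apply/(same_coset_integral _ _ (delta_span i)); exact: tt.
Qed.

Lemma toric_emb_continuous : continuous toric_emb.
Proof.
pose g (a : P * torus R n) : model_space R n N := Phi V (h a.1) (repr a.2).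
apply: (@repr_comp_continuous _ T _ g); last first.
  by move=> a b /eqP ab; apply/eqP; exact: toric_pair_emb.
apply: cont_on_setT.
have c1 : cont_on [set: P * torus R n] (fun a => h a.1).
  by apply: (cont_on_comp_continuous (g := h)) => //; apply: (cont_on_fst (f := id)); exact: cont_on_id.
have c2 (f : R -> R) i k : continuous f -> (forall x y, (exists z : int, x - y = z%:~R) -> f x = f y) ->
    cont_on [set: P * torus R n] (fun a => f ((repr a.2 *m lproj' R (V i)) 0 k)).
  move=> cf fI.
  apply: (cont_on_comp_continuous (f := snd)
    (g := fun t : torus R n => f ((repr t *m lproj' R (V i)) 0 k))).
    exact: cont_on_proj2.
  apply: (torus_lift_continuous (f := fun x => f ((x *m lproj' R (V i)) 0 k))).
    apply: cont_on_setT; apply: cont_on_comp_continuous cf.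
    by apply: cont_on_coord; apply: cont_on_mulmx; exact: cont_on_id.
  move=> x y xy; apply: fI.
  have /is_integralP/(_ k)[z e] := is_integral_lproj' (V i) xy.
  by exists z; rewrite -e mulmxBl !mxE.
have c3 (f : R -> R) i k : continuous f ->
    (forall x y, (exists z : int, x - y = z%:~R) -> f x = f y) ->
    cont_on [set: P * torus R n]
      (fun a => (\matrix_(i, k) (h a.1 0 i * f ((repr a.2 *m lproj' R (V i)) 0 k))) i k : R).
  move=> cf fI.
  apply: (@cont_on_eq _ _ _ (fun a : P * torus R n => h a.1 0 i * f ((repr a.2 *m lproj' R (V i)) 0 k))).
    by move=> x _; rewrite mxE.
  by apply: cont_onM; [exact: cont_on_coord|exact: c2].
apply: cont_on_pair => //; apply: cont_on_pair; apply: cont_on_mx => i k.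
  apply: (c3 (@circle_cos R)); first exact: circle_cos_continuous.
  by move=> x y /circle_eq[].
apply: (c3 (@circle_sin R)); first exact: circle_sin_continuous.
by move=> x y /circle_eq[].
Qed.

Lemma toric_emb_range (W : split_lattice n) : (forall x : 'rV[R]_n, in_lat W x) ->
  range toric_emb = stratum_space le V predT W.
Proof.
move=> W1; apply/seteqP; split=> [_ [z _ <-]|_ [a [t [sa _ ->]]]].
  by exists (h (repr z).1), (repr (repr z).2); split=> //; rewrite -hE; exists (repr z).1.
have [p _ <-] : range h a by rewrite hE.
by exists (\pi_T (p, torus_pi t)) => //; exact: toric_emb_pi.
Qed.

Lemma toric_compact : compact [set: P] -> compact [set: T].
Proof.
move=> cP; have -> : [set: T] = (\pi_T : P * torus R n -> T) @` [set: P * torus R n].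
  by apply/seteqP; split=> // z _; exists (repr z) => //; rewrite reprK.
apply: continuous_compact; first exact/continuous_subspaceT/(@pi_continuous _ T).
have -> : [set: P * torus R n] = [set: P] `*` [set: torus R n] by apply/seteqP; split.
by apply: compact_setX => //; exact: torus_compact.
Qed.

End ToricEmbedding.

Lemma finite_enum (T : eqType) (A : set T) : finite_set A ->
  exists N (c : 'I_N -> T), [/\ injective c, forall i, A (c i) &
    forall x, A x -> exists i, c i = x].
Proof.
move=> /finite_seqP[s ->]; exists (size (undup s)), (tnth (in_tuple (undup s))); split.
- by apply/tuple_uniqP; exact: undup_uniq.
- by move=> i /=; rewrite -mem_undup; exact: mem_tnth.
- move=> x /=; rewrite -mem_undup => xs; have /tnthP[i ->] : x \in in_tuple (undup s) by [].
  by exists i.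
Qed.

(** The functional that is positive on the generators of a cone cuts out the
    apex as a face. *)
Lemma fan_zero_cone (R : realType) n (Sigma : set (set 'rV[R]_n)) :
  complete_fan Sigma -> Sigma [set 0].
Proof.
move=> fanS; have [sigma Ss] := fan_nonempty fanS.
have [s [sE _ [u us]]] := fan_cones fanS Ss.
apply: (fan_faces fanS Ss); exists u.
  move=> x; rewrite sE => -[a a0 ->]; rewrite dotrv_sumr big_seq.
  by apply: sumr_ge0 => v vs; rewrite dotrvZr mulr_ge0// ltW// us.
apply/seteqP; split=> [x ->|x [+ /= ux]].
  by split; [rewrite sE; exact: cone_hull0|exact: dotrv0r].
rewrite sE => -[a a0 xE]; move: ux; rewrite {1}xE dotrv_sumr big_seq => /eqP.
rewrite psumr_eq0; last by move=> v vs; rewrite dotrvZr mulr_ge0// ltW// us.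
move=> /allP H; rewrite /= xE big_seq big1// => v vs.
have := H v vs; rewrite vs dotrvZr /= mulf_eq0 => /orP[/eqP->|/eqP e]; first by rewrite scale0r.
by have := us v vs; rewrite e ltxx.
Qed.

Lemma full_splitK n : (1%:M : 'M[int]_n) *m 1%:M = 1%:M.
Proof. exact: mulmx1. Qed.

Definition full_lattice n : split_lattice n := SplitLattice (full_splitK n).

Lemma lproj_full (R : realType) n : lproj R (full_lattice n) = 1%:M.
Proof. by rewrite /lproj /= mulmx1 map_mx1. Qed.

Lemma in_lat_full (R : realType) n (x : 'rV[R]_n) : in_lat (full_lattice n) x.
Proof. by rewrite /in_lat/= lproj_full mulmx1. Qed.

Theorem proposition19 (R : realType) (n : nat)
    (Sigma : set (set 'rV[R]_n)) (hSigma : complete_fan Sigma)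
    (P : topologicalType) (faces : set (set P))
    (delta : set P -> set 'rV[R]_n) (hP : dual_polytope Sigma faces delta) :
  pseudomanifold R (2 * n)%N (toric_filtration faces delta) /\
  trivial_link_bundle R (2 * n)%N (toric_filtration faces delta).
Proof.
have [N [c [cI cS cSurj]]] := finite_enum (fan_finite hSigma).
have /choice[gens gensE] : forall i, exists s, c i = cone_hull s.
  by move=> i; have [s [? _ _]] := fan_cones hSigma (cS i); exists s.
have /choice[V VE] : forall i, exists U : split_lattice n,
    (forall x, c i x -> in_lat U x) /\
    (forall k (A : 'M[R]_(n, k)), (forall x, c i x -> x *m A = 0) ->
       forall x, in_lat U x -> x *m A = 0).
  by move=> i; rewrite gensE; exact: cone_lattice.
have V_sub i := (VE i).1; have V_span i := (VE i).2.
(* The vertices of the model are the cones, ordered by inclusion; F i will be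
   the face dual to c i, and V i the lattice of c i. *)
pose le := fan_le c.
have le_refl : reflexive le := fan_le_refl c.
have le_trans : transitive le := @fan_le_trans _ _ _ c.
have le_anti : antisymmetric le := fan_le_anti cI.
have leV : forall i j, le i j -> lproj R (V i) *m lproj R (V j) = lproj R (V i).
  by move=> i j; exact: fan_leV.
have dlt : forall i j, lt le i j -> (ldim (V i) < ldim (V j))%N.
  by move=> i j; exact: (fan_dlt hSigma cI cS gensE V_sub V_span).
have dle i j : le i j -> (ldim (V i) <= ldim (V j))%N.
  by move=> ij; have [->//|ne] := eqVneq i j; apply/ltnW/dlt/le_below.
have adm_below s : (0 < ldim (V s))%N ->
    admissible R le V (below le s) (V s) (ldim (V s)).-1.
  exact: (below_admissible hSigma cI cS cSurj gensE V_sub V_span).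
have [disc [discg [cdisc cdiscg discK _]]] := dual_disc hP.
have cP : compact [set: P].
  have -> : [set: P] = discg @` [set: unit_disc R n].
    by apply/seteqP; split=> // p _; exists (disc p).
  apply: continuous_compact; first exact: continuous_subspaceT.
  exact/compact_set_type/unit_disc_compact.
have d0 : unit_disc R n 0.
  rewrite /unit_disc /= big1 ?ler01// => i _; by rewrite mxE expr0n.
pose p0 := discg (elt_of d0).
have [hausP _ cells cover] := dual_complex hP.
have [dfun dinj dsurj] := dual_bij hP.
have /choice[F FE] : forall i, exists G, faces G /\ delta G = c i.
  by move=> i; have [G ? ?] := dsurj _ (cS i); exists G.
have F_faces i := (FE i).1; have deltaF i : delta (F i) = c i := (FE i).2.
have F_surj G : faces G -> exists i, F i = G.
  move=> fG; have [i ci] := cSurj _ (dfun _ fG); exists i.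
  by apply: dinj; rewrite ?inE// deltaF.
have F_le i j : F j `<=` F i <-> le i j.
  rewrite (dual_anti hP (F_faces j) (F_faces i)) !deltaF.
  by split=> [?|/fan_leP//]; apply/fan_leP.
have F_bd i : face_bd faces (F i) = cell_bd le F i.
  apply/seteqP; split=> [x [_ [/F_surj[j <-] [ji ij]] Fx]|x [j ij Fx]].
    exists j => //; apply: le_below; first exact/F_le.
    by apply/eqP => e; apply: ij; rewrite e.
  exists (F j) => //; split=> //; split; first exact/F_le/below_le.
  by move/F_le; apply/negP; exact: belowNle.
have F_dim i k : is_cell R faces k (F i) -> (k + ldim (V i) = n)%N.
  by move=> /(dual_dim hP (F_faces i)); rewrite deltaF (dim_lin_span V_sub V_span).
have F_disc i k : is_cell R faces k (F i) -> exists (f : 'rV[R]_k -> P) g,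
    hom_on (unit_disc R k) (F i) f g /\
    forall y, unit_disc R k y -> (unit_sphere R k y <-> cell_bd le F i (f y)).
  move=> [f [homf fbd]]; have [f' [g' [fg' f'E]]] := homeomorphism_hom_on (0 : 'rV[R]_k) p0 homf.
  have [q [_ _ fK _]] := homf.
  exists f', g'; split=> // y dy; rewrite -F_bd -(set_val_elt dy) f'E.
  split=> [Sy|bdy].
    have : (f @` [set x | unit_sphere R k (set_val x)]) (f (elt_of dy)) by exists (elt_of dy).
    by rewrite fbd.
  have : [set y | face_bd faces (F i) (set_val y)] (f (elt_of dy)) by [].
  rewrite -fbd => -[x Sx fx]; have <- // : x = elt_of dy.
  exact: (can_inj fK).
have F_anti i j : le i j -> F j `<=` F i by move/F_le.
have F_cell i : exists k (f : 'rV[R]_k -> P) g, hom_on (unit_disc R k) (F i) f g /\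
    forall y, unit_disc R k y -> (unit_sphere R k y <-> cell_bd le F i (f y)).
  by have [k /F_disc] := cells _ (F_faces i); exists k.
have F_int x : exists i, F i x /\ ~ cell_bd le F i x.
  have [G [[/F_surj[i <-] [Fx nx]] _]] := cover x.
  by exists i; rewrite -F_bd.
have F_uniq x i j : F i x -> ~ cell_bd le F i x -> F j x -> ~ cell_bd le F j x -> i = j.
  move=> Fi ni Fj nj; have [G [_ uG]] := cover x.
  apply: cI; rewrite -!deltaF -(uG (F i)) ?(uG (F j))//; split=> //; split=> //; by rewrite F_bd.
have [h [hc hI hE hF]] :=
  cell_complex_model le_refl le_trans le_anti dlt hausP F_anti F_cell F_int F_uniq.
have adm : admissible R le V predT (full_lattice n) n.
  split=> // [i _|i _|i _]; first by rewrite lproj_full mulmx1.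
    have [k /F_dim dk] := cells _ (F_faces i).
    by apply: leq_trans (leq_addl k _) _; rewrite dk.
  have [k ck] := cells _ (F_faces i); have [f [g [fg bd]]] := F_disc _ _ ck.
  have -> : (n - ldim (V i) = k)%N by have := F_dim _ _ ck; lia.
  exact: (face_open_euclidean le_refl le_anti p0 dlt cP hc hI hE hF fg bd).
have span i z : (z \in lin_span (delta (F i))) <-> in_lat (V i) z.
  by rewrite deltaF; exact: mem_lin_span.
pose iota := toric_emb V h : toric_variety faces delta -> _.
have iotac : continuous iota := toric_emb_continuous le_refl le_anti leV dlt F_faces span F_bd F_int hc hE hF.
have iotaI : injective iota := toric_emb_injective le_refl le_anti dlt F_surj span F_bd hI hE hF.
have iotaE : range iota = stratum_space le V predT (full_lattice n).
  exact: (toric_emb_range le_refl le_anti leV dlt F_faces span F_bd F_int hE hF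
    (@in_lat_full R n)).
have cT : compact [set: toric_variety faces delta] by exact: toric_compact.
(* A face F i has dimension n - ldim (V i), half the dimension of its stratum. *)
have filtE : toric_filtration faces delta =
    fun k => iota @^-1` model_filtration V (full_lattice n) n k.
  apply/funext => k; apply/seteqP; split=> x.
    move=> [_ [/F_surj[i <-] [j jk /F_dim di]] Fx] l kl.
    apply: contrapT => /eqP xl; have := (hF i _).1 Fx l xl => /dle.
    by move: kl jk; rewrite /stratum_dim /=; lia.
  move=> Xx; have [i [Fx nx]] := F_int (toric_proj x).
  have [_ xi _] := (face_openE le_refl le_anti dlt hE hF _ _).2 (conj Fx nx).
  exists (F i) => //; split=> //; have [j cj] := cells _ (F_faces i).
  exists j => //; have := F_dim _ _ cj; rewrite leqNgt => dj; apply/negP => kj.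
  move/eqP: xi; apply; apply: Xx; rewrite /stratum_dim /=.
  by move: kj dj; lia.
have [i0 i0E] := cSurj _ (fan_zero_cone hSigma).
have i0_le i : le i0 i.
  by apply/fan_leP; rewrite i0E => x ->; rewrite gensE; exact: cone_hull0.
have d0' : ldim (V i0) = 0%N.
  rewrite -(dim_lin_span V_sub V_span); apply/eqP; rewrite dimv_eq0 -subv0.
  apply/subvP => x /(mem_lin_span V_sub V_span) Vx; rewrite memv0 -(mulmx1 x).
  by apply/eqP; apply: (V_span i0 _ 1%:M) Vx => y; rewrite i0E => ->; rewrite mul0mx.
rewrite filtE mul2n -addnn; split.
  exact: (model_pseudomanifold le_refl le_trans le_anti leV dlt adm_below adm
    cT iotac iotaI iotaE (i0 := i0) isT (fun i _ => i0_le i) d0').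
exact: (model_trivial_link_bundle le_refl le_trans le_anti leV dlt adm_below adm cT iotac iotaI iotaE).
Qed.
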